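(* Let $f\in\mathcal{M}_S$ and let $p\geq 3$ be an integer. Then $f$ has only finitely many $p$-periodic Herman rings.
   Context: A general transcendental meromorphic function is a meromorphic function $f:\mathbb{C}\to\widehat{\mathbb{C}}$ whose only essential singularity is at $\infty$ and which has either at least two poles or exactly one pole that is not an omitted value. The Fatou set $\mathcal{F}(f)$ is the set of points having a neighbourhood on which all iterates $f^n$ are defined and form a normal family; the Julia set $\mathcal{J}(f)$ is its complement (so $\infty\in\mathcal{J}(f)$). A point $b\in\mathbb{C}$ is an omitted value if $f(z)\neq b$ for all $z\in\mathbb{C}$. A Baker omitted value (bov) is an omitted value $b$ for which there is a disk $D$ centred at $b$ such that each component of the boundary of $f^{-1}(D)$ is bounded. The bov is stable if all iterates $f^n$ are defined (analytic) in a neighbourhood of it. $\mathcal{M}_S$ is the class of general transcendental meromorphic functions having a stable bov. A Fatou component $V$ is $p$-periodic if $f^p(V)\subseteq V$ (with $p$ minimal); a $p$-periodic Fatou component $V$ is a Herman ring if there is a conformal map $\phi:V\to\{1<|z|<r\}$ with $\phi\circ f^p\circ\phi^{-1}(z)=e^{2\pi i\theta}z$ for some irrational $\theta$. *)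

(* Defs.v *)
From Stdlib Require Import Reals List ZArith.
From Coquelicot Require Import Coquelicot.
Open Scope R_scope.

(* Sphere-valued functions; None stands for the point at infinity. *)
Definition sphere := option C.

Definition ball_C (z0 : C) (r : R) (z : C) : Prop := Cmod (z - z0)%C < r.

Definition C_holo_at (g : C -> C) (z : C) : Prop :=
  ex_derive (K := C_AbsRing) (V := C_NormedModule) g z.

(* f : C -> C^ is meromorphic (holomorphic into the sphere) near z0:
   either f is finite and holomorphic near z0, or z0 is a pole, i.e. 1/f
   extends holomorphically near z0, vanishing only at z0. *)
Definition merom_at (f : C -> sphere) (z0 : C) : Prop :=
  exists r, 0 < r /\ exists g : C -> C,
    (forall z, ball_C z0 r z -> C_holo_at g z) /\
    ((forall z, ball_C z0 r z -> f z = Some (g z)) \/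
     (f z0 = None /\ g z0 = 0%C /\
      forall z, ball_C z0 r z -> z <> z0 -> g z <> 0%C /\ f z = Some (/ g z)%C)).

Definition meromorphic (f : C -> sphere) : Prop := forall z0, merom_at f z0.

Definition essential_at_infinity (f : C -> sphere) : Prop :=
  ~ exists F : C -> sphere, merom_at F 0%C /\ forall w, w <> 0%C -> F w = f (/ w)%C.

Definition is_pole (f : C -> sphere) (z : C) : Prop := f z = None.

Definition omitted_value (f : C -> sphere) (b : C) : Prop := forall z, f z <> Some b.

Definition general_tmf (f : C -> sphere) : Prop :=
  meromorphic f /\ essential_at_infinity f /\
  ((exists z1 z2, z1 <> z2 /\ is_pole f z1 /\ is_pole f z2) \/
   (exists z0, is_pole f z0 /\ (forall z, is_pole f z -> z = z0) /\
               ~ omitted_value f z0)).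

(* iterates: fiter f n z = f^n(z); None if f^n(z) = infinity or undefined *)
Fixpoint fiter (f : C -> sphere) (n : nat) (z : C) : sphere :=
  match n with
  | O => Some z
  | S m => match fiter f m z with Some w => f w | None => None end
  end.

Definition chord (a b : sphere) : R :=
  match a, b with
  | Some z, Some w => 2 * Cmod (z - w)%C / (sqrt (1 + Cmod z ^ 2) * sqrt (1 + Cmod w ^ 2))
  | Some z, None | None, Some z => 2 / sqrt (1 + Cmod z ^ 2)
  | None, None => 0
  end.

Definition normal_iterates (f : C -> sphere) (U : C -> Prop) : Prop :=
  forall s : nat -> nat, exists phi : nat -> nat,
    (forall k, (phi k < phi (S k))%nat) /\
    exists h : C -> sphere,
      forall z0, U z0 -> exists r, 0 < r /\ (forall z, ball_C z0 r z -> U z) /\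
        forall eps, 0 < eps -> exists N, forall k, (N <= k)%nat ->
          forall z, ball_C z0 r z -> chord (fiter f (s (phi k)) z) (h z) < eps.

(* Fatou set (as a subset of C; infinity always lies in the Julia set) *)
Definition fatou (f : C -> sphere) (z : C) : Prop :=
  exists r, 0 < r /\ (forall n w, ball_C z r w -> fiter f n w <> None) /\
            normal_iterates f (ball_C z r).

Definition open_C (A : C -> Prop) : Prop :=
  forall z, A z -> exists r, 0 < r /\ forall w, ball_C z r w -> A w.

Definition connected_C (S : C -> Prop) : Prop :=
  forall A B : C -> Prop, open_C A -> open_C B ->
    (forall z, S z -> A z \/ B z) ->
    (exists z, S z /\ A z) -> (exists z, S z /\ B z) ->
    exists z, S z /\ A z /\ B z.

Definition comp_of (S : C -> Prop) (z : C) (w : C) : Prop :=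
  exists T : C -> Prop, (forall u, T u -> S u) /\ connected_C T /\ T z /\ T w.

Definition is_component (S V : C -> Prop) : Prop :=
  exists z, S z /\ forall w, V w <-> comp_of S z w.

Definition bounded_C (V : C -> Prop) : Prop := exists M, forall w, V w -> Cmod w <= M.

Definition closure_C (A : C -> Prop) (z : C) : Prop :=
  forall r, 0 < r -> exists w, ball_C z r w /\ A w.
Definition interior_C (A : C -> Prop) (z : C) : Prop :=
  exists r, 0 < r /\ forall w, ball_C z r w -> A w.
Definition boundary_C (A : C -> Prop) (z : C) : Prop :=
  closure_C A z /\ ~ interior_C A z.

Definition baker_omitted_value (f : C -> sphere) (b : C) : Prop :=
  omitted_value f b /\
  exists eps, 0 < eps /\
    let preD := fun z => exists w, f z = Some w /\ ball_C b eps w in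
    forall V, is_component (boundary_C preD) V -> bounded_C V.

Definition stable_bov (f : C -> sphere) (b : C) : Prop :=
  baker_omitted_value f b /\
  exists r, 0 < r /\ forall n z, ball_C b r z -> fiter f n z <> None.

Definition class_MS (f : C -> sphere) : Prop :=
  general_tmf f /\ exists b, stable_bov f b.

Definition maps_into (f : C -> sphere) (q : nat) (V : C -> Prop) : Prop :=
  forall z, V z -> exists w, fiter f q z = Some w /\ V w.

Definition periodic_fatou_component (f : C -> sphere) (p : nat) (V : C -> Prop) : Prop :=
  is_component (fatou f) V /\ (1 <= p)%nat /\ maps_into f p V /\
  forall q, (1 <= q < p)%nat -> ~ maps_into f q V.

Definition irrational (t : R) : Prop :=
  ~ exists (a : Z) (b : positive), t = IZR a / IZR (Zpos b).

Definition herman_ring (f : C -> sphere) (p : nat) (V : C -> Prop) : Prop :=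
  periodic_fatou_component f p V /\
  exists (r theta : R) (phi : C -> C),
    1 < r /\ irrational theta /\
    (forall z, V z -> C_holo_at phi z) /\
    (forall z w, V z -> V w -> phi z = phi w -> z = w) /\
    (forall z, V z -> 1 < Cmod (phi z) < r) /\
    (forall u, 1 < Cmod u < r -> exists z, V z /\ phi z = u) /\
    (forall z, V z -> exists w, fiter f p z = Some w /\
        phi w = (Cmult (cos (2 * PI * theta), sin (2 * PI * theta)) (phi z))).

(* Main.v *)
(** Let b be an omitted value of f, so that g = 1 / (f - b) is entire. Let H be a p-periodic Herman ring with an invariant
    core curve, and consider the inside of each image of this curve under f^j. If b is outside the image of a curve,
    the argument principle shows that f maps the inside of the curve bijectively onto the inside of the image; if b is
    inside the image, f maps the inside bijectively onto the outside, infinity included. If b were outside all the images,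
    the iterates would be bounded inside the curve and H would contain that inside, so b is inside the image for some j < p.
    Attach to H the set of such j. Two distinct rings with the same set have images which, for some j, both surround b,
    hence are nested; by the previous dichotomy f then maps the annulus between the two curves into the annulus between their
    images, at every step. All iterates are bounded on it, so it lies in the Fatou set and joins the two rings, which is
    absurd. Hence there are at most 2^p such rings. *)

Require Import Defs.
From Stdlib Require Import Reals List.
From Coquelicot Require Import Coquelicot.
From Stdlib Require Import ZArith Lra Lia Psatz Classical ClassicalEpsilon FunctionalExtensionality.
Open Scope R_scope.

(** * Continuity and complex differentiability *)

(** No Jordan curve theorem is involved: insides are defined by winding numbers, and the annulus
    around a core curve does the rest. On the ring the winding number is computed up to a constant
    and jumps by one period across the curve, so only two values occur in the plane. Image curves
    are again core curves of conformal annuli, because an iterate of f is injective on the ring as a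
    factor of a rotation. Having just two winding values, such a curve forces the zero count of the
    argument principle to be 0 or 1, which is where bijectivity comes from. Poles are avoided by
    counting zeros of the entire g; the Moebius map w -> 1 / (w - b) carries winding numbers from g
    back to f. Nestedness is first known at a time j0 when both curves surround b, and it propagates
    only forward; since the curves recur with period p, it reaches the rings themselves at time j0
    p. Separation arguments all compare two points under a predicate that is locally constant on the
    plane. The complex analysis rests on Goursat by bisection and on mean values over circles in
    place of general contours. *)

Lemma Cmod_sub_sym (a b : C) : Cmod (a - b) = Cmod (b - a).
Proof. rewrite <- Cmod_opp. f_equal. ring. Qed.

Lemma Cmod_sub_tri (a b c : C) : Cmod (a - c) <= Cmod (a - b) + Cmod (b - c).
Proof. replace (a - c)%C with ((a - b) + (b - c))%C by ring. apply Cmod_triangle. Qed.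

Lemma Cmod_tri_inv (a b : C) : Cmod a - Cmod b <= Cmod (a - b).
Proof.
  assert (H := Cmod_triangle (a - b) b). replace (a - b + b)%C with a in H by ring. lra.
Qed.

Lemma Cmod_sub_0 (a b : C) : Cmod (a - b) = 0 -> a = b.
Proof. intro H. apply Cmod_eq_0 in H. replace a with (a - b + b)%C by ring. rewrite H. ring. Qed.

Lemma Cmod_sub_pos (a b : C) : a <> b -> 0 < Cmod (a - b).
Proof.
  intro H. destruct (Cmod_ge_0 (a - b)) as [H1|H1]; auto.
  symmetry in H1. apply Cmod_sub_0 in H1. contradiction.
Qed.

Lemma im_le_Cmod (z : C) : Rabs (Im z) <= Cmod z.
Proof.
  apply Rle_trans with (Rmax (Rabs (fst z)) (Rabs (snd z))). apply Rmax_r. apply Rmax_Cmod.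
Qed.

Lemma Re_le_Cmod (z : C) : Re z <= Cmod z.
Proof. eapply Rle_trans. apply Rle_abs. apply re_le_Cmod. Qed.

Lemma Cmod_le_re_im (z : C) : Cmod z <= Rabs (Re z) + Rabs (Im z).
Proof.
  assert (E : z = (RtoC (Re z) + Ci * RtoC (Im z))%C).
  { destruct z as [x y]. unfold Cplus, Cmult, Ci, RtoC; simpl. f_equal; ring. }
  rewrite E at 1. eapply Rle_trans. apply Cmod_triangle. rewrite Cmod_mult, Cmod_Ci, !Cmod_R. lra.
Qed.

Lemma re_minus (a b : C) : Re (a - b) = Re a - Re b.
Proof. reflexivity. Qed.
Lemma im_minus (a b : C) : Im (a - b) = Im a - Im b.
Proof. reflexivity. Qed.

Lemma C_ext (a b : C) : Re a = Re b -> Im a = Im b -> a = b.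
Proof. destruct a, b. simpl. intros; subst; reflexivity. Qed.

Lemma RtoC_neq_0 (x : R) : x <> 0 -> RtoC x <> 0%C.
Proof. intros H H1. apply H. now apply RtoC_inj. Qed.

Lemma Csub_neq_0 (a b : C) : a <> b -> (a - b)%C <> 0%C.
Proof. intros H H1. apply H. now apply Ceq_minus. Qed.

(* The domain X is the plane or the real line, embedded in the plane by e; differentiability is in Caratheodory's form. *)
Definition idC (z : C) : C := z.

Definition cont {X : Type} (e : X -> C) (f : X -> C) (x : X) : Prop :=
  forall eps, 0 < eps -> exists del, 0 < del /\
    forall y, Cmod (e y - e x) < del -> Cmod (f y - f x) < eps.

Definition der {X : Type} (e : X -> C) (f : X -> C) (x : X) (l : C) : Prop :=
  exists psi : X -> C, cont e psi x /\ psi x = l /\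
    forall y, (f y - f x)%C = (psi y * (e y - e x))%C.

(** Differentiability at the single point [z]; analyticity is expressed by requiring it on a whole
    ball. *)
Definition holo (F : C -> C) (z : C) : Prop := exists l, der idC F z l.

Lemma cont_const {X} (e : X -> C) c x : cont e (fun _ => c) x.
Proof.
  intros eps He. exists 1. split. lra. intros. replace (c - c)%C with (RtoC 0) by ring. now rewrite Cmod_0.
Qed.

Lemma cont_e {X} (e : X -> C) x : cont e e x.
Proof. intros eps He. exists eps. auto. Qed.

Lemma cont_id z : cont idC (fun z => z) z.
Proof. intros eps He. exists eps. auto. Qed.

Lemma cont_plus {X} (e : X -> C) f g x : cont e f x -> cont e g x -> cont e (fun y => f y + g y)%C x.
Proof.
  intros Hf Hg eps He. destruct (Hf (eps/2)) as [d1 [Hd1 H1]]. lra. destruct (Hg (eps/2)) as [d2 [Hd2 H2]]. lra.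
  exists (Rmin d1 d2). split. now apply Rmin_pos. intros y Hy.
  replace (f y + g y - (f x + g x))%C with ((f y - f x) + (g y - g x))%C by ring.
  eapply Rle_lt_trans. apply Cmod_triangle.
  assert (Cmod (f y - f x) < eps/2). { apply H1. eapply Rlt_le_trans. apply Hy. apply Rmin_l. }
  assert (Cmod (g y - g x) < eps/2). { apply H2. eapply Rlt_le_trans. apply Hy. apply Rmin_r. }
  lra.
Qed.

Lemma cont_mult {X} (e : X -> C) f g x : cont e f x -> cont e g x -> cont e (fun y => f y * g y)%C x.
Proof.
  intros Hf Hg eps He.
  set (A := Cmod (f x) + 1). set (B := Cmod (g x) + 1).
  assert (HA : 0 < A) by (unfold A; generalize (Cmod_ge_0 (f x)); lra).
  assert (HB : 0 < B) by (unfold B; generalize (Cmod_ge_0 (g x)); lra).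
  destruct (Hf (eps/(2*B))) as [d1 [Hd1 H1]]. apply Rdiv_lt_0_compat; lra.
  destruct (Hg (Rmin 1 (eps/(2*A)))) as [d2 [Hd2 H2]]. apply Rmin_pos. lra. apply Rdiv_lt_0_compat; lra.
  exists (Rmin d1 d2). split. now apply Rmin_pos. intros y Hy.
  replace (f y * g y - f x * g x)%C with ((f y - f x) * g y + f x * (g y - g x))%C by ring.
  assert (K1 : Cmod (f y - f x) < eps/(2*B)). { apply H1. eapply Rlt_le_trans. apply Hy. apply Rmin_l. }
  assert (K2 : Cmod (g y - g x) < Rmin 1 (eps/(2*A))). { apply H2. eapply Rlt_le_trans. apply Hy. apply Rmin_r. }
  assert (K3 := Rmin_l 1 (eps/(2*A))). assert (K4 := Rmin_r 1 (eps/(2*A))).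
  eapply Rle_lt_trans. apply Cmod_triangle. rewrite !Cmod_mult.
  assert (K5 : Cmod (g y) <= B). { generalize (Cmod_tri_inv (g y) (g x)). unfold B. lra. }
  assert (K6 : Cmod (f y - f x) * Cmod (g y) <= eps/(2*B) * B).
  { apply Rmult_le_compat; try apply Cmod_ge_0; lra. }
  assert (K7 : Cmod (f x) * Cmod (g y - g x) <= Cmod (f x) * (eps/(2*A))).
  { apply Rmult_le_compat_l; try apply Cmod_ge_0; lra. }
  assert (K8 : eps/(2*B) * B = eps/2) by (field; lra).
  assert (K9 : A * (eps/(2*A)) = eps/2) by (field; lra).
  assert (0 < eps/(2*A)) by (apply Rdiv_lt_0_compat; lra).
  assert (Cmod (f x) * (eps/(2*A)) < A * (eps/(2*A))).
  { apply Rmult_lt_compat_r; [assumption|unfold A; lra]. }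
  lra.
Qed.

Lemma cont_opp {X} (e : X -> C) f x : cont e f x -> cont e (fun y => - f y)%C x.
Proof.
  intros Hf eps He. destruct (Hf eps He) as [d [Hd H]]. exists d. split; auto. intros y Hy.
  replace (- f y - - f x)%C with (- (f y - f x))%C by ring. rewrite Cmod_opp. auto.
Qed.

Lemma cont_minus {X} (e : X -> C) f g x : cont e f x -> cont e g x -> cont e (fun y => f y - g y)%C x.
Proof. intros. apply cont_plus; auto. now apply cont_opp. Qed.

Lemma cont_inv {X} (e : X -> C) f x : cont e f x -> f x <> 0%C -> cont e (fun y => / f y)%C x.
Proof.
  intros Hf Hn eps He. apply Cmod_gt_0 in Hn as Hm. set (m := Cmod (f x)) in *.
  assert (Hmm : 0 < m * m) by (apply Rmult_lt_0_compat; auto).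
  assert (Hp : 0 < eps * (m * m / 2)) by (apply Rmult_lt_0_compat; lra).
  destruct (Hf (Rmin (m/2) (eps * (m*m/2)))) as [d [Hd H]]. apply Rmin_pos; lra.
  exists d. split; auto. intros y Hy. specialize (H y Hy).
  assert (K1 := Rmin_l (m/2) (eps * (m*m/2))). assert (K2 := Rmin_r (m/2) (eps * (m*m/2))).
  assert (K3 : m/2 < Cmod (f y)).
  { generalize (Cmod_tri_inv (f x) (f y)). rewrite Cmod_sub_sym. fold m. lra. }
  assert (Hy0 : f y <> 0%C) by (apply Cmod_gt_0; lra).
  replace (/ f y - / f x)%C with ((f x - f y) / (f y * f x))%C by (field; auto).
  rewrite Cmod_div, Cmod_mult by (apply Cmult_neq_0; auto). fold m.
  apply Rmult_lt_reg_r with (Cmod (f y) * m). nra.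
  unfold Rdiv. rewrite Rmult_assoc, Rinv_l, Rmult_1_r by nra. rewrite Cmod_sub_sym. nra.
Qed.

Lemma cont_div {X} (e : X -> C) f g x : cont e f x -> cont e g x -> g x <> 0%C -> cont e (fun y => f y / g y)%C x.
Proof. intros. apply cont_mult; auto. now apply cont_inv. Qed.

Lemma cont_comp {X} (e : X -> C) (F : C -> C) (f : X -> C) x :
  cont idC F (f x) -> cont e f x -> cont e (fun y => F (f y)) x.
Proof.
  intros HF Hf eps He. destruct (HF eps He) as [d [Hd H]]. destruct (Hf d Hd) as [d2 [Hd2 H2]].
  exists d2. split; auto. intros y Hy. apply H. apply H2; auto.
Qed.

Lemma cont_loc {X} (e : X -> C) f g x d : 0 < d -> (forall y, Cmod (e y - e x) < d -> f y = g y) ->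
  cont e f x -> cont e g x.
Proof.
  intros Hd Hfg Hf eps He. destruct (Hf eps He) as [d1 [Hd1 H]].
  exists (Rmin d d1). split. now apply Rmin_pos. intros y Hy.
  rewrite <- !Hfg. apply H. eapply Rlt_le_trans. apply Hy. apply Rmin_r.
  replace (e x - e x)%C with (RtoC 0) by ring. now rewrite Cmod_0.
  eapply Rlt_le_trans. apply Hy. apply Rmin_l.
Qed.

Lemma der_cont {X} (e : X -> C) f x l : der e f x l -> cont e f x.
Proof.
  intros [psi [H1 [H2 H3]]].
  assert (H : cont e (fun y => f x + psi y * (e y - e x))%C x).
  { apply cont_plus. apply cont_const. apply cont_mult; auto. apply cont_minus. apply cont_e. apply cont_const. }
  revert H. apply (cont_loc e _ _ x 1). lra. intros y _. rewrite <- H3. ring.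
Qed.

Lemma der_eq {X} (e : X -> C) f x l m : der e f x l -> l = m -> der e f x m.
Proof. intros H <-. exact H. Qed.

Lemma der_const {X} (e : X -> C) c x : der e (fun _ => c) x 0%C.
Proof. exists (fun _ => 0%C). split. apply cont_const. split; auto. intros. ring. Qed.

Lemma der_e {X} (e : X -> C) x : der e e x 1%C.
Proof. exists (fun _ => 1%C). split. apply cont_const. split; auto. intros. ring. Qed.

Lemma der_id z : der idC (fun z => z) z 1%C.
Proof. apply (der_e idC z). Qed.

Lemma der_plus {X} (e : X -> C) f g x l m :
  der e f x l -> der e g x m -> der e (fun y => f y + g y)%C x (l + m)%C.
Proof.
  intros [p [H1 [H2 H3]]] [q [G1 [G2 G3]]]. exists (fun y => p y + q y)%C. split.
  now apply cont_plus. split. congruence. intros y.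
  replace (f y + g y - (f x + g x))%C with ((f y - f x) + (g y - g x))%C by ring. rewrite H3, G3. ring.
Qed.

Lemma der_mult {X} (e : X -> C) f g x l m :
  der e f x l -> der e g x m -> der e (fun y => f y * g y)%C x (l * g x + f x * m)%C.
Proof.
  intros Hf Hg. assert (Cg := der_cont _ _ _ _ Hg).
  destruct Hf as [p [H1 [H2 H3]]]. destruct Hg as [q [G1 [G2 G3]]].
  exists (fun y => p y * g y + f x * q y)%C. split.
  apply cont_plus; apply cont_mult; auto. apply cont_const. split. congruence. intros y.
  replace (f y * g y - (f x * g x))%C with ((f y - f x) * g y + f x * (g y - g x))%C by ring. rewrite H3, G3. ring.
Qed.

Lemma der_opp {X} (e : X -> C) f x l : der e f x l -> der e (fun y => - f y)%C x (- l)%C.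
Proof.
  intros [p [H1 [H2 H3]]]. exists (fun y => - p y)%C. split. now apply cont_opp. split. congruence.
  intros y. replace (- f y - - f x)%C with (- (f y - f x))%C by ring. rewrite H3. ring.
Qed.

Lemma der_minus {X} (e : X -> C) f g x l m :
  der e f x l -> der e g x m -> der e (fun y => f y - g y)%C x (l - m)%C.
Proof. intros. apply der_plus; auto. now apply der_opp. Qed.

Lemma der_scal {X} (e : X -> C) c f x l : der e f x l -> der e (fun y => c * f y)%C x (c * l)%C.
Proof. intros H. eapply der_eq. apply der_mult. apply der_const. apply H. cbv beta. ring. Qed.

Lemma der_comp {X} (e : X -> C) (F : C -> C) (f : X -> C) x l m :
  der idC F (f x) m -> der e f x l -> der e (fun y => F (f y)) x (m * l)%C.
Proof.
  intros HF Hf. assert (Cf := der_cont _ _ _ _ Hf).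
  destruct HF as [q [G1 [G2 G3]]]. destruct Hf as [p [H1 [H2 H3]]].
  exists (fun y => q (f y) * p y)%C. split. apply cont_mult; auto. now apply cont_comp. split. congruence.
  intros y. rewrite G3. unfold idC. rewrite H3. ring.
Qed.

Lemma der_eps {X} (e : X -> C) f x l : der e f x l <->
  forall eps, 0 < eps -> exists del, 0 < del /\ forall y, Cmod (e y - e x) < del ->
    Cmod (f y - f x - l * (e y - e x)) <= eps * Cmod (e y - e x).
Proof.
  split.
  - intros [p [H1 [H2 H3]]] eps He. destruct (H1 eps He) as [d [Hd H]]. exists d. split; auto. intros y Hy.
    rewrite H3. replace (p y * (e y - e x) - l * (e y - e x))%C with ((p y - l) * (e y - e x))%C by ring.
    rewrite Cmod_mult. apply Rmult_le_compat_r. apply Cmod_ge_0. rewrite <- H2. left. auto.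
  - intros H.
    (* [e] is not assumed injective; the estimate itself, at increment 0, forces equal values, so
       the slope below is well defined. *)
    assert (H0 : forall y, e y = e x -> f y = f x).
    { intros y Hy. destruct (H 1 Rlt_0_1) as [d [Hd Hd']]. specialize (Hd' y).
      assert (K : (e y - e x)%C = 0%C) by (rewrite Hy; ring). rewrite K, Cmod_0 in Hd'. specialize (Hd' Hd).
      apply Cmod_sub_0. replace (f y - f x)%C with (f y - f x - l * 0)%C by ring.
      apply Rle_antisym. lra. apply Cmod_ge_0. }
    exists (fun y => if excluded_middle_informative (e y = e x) then l else (f y - f x) / (e y - e x))%C.
    split; [|split].
    + intros eps He. destruct (H (eps/2)) as [d [Hd Hd']]. lra. exists d. split; auto. intros y Hy.
      destruct (excluded_middle_informative (e x = e x)); [|contradiction].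
      destruct (excluded_middle_informative (e y = e x)) as [E|E].
      { replace (l - l)%C with (RtoC 0) by ring. now rewrite Cmod_0. }
      specialize (Hd' y Hy). assert (K := Cmod_sub_pos _ _ E). assert (K' := Csub_neq_0 _ _ E).
      replace ((f y - f x) / (e y - e x) - l)%C with ((f y - f x - l * (e y - e x)) / (e y - e x))%C by (field; auto).
      rewrite Cmod_div by auto. apply Rle_lt_trans with (eps/2); [|lra].
      apply Rmult_le_reg_r with (Cmod (e y - e x)); auto. unfold Rdiv at 1.
      rewrite Rmult_assoc, Rinv_l by lra. lra.
    + destruct (excluded_middle_informative (e x = e x)); [reflexivity|contradiction].
    + intros y. destruct (excluded_middle_informative (e y = e x)) as [E|E].
      rewrite (H0 y E), E. ring. field. now apply Csub_neq_0.
Qed.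

Lemma der_loc {X} (e : X -> C) f g x l d : 0 < d -> (forall y, Cmod (e y - e x) < d -> f y = g y) ->
  der e f x l -> der e g x l.
Proof.
  intros Hd Hfg Hf. apply der_eps. intros eps He. destruct (proj1 (der_eps _ _ _ _) Hf eps He) as [d1 [Hd1 H]].
  exists (Rmin d d1). split. now apply Rmin_pos. intros y Hy. rewrite <- !Hfg. apply H.
  eapply Rlt_le_trans. apply Hy. apply Rmin_r.
  replace (e x - e x)%C with (RtoC 0) by ring. now rewrite Cmod_0.
  eapply Rlt_le_trans. apply Hy. apply Rmin_l.
Qed.

Lemma der_inv {X} (e : X -> C) f x l : der e f x l -> f x <> 0%C -> der e (fun y => / f y)%C x (- l / (f x * f x))%C.
Proof.
  intros Hf Hn. apply (der_comp e (fun z => / z)%C f x l (- 1 / (f x * f x))%C) in Hf.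
  replace (- l / (f x * f x))%C with (-1 / (f x * f x) * l)%C by (field; auto). exact Hf.
  clear e l Hf. generalize (f x) Hn. clear. intros z Hz.
  assert (Hm := proj1 (Cmod_gt_0 z) Hz).
  (* The slope function of inversion at [z] is [- / (z * w)]. It reproduces [/ w] only for nonzero
     [w], hence the passage to a ball of radius [Cmod z]. *)
  assert (H : der idC (fun w => / z - / (z * w) * (w - z))%C z ( - 1 / (z * z))%C).
  { exists (fun w => - / (z * w))%C. split; [|split].
    - apply cont_opp, cont_inv. apply cont_mult. apply cont_const. apply cont_id. now apply Cmult_neq_0.
    - field; auto.
    - intros y. unfold idC. ring. }
  revert H. apply der_loc with (Cmod z). auto. intros w Hw. unfold idC in Hw.
  assert (w <> 0%C). { intro; subst w. replace (0 - z)%C with (- z)%C in Hw by ring. rewrite Cmod_opp in Hw. lra. }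
  field; auto.
Qed.

Lemma der_unique z F l m : der idC F z l -> der idC F z m -> l = m.
Proof.
  intros Hl Hm. apply NNPP. intro Hn. assert (K := Cmod_sub_pos _ _ Hn). set (k := Cmod (l - m)) in *.
  destruct (proj1 (der_eps _ _ _ _) Hl (k/4)) as [d1 [Hd1 H1]]. lra.
  destruct (proj1 (der_eps _ _ _ _) Hm (k/4)) as [d2 [Hd2 H2]]. lra.
  set (h := Rmin d1 d2 / 2). assert (Hh : 0 < h) by (unfold h; generalize (Rmin_pos _ _ Hd1 Hd2); lra).
  assert (E : Cmod (z + RtoC h - z) = h).
  { replace (z + RtoC h - z)%C with (RtoC h) by ring. rewrite Cmod_R. apply Rabs_pos_eq. lra. }
  specialize (H1 (z + RtoC h)%C). specialize (H2 (z + RtoC h)%C). unfold idC in H1, H2. rewrite E in H1, H2.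
  assert (h < d1) by (generalize (Rmin_l d1 d2); unfold h in *; lra).
  assert (h < d2) by (generalize (Rmin_r d1 d2); unfold h in *; lra).
  specialize (H1 H). specialize (H2 H0).
  set (w := (z + RtoC h)%C) in *.
  assert (Cmod ((l - m) * (w - z)) <= k / 4 * h + k / 4 * h).
  { replace ((l - m) * (w - z))%C with ((F w - F z - m * (w - z)) - (F w - F z - l * (w - z)))%C by ring.
    eapply Rle_trans. apply Cmod_triangle. rewrite Cmod_opp. lra. }
  rewrite Cmod_mult, E in H3. fold k in H3. nra.
Qed.

(** A total derivative obtained by choice; its value means something only where [F] is
    differentiable. *)
Definition Cder (F : C -> C) (z : C) : C := @epsilon C (inhabits (RtoC 0)) (der idC F z).

Lemma Cder_spec F z : holo F z -> der idC F z (Cder F z).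
Proof. intros H. exact (@epsilon_spec C (inhabits (RtoC 0)) (der idC F z) H). Qed.

Lemma Cder_eq F z l : der idC F z l -> Cder F z = l.
Proof. intros H. apply der_unique with z F; auto. apply Cder_spec. now exists l. Qed.

Lemma holo_cont F z : holo F z -> cont idC F z.
Proof. intros [l H]. eapply der_cont; eauto. Qed.
Lemma holo_const c z : holo (fun _ => c) z.
Proof. eexists; apply der_const. Qed.
Lemma holo_id z : holo (fun z => z) z.
Proof. eexists; apply der_id. Qed.
Lemma holo_plus F G z : holo F z -> holo G z -> holo (fun w => F w + G w)%C z.
Proof. intros [l H] [m K]. eexists; apply der_plus; eauto. Qed.
Lemma holo_minus F G z : holo F z -> holo G z -> holo (fun w => F w - G w)%C z.
Proof. intros [l H] [m K]. eexists; apply der_minus; eauto. Qed.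
Lemma holo_mult F G z : holo F z -> holo G z -> holo (fun w => F w * G w)%C z.
Proof. intros [l H] [m K]. eexists; apply der_mult; eauto. Qed.
Lemma holo_inv F z : holo F z -> F z <> 0%C -> holo (fun w => / F w)%C z.
Proof. intros [l H] K. eexists; apply der_inv; eauto. Qed.
Lemma holo_div F G z : holo F z -> holo G z -> G z <> 0%C -> holo (fun w => F w / G w)%C z.
Proof. intros. apply holo_mult; auto. now apply holo_inv. Qed.
Lemma holo_comp F G z : holo F (G z) -> holo G z -> holo (fun w => F (G w)) z.
Proof. intros [l H] [m K]. eexists. apply (der_comp idC F G); eauto. Qed.
Lemma holo_loc F G z d : 0 < d -> (forall w, Cmod (w - z) < d -> F w = G w) -> holo F z -> holo G z.
Proof. intros Hd E [l H]. exists l. eapply der_loc; eauto. Qed.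

Lemma C_holo_at_holo F z : C_holo_at F z -> holo F z.
Proof.
  intros [l Hl]. exists l. apply der_eps. intros eps He.
  destruct Hl as [_ Hl]. specialize (Hl z (fun P HP => HP) (mkposreal eps He)).
  destruct Hl as [d Hd]. exists d. split. apply cond_pos. intros y Hy. specialize (Hd y Hy).
  replace (F y - F z - l * (idC y - idC z))%C with (F y + - F z + - ((y + - z) * l))%C by (unfold idC; ring).
  exact Hd.
Qed.

Lemma rder_is_derive (f : R -> C) (t : R) (l : C) : der RtoC f t l ->
  is_derive (fun s => Re (f s)) t (Re l) /\ is_derive (fun s => Im (f s)) t (Im l).
Proof.
  intros [p [H1 [H2 H3]]].
  split; apply is_derive_Reals; intros eps He; destruct (H1 eps He) as [d [Hd H]];
  exists (mkposreal d Hd); intros h Hh Hhd; simpl in Hhd;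
  assert (E : (RtoC (t + h) - RtoC t)%C = RtoC h) by (rewrite RtoC_plus; ring);
  specialize (H (t + h)); rewrite E, Cmod_R in H; specialize (H Hhd); specialize (H3 (t + h)); rewrite E in H3.
  - rewrite <- re_minus, H3, re_scal_r.
    replace (Re (p (t + h)) * h / h) with (Re (p (t + h))) by (field; auto).
    rewrite <- H2, <- re_minus. eapply Rle_lt_trans. apply re_le_Cmod. auto.
  - rewrite <- im_minus, H3, im_scal_r.
    replace (Im (p (t + h)) * h / h) with (Im (p (t + h))) by (field; auto).
    rewrite <- H2, <- im_minus. eapply Rle_lt_trans. apply im_le_Cmod. auto.
Qed.

Lemma is_derive_rder (f : R -> C) (t : R) (l : C) :
  is_derive (fun s => Re (f s)) t (Re l) -> is_derive (fun s => Im (f s)) t (Im l) -> der RtoC f t l.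
Proof.
  intros H1 H2. apply is_derive_Reals in H1. apply is_derive_Reals in H2.
  apply der_eps. intros eps He. destruct (H1 (eps/2)) as [d1 K1]. lra. destruct (H2 (eps/2)) as [d2 K2]. lra.
  exists (Rmin d1 d2). split. apply Rmin_pos; apply cond_pos. intros y Hy.
  rewrite <- RtoC_minus, Cmod_R in *. set (h := y - t) in *. replace y with (t + h) by (unfold h; ring).
  clearbody h. destruct (Req_dec h 0) as [->|Hh].
  { rewrite Rplus_0_r. replace (f t - f t - l * RtoC 0)%C with (RtoC 0) by ring. rewrite Cmod_0, Rabs_R0. lra. }
  assert (A1 : Rabs h < d1) by (eapply Rlt_le_trans; [apply Hy|apply Rmin_l]).
  assert (A2 : Rabs h < d2) by (eapply Rlt_le_trans; [apply Hy|apply Rmin_r]).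
  specialize (K1 h Hh A1). specialize (K2 h Hh A2).
  set (q := (f (t + h)%R - f t - l * RtoC h)%C).
  assert (B1 : Rabs (Re q) <= eps/2 * Rabs h).
  { unfold q. rewrite !re_minus, re_scal_r.
    replace (Re (f (t + h)) - Re (f t) - Re l * h) with (((Re (f (t + h)) - Re (f t)) / h - Re l) * h) by (field; auto).
    rewrite Rabs_mult. apply Rmult_le_compat_r. apply Rabs_pos. lra. }
  assert (B2 : Rabs (Im q) <= eps/2 * Rabs h).
  { unfold q. rewrite !im_minus, im_scal_r.
    replace (Im (f (t + h)) - Im (f t) - Im l * h) with (((Im (f (t + h)) - Im (f t)) / h - Im l) * h) by (field; auto).
    rewrite Rabs_mult. apply Rmult_le_compat_r. apply Rabs_pos. lra. }
  generalize (Cmod_le_re_im q). lra.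
Qed.

Lemma rcont_continuous (f : R -> C) (t : R) : cont RtoC f t ->
  continuity_pt (fun s => Re (f s)) t /\ continuity_pt (fun s => Im (f s)) t.
Proof.
  intros H. split; intros eps He; destruct (H eps He) as [d [Hd K]]; exists d; (split; [exact Hd|]);
  intros x [_ Hx]; simpl in *; unfold R_dist in *; specialize (K x); rewrite <- RtoC_minus, Cmod_R in K;
  specialize (K Hx); eapply Rle_lt_trans; try exact K; [rewrite <- re_minus; apply re_le_Cmod | rewrite <- im_minus; apply im_le_Cmod].
Qed.

Lemma continuous_rcont (f : R -> C) (t : R) : continuity_pt (fun s => Re (f s)) t -> continuity_pt (fun s => Im (f s)) t -> cont RtoC f t.
Proof.
  intros H1 H2 eps He. destruct (H1 (eps/2)) as [d1 [Hd1 K1]]. lra. destruct (H2 (eps/2)) as [d2 [Hd2 K2]]. lra.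
  exists (Rmin d1 d2). split. apply Rmin_pos; auto. intros y Hy. rewrite <- RtoC_minus, Cmod_R in Hy.
  destruct (Req_dec y t) as [->|Hn]. { replace (f t - f t)%C with (RtoC 0) by ring. now rewrite Cmod_0. }
  assert (A1 : Rabs (Re (f y) - Re (f t)) < eps/2).
  { apply K1. split. split. exact I. auto. simpl. unfold R_dist. eapply Rlt_le_trans; [apply Hy|apply Rmin_l]. }
  assert (A2 : Rabs (Im (f y) - Im (f t)) < eps/2).
  { apply K2. split. split. exact I. auto. simpl. unfold R_dist. eapply Rlt_le_trans; [apply Hy|apply Rmin_r]. }
  set (q := (f y - f t)%C). rewrite <- re_minus in A1. rewrite <- im_minus in A2. fold q in A1, A2.
  generalize (Cmod_le_re_im q). lra.
Qed.

Lemma rcont_Cmod (f : R -> C) (t : R) : cont RtoC f t -> continuity_pt (fun s => Cmod (f s)) t.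
Proof.
  intros H eps He. destruct (H eps He) as [d [Hd K]]. exists d. split; auto.
  intros x [_ Hx]. simpl in *. unfold R_dist in *. specialize (K x). rewrite <- RtoC_minus, Cmod_R in K.
  specialize (K Hx). apply Rabs_def1. generalize (Cmod_tri_inv (f x) (f t)). lra.
  generalize (Cmod_tri_inv (f t) (f x)). rewrite Cmod_sub_sym. lra.
Qed.

(** * Complex-valued integrals *)

Definition cint (f : R -> C) (a b : R) : C :=
  (RInt (fun t => Re (f t)) a b, RInt (fun t => Im (f t)) a b).

Definition rcont_on (f : R -> C) (a b : R) : Prop := forall t, a <= t <= b -> cont RtoC f t.

Lemma rcont_on_ex f a b : a <= b -> rcont_on f a b ->
  ex_RInt (fun t => Re (f t)) a b /\ ex_RInt (fun t => Im (f t)) a b.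
Proof.
  intros Hab H. split; apply (ex_RInt_continuous (V := R_CompleteNormedModule)); rewrite Rmin_left, Rmax_right by auto; intros t Ht;
  apply continuity_pt_filterlim; now apply rcont_continuous, H.
Qed.

Lemma cint_ext f g a b : a <= b -> (forall t, a <= t <= b -> f t = g t) -> cint f a b = cint g a b.
Proof.
  intros Hab H. unfold cint. f_equal; apply RInt_ext; rewrite Rmin_left, Rmax_right by auto; intros t Ht;
  rewrite H; auto; lra.
Qed.

Lemma cint_plus f g a b : a <= b -> rcont_on f a b -> rcont_on g a b ->
  cint (fun t => f t + g t)%C a b = (cint f a b + cint g a b)%C.
Proof.
  intros Hab Hf Hg. destruct (rcont_on_ex f a b Hab Hf). destruct (rcont_on_ex g a b Hab Hg).
  apply C_ext; simpl.
  - rewrite (RInt_plus (fun t => Re (f t)) (fun t => Re (g t))); auto.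
  - rewrite (RInt_plus (fun t => Im (f t)) (fun t => Im (g t))); auto.
Qed.

Lemma cint_scal c f a b : a <= b -> rcont_on f a b ->
  cint (fun t => c * f t)%C a b = (c * cint f a b)%C.
Proof.
  intros Hab Hf. destruct (rcont_on_ex f a b Hab Hf) as [H1 H2].
  assert (S1 : forall k, ex_RInt (fun t => k * Re (f t)) a b) by (intro k; apply (ex_RInt_scal (fun t => Re (f t))); auto).
  assert (S2 : forall k, ex_RInt (fun t => k * Im (f t)) a b) by (intro k; apply (ex_RInt_scal (fun t => Im (f t))); auto).
  assert (T1 : forall k, RInt (fun t => k * Re (f t)) a b = k * RInt (fun t => Re (f t)) a b)
    by (intro k; apply (RInt_scal (fun t => Re (f t))); auto).
  assert (T2 : forall k, RInt (fun t => k * Im (f t)) a b = k * RInt (fun t => Im (f t)) a b)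
    by (intro k; apply (RInt_scal (fun t => Im (f t))); auto).
  apply C_ext; simpl.
  - rewrite <- T1, <- T2. apply (RInt_minus (fun t => Re c * Re (f t)) (fun t => Im c * Im (f t))); auto.
  - rewrite <- T1, <- T2. apply (RInt_plus (fun t => Re c * Im (f t)) (fun t => Im c * Re (f t))); auto.
Qed.

Lemma rcont_on_const c a b : rcont_on (fun _ => c) a b.
Proof. intros t _. apply cont_const. Qed.

Lemma cint_minus f g a b : a <= b -> rcont_on f a b -> rcont_on g a b ->
  cint (fun t => f t - g t)%C a b = (cint f a b - cint g a b)%C.
Proof.
  intros Hab Hf Hg. rewrite (cint_ext _ (fun t => f t + (-1) * g t)%C) by (auto; intros; ring).
  rewrite cint_plus, cint_scal; auto. ring.
  intros t Ht. apply cont_mult; auto. apply cont_const.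
Qed.

Lemma cint_const c a b : cint (fun _ => c) a b = (RtoC (b - a) * c)%C.
Proof.
  destruct c as [x y]. unfold cint; simpl. rewrite !RInt_const. unfold scal, Cmult; simpl; unfold mult; simpl. f_equal; ring.
Qed.

Lemma cint_chasles f a b c : a <= b -> b <= c -> rcont_on f a c -> (cint f a b + cint f b c)%C = cint f a c.
Proof.
  intros Hab Hbc Hf.
  destruct (rcont_on_ex f a b) as [H1 H2]; auto. { intros t Ht; apply Hf; lra. }
  destruct (rcont_on_ex f b c) as [H3 H4]; auto. { intros t Ht; apply Hf; lra. }
  apply C_ext; simpl.
  - apply (RInt_Chasles (fun t => Re (f t))); auto.
  - apply (RInt_Chasles (fun t => Im (f t))); auto.
Qed.

Lemma RInt_le_const f a b M : a <= b -> ex_RInt f a b -> (forall t, a <= t <= b -> f t <= M) ->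
  RInt f a b <= M * (b - a).
Proof.
  intros Hab Hf H. replace (M * (b - a)) with (RInt (fun _ => M) a b).
  apply RInt_le; auto. apply ex_RInt_const. intros; apply H; lra.
  rewrite RInt_const. unfold scal; simpl; unfold mult; simpl; ring.
Qed.

(** Multiplying the integrand by the conjugate of the integral I makes |I|^2 the integral of a real
    part, so the real estimate applies without a loss of constant. *)
Lemma cint_bound f a b M : a <= b -> rcont_on f a b -> (forall t, a <= t <= b -> Cmod (f t) <= M) ->
  Cmod (cint f a b) <= M * (b - a).
Proof.
  intros Hab Hf HM.
  assert (HM0 : 0 <= M). { apply Rle_trans with (Cmod (f a)). apply Cmod_ge_0. apply HM; lra. }
  set (I := cint f a b).
  destruct (Req_dec (Cmod I) 0) as [E|E]. { rewrite E. apply Rmult_le_pos; lra. }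
  assert (HI : 0 < Cmod I) by (generalize (Cmod_ge_0 I); lra).
  assert (Hc : rcont_on (fun t => Cconj I * f t)%C a b).
  { intros t Ht. apply cont_mult. apply cont_const. auto. }
  assert (K : Cmod I ^ 2 = Re (cint (fun t => Cconj I * f t)%C a b)).
  { rewrite cint_scal by auto. fold I. rewrite Cmult_comm, <- Cmod2_conj, re_RtoC. reflexivity. }
  assert (K2 : Cmod I ^ 2 <= Cmod I * M * (b - a)).
  { rewrite K. apply RInt_le_const; [exact Hab|exact (proj1 (rcont_on_ex _ a b Hab Hc))|]. intros t Ht.
    eapply Rle_trans. apply Re_le_Cmod. rewrite Cmod_mult, Cmod_conj.
    apply Rmult_le_compat_l; auto. lra. }
  apply Rmult_le_reg_l with (Cmod I); auto. nra.
Qed.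

Lemma cint_FTC f g a b : a <= b -> (forall t, a <= t <= b -> der RtoC f t (g t)) -> rcont_on g a b ->
  cint g a b = (f b - f a)%C.
Proof.
  intros Hab Hf Hg. unfold cint.
  apply C_ext; simpl.
  - apply is_RInt_unique. apply (is_RInt_derive (fun t => Re (f t)) (fun t => Re (g t)));
    rewrite Rmin_left, Rmax_right by auto; intros t Ht.
    exact (proj1 (rder_is_derive f t (g t) (Hf t Ht))). apply continuity_pt_filterlim. exact (proj1 (rcont_continuous g t (Hg t Ht))).
  - apply is_RInt_unique. apply (is_RInt_derive (fun t => Im (f t)) (fun t => Im (g t)));
    rewrite Rmin_left, Rmax_right by auto; intros t Ht.
    exact (proj2 (rder_is_derive f t (g t) (Hf t Ht))). apply continuity_pt_filterlim. exact (proj2 (rcont_continuous g t (Hg t Ht))).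
Qed.

Lemma cint_der f a x : (forall t, cont RtoC f t) -> der RtoC (cint f a) x (f x).
Proof.
  intros Hf. apply is_derive_rder; simpl.
  - apply (is_derive_RInt (V := R_NormedModule) (fun t => Re (f t)) (fun y => RInt (fun t => Re (f t)) a y) a).
    + exists (mkposreal 1 Rlt_0_1). intros y _. apply (RInt_correct (V := R_CompleteNormedModule) (fun t => Re (f t)) a y). apply (ex_RInt_continuous (V := R_CompleteNormedModule) (fun t => Re (f t))).
      intros t _. apply continuity_pt_filterlim. match goal with |- continuity_pt _ ?s => destruct (rcont_continuous f s (Hf s)); assumption end.
    + apply continuity_pt_filterlim. match goal with |- continuity_pt _ ?s => destruct (rcont_continuous f s (Hf s)); assumption end.
  - apply (is_derive_RInt (V := R_NormedModule) (fun t => Im (f t)) (fun y => RInt (fun t => Im (f t)) a y) a).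
    + exists (mkposreal 1 Rlt_0_1). intros y _. apply (RInt_correct (V := R_CompleteNormedModule) (fun t => Im (f t)) a y). apply (ex_RInt_continuous (V := R_CompleteNormedModule) (fun t => Im (f t))).
      intros t _. apply continuity_pt_filterlim. match goal with |- continuity_pt _ ?s => destruct (rcont_continuous f s (Hf s)); assumption end.
    + apply continuity_pt_filterlim. match goal with |- continuity_pt _ ?s => destruct (rcont_continuous f s (Hf s)); assumption end.
Qed.

Lemma cint_shift f a b v : a <= b -> rcont_on f (a + v) (b + v) ->
  cint (fun t => f (t + v)) a b = cint f (a + v) (b + v).
Proof.
  intros Hab Hf. destruct (rcont_on_ex f (a + v) (b + v)) as [H1 H2]; auto. lra.
  unfold cint. f_equal.
  - replace (a + v) with (1 * a + v) in * by ring. replace (b + v) with (1 * b + v) in * by ring.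
    rewrite <- (RInt_comp_lin (fun t => Re (f t)) 1 v a b) by auto. apply RInt_ext. intros t _.
    unfold scal; simpl; unfold mult; simpl. rewrite !Rmult_1_l. reflexivity.
  - replace (a + v) with (1 * a + v) in * by ring. replace (b + v) with (1 * b + v) in * by ring.
    rewrite <- (RInt_comp_lin (fun t => Im (f t)) 1 v a b) by auto. apply RInt_ext. intros t _.
    unfold scal; simpl; unfold mult; simpl. rewrite !Rmult_1_l. reflexivity.
Qed.

Lemma cint_conj f a b : a <= b -> rcont_on f a b -> cint (fun t => Cconj (f t)) a b = Cconj (cint f a b).
Proof.
  intros Hab Hf. destruct (rcont_on_ex f a b) as [H1 H2]; auto. apply C_ext; simpl. reflexivity.
  apply (RInt_opp (fun t => Im (f t))). auto.
Qed.

(* Apply the real mean value theorem to Re (conj (f 1 - f 0) * f). *)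
Lemma mvt_bound (f g : R -> C) M : (forall t, 0 <= t <= 1 -> der RtoC f t (g t)) ->
  (forall t, 0 <= t <= 1 -> Cmod (g t) <= M) -> Cmod (f 1 - f 0) <= M.
Proof.
  intros Hf Hg. set (v := (f 1 - f 0)%C).
  destruct (Req_dec (Cmod v) 0) as [E|E].
  { rewrite E. apply Rle_trans with (Cmod (g 0)). apply Cmod_ge_0. apply Hg; lra. }
  assert (Hv : 0 < Cmod v) by (generalize (Cmod_ge_0 v); lra).
  assert (Hd : forall t, 0 <= t <= 1 -> der RtoC (fun t => Cconj v * f t)%C t (Cconj v * g t)%C).
  { intros t Ht. apply der_scal. auto. }
  destruct (MVT_gen (fun t => Re (Cconj v * f t)) 0 1 (fun t => Re (Cconj v * g t))) as [c [Hc E1]].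
  { rewrite Rmin_left, Rmax_right by lra. intros t Ht. apply (rder_is_derive (fun t => Cconj v * f t)%C). apply Hd. lra. }
  { rewrite Rmin_left, Rmax_right by lra. intros t Ht. apply (rcont_continuous (fun t => Cconj v * f t)%C).
    eapply der_cont. apply Hd. auto. }
  rewrite Rmin_left, Rmax_right in Hc by lra.
  rewrite <- re_minus in E1. replace (Cconj v * f 1 - Cconj v * f 0)%C with (v * Cconj v)%C in E1 by (unfold v; ring).
  rewrite <- Cmod2_conj, re_RtoC in E1.
  assert (K : Re (Cconj v * g c) <= Cmod v * M).
  { eapply Rle_trans. apply Re_le_Cmod. rewrite Cmod_mult, Cmod_conj. apply Rmult_le_compat_l; auto. lra. }
  apply Rmult_le_reg_l with (Cmod v); auto. nra.
Qed.

Lemma rder_line (a v : C) t : der RtoC (fun t => a + RtoC t * v)%C t v.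
Proof.
  eapply der_eq. apply der_plus. apply der_const. apply (der_mult RtoC RtoC (fun _ => v)). apply der_e. apply der_const.
  cbv beta. ring.
Qed.

Lemma rcont_line (a v : C) t : cont RtoC (fun t => a + RtoC t * v)%C t.
Proof. eapply der_cont, rder_line. Qed.

Lemma seg_bound F F' x y M : (forall t, 0 <= t <= 1 -> der idC F (x + RtoC t * (y - x))%C (F' (x + RtoC t * (y - x))%C)) ->
  (forall t, 0 <= t <= 1 -> Cmod (F' (x + RtoC t * (y - x))%C) <= M) ->
  Cmod (F y - F x) <= M * Cmod (y - x).
Proof.
  intros Hd HM.
  generalize (mvt_bound (fun t => F (x + RtoC t * (y - x))%C) (fun t => F' (x + RtoC t * (y - x))%C * (y - x))%C (M * Cmod (y - x))).
  replace (x + RtoC 1 * (y - x))%C with y by ring. replace (x + RtoC 0 * (y - x))%C with x by ring.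
  intro K. apply K.
  - intros t Ht. apply (der_comp RtoC F). apply Hd; auto. apply rder_line.
  - intros t Ht. rewrite Cmod_mult. apply Rmult_le_compat_r. apply Cmod_ge_0. auto.
Qed.

Lemma seg_in_ball (c x y : C) r t : 0 <= t <= 1 -> Cmod (x - c) < r -> Cmod (y - c) < r ->
  Cmod (x + RtoC t * (y - x) - c) < r.
Proof.
  intros Ht Hx Hy.
  replace (x + RtoC t * (y - x) - c)%C with (RtoC (1 - t) * (x - c) + RtoC t * (y - c))%C by (rewrite RtoC_minus; ring).
  eapply Rle_lt_trans. apply Cmod_triangle. rewrite !Cmod_mult, !Cmod_R, !Rabs_pos_eq by lra.
  destruct (Req_dec t 0) as [->|]. lra.
  assert (t * Cmod (y - c) < t * r) by (apply Rmult_lt_compat_l; lra).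
  assert ((1 - t) * Cmod (x - c) <= (1 - t) * r) by (apply Rmult_le_compat_l; lra). lra.
Qed.

Lemma ball_bound F F' c r x y M : (forall z, Cmod (z - c) < r -> der idC F z (F' z)) ->
  (forall z, Cmod (z - c) < r -> Cmod (F' z) <= M) -> Cmod (x - c) < r -> Cmod (y - c) < r ->
  Cmod (F y - F x) <= M * Cmod (y - x).
Proof.
  intros Hd HM Hx Hy. apply seg_bound with F'; intros t Ht; [apply Hd|apply HM]; now apply seg_in_ball.
Qed.

(** * The unit circle and the complex exponential *)

Definition cis (t : R) : C := (cos t, sin t).
Definition cexp (z : C) : C := (RtoC (exp (Re z)) * cis (Im z))%C.

Lemma cis_0 : cis 0 = 1%C.
Proof. unfold cis. now rewrite cos_0, sin_0. Qed.
Lemma cis_2PI : cis (2 * PI) = 1%C.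
Proof. unfold cis. now rewrite cos_2PI, sin_2PI. Qed.
Lemma cis_plus s t : cis (s + t) = (cis s * cis t)%C.
Proof. unfold cis. rewrite cos_plus, sin_plus. unfold Cmult; simpl. f_equal. ring. Qed.
Lemma cis_period t : cis (t + 2 * PI) = cis t.
Proof. rewrite cis_plus, cis_2PI. ring. Qed.
Lemma Cmod_cis t : Cmod (cis t) = 1.
Proof. unfold Cmod, cis; simpl. rewrite !Rmult_1_r. generalize (sin2_cos2 t). unfold Rsqr. intro H.
  rewrite Rplus_comm, H. apply sqrt_1. Qed.
Lemma cis_neq_0 t : cis t <> 0%C.
Proof. apply Cmod_gt_0. rewrite Cmod_cis. lra. Qed.
Lemma cis_der t : der RtoC cis t (Ci * cis t)%C.
Proof.
  apply is_derive_rder; unfold cis; simpl.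
  - apply is_derive_ext with cos. reflexivity. replace (0 * cos t - 1 * sin t) with (- sin t) by ring. apply is_derive_cos.
  - apply is_derive_ext with sin. reflexivity. replace (0 * sin t + 1 * cos t) with (cos t) by ring. apply is_derive_sin.
Qed.
Lemma cis_cont t : cont RtoC cis t.
Proof. eapply der_cont, cis_der. Qed.

Lemma cexp_plus z w : cexp (z + w) = (cexp z * cexp w)%C.
Proof. unfold cexp. rewrite re_plus, im_plus, exp_plus, cis_plus, RtoC_mult. ring. Qed.

Lemma cexp_0_der : der idC cexp 0%C 1%C.
Proof.
  apply der_eps. intros eps He.
  (* The error splits below into three terms bounded by e|w|, 2e|w| and 2e|w|, whence the 5; the
     minimum with 1 keeps exp x below 2. *)
  assert (He4 : 0 < Rmin 1 eps / 5) by (assert (K := Rmin_pos 1 eps); lra).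
  set (e := Rmin 1 eps / 5) in *.
  assert (e <= 1/5) by (unfold e; generalize (Rmin_l 1 eps); lra).
  assert (He5 : 5 * e <= eps) by (unfold e; generalize (Rmin_r 1 eps); lra).
  assert (Hexp : der RtoC (fun x => RtoC (exp x)) 0 1%C).
  { apply is_derive_rder; simpl. replace 1 with (exp 0) by apply exp_0. apply is_derive_exp.
    apply (is_derive_const 0). }
  assert (Hcis := cis_der 0). rewrite cis_0 in Hcis.
  destruct (proj1 (der_eps _ _ _ _) Hexp e He4) as [d1 [Hd1 H1]].
  destruct (proj1 (der_eps _ _ _ _) Hcis e He4) as [d2 [Hd2 H2]].
  exists (Rmin (Rmin d1 d2) e). split. repeat apply Rmin_pos; auto. intros w Hw. unfold idC in *.
  replace (w - 0)%C with w in * by ring.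
  assert (A := Rmin_l (Rmin d1 d2) e). assert (A' := Rmin_r (Rmin d1 d2) e). assert (B := Rmin_l d1 d2). assert (B' := Rmin_r d1 d2).
  assert (Cx := re_le_Cmod w). assert (Cy := im_le_Cmod w).
  set (x := Re w) in *. set (y := Im w) in *. specialize (H1 x). specialize (H2 y).
  replace (RtoC x - RtoC 0)%C with (RtoC x) in H1 by ring. replace (RtoC y - RtoC 0)%C with (RtoC y) in H2 by ring.
  rewrite Cmod_R in H1, H2. specialize (H1 ltac:(lra)). specialize (H2 ltac:(lra)).
  rewrite exp_0 in H1. rewrite cis_0 in H2.
  assert (E0 : cexp 0%C = 1%C). { unfold cexp. simpl. rewrite exp_0, cis_0. ring. }
  rewrite E0.
  assert (Ew : w = (RtoC x + Ci * RtoC y)%C). { apply C_ext; simpl; unfold x, y; ring. }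
  assert (E : (cexp w - 1 - 1 * w)%C = ((RtoC (exp x) - 1 - 1 * RtoC x) + RtoC (exp x) * (cis y - 1 - Ci * 1 * RtoC y) + (RtoC (exp x) - 1) * Ci * RtoC y)%C).
  { unfold cexp. fold x y. rewrite Ew at 1. ring. }
  rewrite E. clear E.
  assert (X1 : Cmod (RtoC (exp x) - 1) <= 2 * e).
  { replace (RtoC (exp x) - 1)%C with ((RtoC (exp x) - 1 - 1 * RtoC x) + RtoC x)%C by ring.
    eapply Rle_trans. apply Cmod_triangle. rewrite Cmod_R.
    assert (e * Rabs x <= e * 1) by (apply Rmult_le_compat_l; lra). lra. }
  assert (X2 : Cmod (RtoC (exp x)) <= 2).
  { generalize (Cmod_tri_inv (RtoC (exp x)) 1). rewrite Cmod_1. lra. }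
  eapply Rle_trans. apply Cmod_triangle. eapply Rle_trans. apply Rplus_le_compat_r. apply Cmod_triangle.
  rewrite !Cmod_mult, Cmod_Ci, (Cmod_R y).
  assert (Y1 : Cmod (RtoC (exp x)) * Cmod (cis y - 1 - Ci * 1 * RtoC y) <= 2 * (e * Rabs y)).
  { apply Rmult_le_compat; auto; apply Cmod_ge_0. }
  assert (Y2 : Cmod (RtoC (exp x) - 1) * 1 * Rabs y <= 2 * e * 1 * Rabs y).
  { apply Rmult_le_compat_r. apply Rabs_pos. lra. }
  assert (e * Rabs x <= e * Cmod w) by (apply Rmult_le_compat_l; lra).
  assert (e * Rabs y <= e * Cmod w) by (apply Rmult_le_compat_l; lra).
  assert (5 * e * Cmod w <= eps * Cmod w) by (apply Rmult_le_compat_r; [apply Cmod_ge_0|lra]).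
  lra.
Qed.

Lemma cexp_der z : der idC cexp z (cexp z).
Proof.
  assert (H : der idC (fun w => cexp z * cexp (w - z))%C z (cexp z)).
  { assert (H1 : der idC (fun w => w - z)%C z 1%C).
    { replace (RtoC 1) with (1 - 0)%C by ring. apply der_minus. apply der_id. apply der_const. }
    assert (H2 : der idC (fun w => cexp (w - z))%C z (1 * 1)%C).
    { apply (der_comp idC cexp); auto. replace (z - z)%C with (RtoC 0) by ring. apply cexp_0_der. }
    assert (H3 := der_mult idC _ _ _ _ _ (der_const idC (cexp z) z) H2). simpl in H3.
    eapply der_eq. exact H3. cbv beta. ring. }
  revert H. apply der_loc with 1. lra. intros w _. rewrite <- cexp_plus. f_equal. ring.
Qed.

(** * Goursat's theorem and the mean value property *)

(** The invariant and the relation depend on the index, as is required by bisection at scale 2^-n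
    and by successive extraction of subsequences. *)
Lemma dependent_choice {A : Type} (P : nat -> A -> Prop) (S' : nat -> A -> A -> Prop) (a0 : A) :
  P O a0 -> (forall n a, P n a -> exists a', P (S n) a' /\ S' n a a') ->
  exists s : nat -> A, s O = a0 /\ forall n, P n (s n) /\ S' n (s n) (s (S n)).
Proof.
  intros H0 H.
  set (nx := fun n (x : {a | P n a}) => constructive_indefinite_description _ (H n (proj1_sig x) (proj2_sig x))).
  set (sq := fix sq (n : nat) : {a | P n a} :=
    match n with O => exist _ a0 H0 | S m => exist _ (proj1_sig (nx m (sq m))) (proj1 (proj2_sig (nx m (sq m)))) end).
  exists (fun n => proj1_sig (sq n)). split. reflexivity. intros n. split. apply proj2_sig.
  simpl. exact (proj2 (proj2_sig (nx n (sq n)))).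
Qed.

Lemma nested_intervals (a l : nat -> R) : (forall n, a n <= a (S n)) -> (forall n, a (S n) + l (S n) <= a n + l n) ->
  (forall n, 0 <= l n) -> exists x, forall n, a n <= x <= a n + l n.
Proof.
  intros H1 H2 H3.
  assert (M1 : forall n k, a n <= a (n + k)%nat).
  { intros n k. induction k. rewrite Nat.add_0_r. lra. rewrite Nat.add_succ_r. specialize (H1 (n + k)%nat). lra. }
  assert (M2 : forall n k, a (n + k)%nat + l (n + k)%nat <= a n + l n).
  { intros n k. induction k. rewrite Nat.add_0_r. lra. rewrite Nat.add_succ_r. specialize (H2 (n + k)%nat). lra. }
  assert (M : forall n m, a n <= a m + l m).
  { intros n m. destruct (Nat.le_gt_cases n m).
    - replace m with (n + (m - n))%nat by lia. specialize (M1 n (m - n)%nat). specialize (H3 (n + (m - n))%nat). lra.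
    - replace n with (m + (n - m))%nat by lia. specialize (M2 m (n - m)%nat). specialize (H3 (m + (n - m))%nat). lra. }
  destruct (completeness (fun x => exists n, x = a n)) as [x [Hx1 Hx2]].
  - exists (a O + l O). intros y [n ->]. apply M.
  - exists (a O). now exists O.
  - exists x. intros n. split. apply Hx1. now exists n. apply Hx2. intros y [k ->]. apply M.
Qed.

Lemma pow2_small (w d : R) : 0 < d -> exists n, w / 2 ^ n < d.
Proof.
  intros Hd. destruct (Rle_dec w 0). { exists O. simpl. lra. }
  destruct (pow_lt_1_zero (1/2) ltac:(rewrite Rabs_pos_eq; lra) (d / w)) as [N HN].
  apply Rdiv_lt_0_compat; lra.
  exists N. specialize (HN N (le_n N)). rewrite Rabs_pos_eq in HN by (apply pow_le; lra).
  apply Rmult_lt_compat_l with (r := w) in HN; [|lra].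
  replace (w * (d / w)) with d in HN by (field; lra).
  replace (w / 2 ^ N) with (w * (1 / 2) ^ N); auto. unfold Rdiv. rewrite Rmult_1_l, pow_inv. reflexivity.
Qed.

Definition rect_int (F : C -> C) (a b c d : R) : C :=
  (cint (fun x => F (x, c)) a b + Ci * cint (fun y => F (b, y)) c d
   - cint (fun x => F (x, d)) a b - Ci * cint (fun y => F (a, y)) c d)%C.

Definition in_rect (a b c d : R) (z : C) : Prop := a <= Re z <= b /\ c <= Im z <= d.

Lemma rder_h y x : der RtoC (fun x => (x, y) : C) x 1%C.
Proof.
  apply is_derive_rder; simpl. apply (is_derive_id x). apply (is_derive_const y x).
Qed.

Lemma rder_v x y : der RtoC (fun y => (x, y) : C) y Ci.
Proof.
  apply is_derive_rder; simpl. apply (is_derive_const x y). apply (is_derive_id y).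
Qed.

Lemma rcont_h F x y : cont idC F (x, y) -> cont RtoC (fun x => F (x, y)) x.
Proof. intros H. apply (cont_comp RtoC F (fun x => (x, y) : C)); auto. eapply der_cont, rder_h. Qed.

Lemma rcont_v F x y : cont idC F (x, y) -> cont RtoC (fun y => F (x, y)) y.
Proof. intros H. apply (cont_comp RtoC F (fun y => (x, y) : C)); auto. eapply der_cont, rder_v. Qed.

Lemma rect_int_prim G F a b c d : a <= b -> c <= d -> (forall z, der idC G z (F z)) -> (forall z, cont idC F z) ->
  rect_int F a b c d = 0%C.
Proof.
  intros Hab Hcd HG HF. unfold rect_int.
  assert (H : forall y, cint (fun x => F (x, y)) a b = (G (b, y) - G (a, y))%C).
  { intros y. apply (cint_FTC (fun x => G (x, y))); auto.
    - intros t _. eapply der_eq. apply (der_comp RtoC G (fun x => (x, y) : C)). apply HG. apply rder_h. ring.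
    - intros t _. now apply rcont_h. }
  assert (V : forall x, (Ci * cint (fun y => F (x, y)) c d)%C = (G (x, d) - G (x, c))%C).
  { intros x. rewrite <- cint_scal; auto. 2:{ intros t _. now apply rcont_v. }
    apply (cint_FTC (fun y => G (x, y))); auto.
    - intros t _. eapply der_eq. apply (der_comp RtoC G (fun y => (x, y) : C)). apply HG. apply rder_v. ring.
    - intros t _. apply cont_mult. apply cont_const. now apply rcont_v. }
  rewrite !H, !V. ring.
Qed.

Lemma rect_int_minus F G a b c d : a <= b -> c <= d ->
  (forall z, in_rect a b c d z -> cont idC F z) -> (forall z, in_rect a b c d z -> cont idC G z) ->
  rect_int (fun z => F z - G z)%C a b c d = (rect_int F a b c d - rect_int G a b c d)%C.
Proof.
  intros Hab Hcd HF HG. unfold rect_int.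
  rewrite !(cint_minus (fun x => F (x, _)) (fun x => G (x, _))), !(cint_minus (fun y => F (_, y)) (fun y => G (_, y)));
  auto; try ring; intros t Ht; (apply rcont_h || apply rcont_v); (apply HF || apply HG); unfold in_rect; simpl; lra.
Qed.

Lemma rect_int_split_x F a m b c d : a <= m -> m <= b -> c <= d -> (forall z, in_rect a b c d z -> cont idC F z) ->
  rect_int F a b c d = (rect_int F a m c d + rect_int F m b c d)%C.
Proof.
  intros H1 H2 H3 HF. unfold rect_int.
  rewrite <- (cint_chasles (fun x => F (x, c)) a m b), <- (cint_chasles (fun x => F (x, d)) a m b); auto. ring.
  all: intros t Ht; apply rcont_h, HF; unfold in_rect; simpl; lra.
Qed.

Lemma rect_int_split_y F a b c m d : c <= m -> m <= d -> a <= b -> (forall z, in_rect a b c d z -> cont idC F z) ->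
  rect_int F a b c d = (rect_int F a b c m + rect_int F a b m d)%C.
Proof.
  intros H1 H2 H3 HF. unfold rect_int.
  rewrite <- (cint_chasles (fun y => F (a, y)) c m d), <- (cint_chasles (fun y => F (b, y)) c m d); auto. ring.
  all: intros t Ht; apply rcont_v, HF; unfold in_rect; simpl; lra.
Qed.

Lemma rect_int_bound F a b c d M : a <= b -> c <= d -> (forall z, in_rect a b c d z -> cont idC F z) ->
  (forall z, in_rect a b c d z -> Cmod (F z) <= M) -> Cmod (rect_int F a b c d) <= M * (2 * (b - a) + 2 * (d - c)).
Proof.
  intros Hab Hcd HF HM. unfold rect_int.
  assert (H : forall y, c <= y <= d -> Cmod (cint (fun x => F (x, y)) a b) <= M * (b - a)).
  { intros y Hy. apply cint_bound; auto. intros t Ht. apply rcont_h, HF. unfold in_rect; simpl; lra.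
    intros t Ht. apply HM. unfold in_rect; simpl; lra. }
  assert (V : forall x, a <= x <= b -> Cmod (Ci * cint (fun y => F (x, y)) c d) <= M * (d - c)).
  { intros x Hx. rewrite Cmod_mult, Cmod_Ci, Rmult_1_l. apply cint_bound; auto. intros t Ht. apply rcont_v, HF.
    unfold in_rect; simpl; lra. intros t Ht. apply HM. unfold in_rect; simpl; lra. }
  generalize (H c ltac:(lra)) (H d ltac:(lra)) (V a ltac:(lra)) (V b ltac:(lra)).
  set (A := cint (fun x => F (x, c)) a b). set (B := cint (fun x => F (x, d)) a b).
  set (A' := (Ci * cint (fun y => F (a, y)) c d)%C). set (B' := (Ci * cint (fun y => F (b, y)) c d)%C).
  intros K1 K2 K3 K4.
  generalize (Cmod_triangle A B') (Cmod_triangle (A + B') (- B)) (Cmod_triangle (A + B' + - B) (- A')).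
  rewrite !Cmod_opp. unfold Cminus. lra.
Qed.

Lemma goursat F a b c d : a <= b -> c <= d -> (forall z, in_rect a b c d z -> holo F z) -> rect_int F a b c d = 0%C.
Proof.
  intros Hab Hcd HF. apply NNPP. intro Hn. apply Cmod_gt_0 in Hn.
  set (M := Cmod (rect_int F a b c d)) in *. set (w := b - a). set (h := d - c).
  assert (Hw : 0 <= w) by (unfold w; lra). assert (Hh : 0 <= h) by (unfold h; lra).
  assert (P2 : forall n, 0 < 2 ^ n) by (intro n; apply pow_lt; lra).
  assert (Hwn : forall n, 0 <= w / 2 ^ n) by (intro n; apply Rmult_le_pos; auto; left; apply Rinv_0_lt_compat; auto).
  assert (Hhn : forall n, 0 <= h / 2 ^ n) by (intro n; apply Rmult_le_pos; auto; left; apply Rinv_0_lt_compat; auto).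
  assert (Hc : forall z, in_rect a b c d z -> cont idC F z) by (intros; now apply holo_cont, HF).
  (* The pair is the lower left corner of a rectangle of level n with sides w / 2^n and h / 2^n; the
     integral over its boundary keeps at least the share M / 4^n. *)
  set (P := fun n (p : R * R) =>
    a <= fst p /\ fst p + w / 2 ^ n <= b /\ c <= snd p /\ snd p + h / 2 ^ n <= d /\
    M <= 4 ^ n * Cmod (rect_int F (fst p) (fst p + w / 2 ^ n) (snd p) (snd p + h / 2 ^ n))).
  set (S' := fun n (p q : R * R) =>
    fst p <= fst q /\ fst q + w / 2 ^ S n <= fst p + w / 2 ^ n /\
    snd p <= snd q /\ snd q + h / 2 ^ S n <= snd p + h / 2 ^ n).
  destruct (dependent_choice P S' (a, c)) as [s [_ Hs]].
  { unfold P. simpl. unfold w, h. repeat split; try lra. unfold M.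
    replace (a + (b - a) / 1) with b by field. replace (c + (d - c) / 1) with d by field. lra. }
  { intros n [x y] (A1 & A2 & A3 & A4 & A5). simpl in A1, A2, A3, A4, A5.
    specialize (Hwn n). specialize (Hhn n).
    assert (E1 : w / 2 ^ S n = w / 2 ^ n / 2) by (simpl; field; specialize (P2 n); lra).
    assert (E2 : h / 2 ^ S n = h / 2 ^ n / 2) by (simpl; field; specialize (P2 n); lra).
    unfold P, S'. rewrite E1, E2. simpl fst. simpl snd.
    set (w' := w / 2 ^ n) in *. set (h' := h / 2 ^ n) in *.
    rewrite (rect_int_split_x F x (x + w' / 2) (x + w')) in A5; try lra.
    2:{ intros z [K1 K2]. apply Hc. unfold in_rect. lra. }
    rewrite (rect_int_split_y F x (x + w' / 2) y (y + h' / 2) (y + h')) in A5; try lra.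
    2:{ intros z [K1 K2]. apply Hc. unfold in_rect. lra. }
    rewrite (rect_int_split_y F (x + w' / 2) (x + w') y (y + h' / 2) (y + h')) in A5; try lra.
    2:{ intros z [K1 K2]. apply Hc. unfold in_rect. lra. }
    set (I1 := rect_int F x (x + w' / 2) y (y + h' / 2)) in *.
    set (I2 := rect_int F x (x + w' / 2) (y + h' / 2) (y + h')) in *.
    set (I3 := rect_int F (x + w' / 2) (x + w') y (y + h' / 2)) in *.
    set (I4 := rect_int F (x + w' / 2) (x + w') (y + h' / 2) (y + h')) in *.
    assert (T : Cmod (I1 + I2 + (I3 + I4)) <= Cmod I1 + Cmod I2 + Cmod I3 + Cmod I4).
    { generalize (Cmod_triangle I1 I2) (Cmod_triangle I3 I4) (Cmod_triangle (I1 + I2) (I3 + I4)). lra. }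
    assert (P4 : 0 < 4 ^ n) by (apply pow_lt; lra).
    assert (A6 : M <= 4 ^ n * (Cmod I1 + Cmod I2 + Cmod I3 + Cmod I4)) by nra.
    change (4 ^ S n) with (4 * 4 ^ n).
    destruct (Rle_dec M (4 * 4 ^ n * Cmod I1)).
    { exists (x, y). simpl. unfold I1 in *. repeat split; lra. }
    destruct (Rle_dec M (4 * 4 ^ n * Cmod I2)).
    { exists (x, y + h' / 2). simpl. replace (y + h' / 2 + h' / 2) with (y + h') by field. unfold I2 in *. repeat split; lra. }
    destruct (Rle_dec M (4 * 4 ^ n * Cmod I3)).
    { exists (x + w' / 2, y). simpl. replace (x + w' / 2 + w' / 2) with (x + w') by field. unfold I3 in *. repeat split; lra. }
    exists (x + w' / 2, y + h' / 2). simpl. replace (y + h' / 2 + h' / 2) with (y + h') by field.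
    replace (x + w' / 2 + w' / 2) with (x + w') by field. unfold I4 in *. repeat split; nra. }
  destruct (nested_intervals (fun n => fst (s n)) (fun n => w / 2 ^ n)) as [px Hpx]; auto.
  { intro n. apply Hs. } { intro n. apply Hs. }
  destruct (nested_intervals (fun n => snd (s n)) (fun n => h / 2 ^ n)) as [py Hpy]; auto.
  { intro n. apply Hs. } { intro n. apply Hs. }
  set (p := (px, py) : C).
  destruct (HF p) as [l Hl].
  { generalize (Hpx O) (Hpy O). destruct (Hs O) as [(B1 & B2 & B3 & B4 & _) _].
    unfold in_rect, p, Re, Im. cbv beta. simpl fst. simpl snd. intros; lra. }
  (* At level n the integral will be at most (M / 2 / T) times 2 (w + h)^2 / 4^n, so this T leaves
     at most M / 2 where M is required. The added 1 covers degenerate rectangles. *)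
  set (T := 2 * (w + h) * (w + h) + 1). assert (HT : 0 < T) by (unfold T; nra).
  destruct (proj1 (der_eps _ _ _ _) Hl (M / 2 / T)) as [del [Hdel Hd]]. { apply Rdiv_lt_0_compat; [|assumption]. lra. }
  destruct (pow2_small (w + h) del Hdel) as [n Hnn].
  destruct (Hs n) as [(B1 & B2 & B3 & B4 & B5) _]. specialize (Hpx n). specialize (Hpy n).
  specialize (Hwn n). specialize (Hhn n).
  assert (Ewh : (w + h) / 2 ^ n = w / 2 ^ n + h / 2 ^ n) by (field; specialize (P2 n); lra).
  set (x := fst (s n)) in *. set (y := snd (s n)) in *.
  set (w' := w / 2 ^ n) in *. set (h' := h / 2 ^ n) in *.
  (* The affine approximation has a primitive, so its boundary integral vanishes and only the
     remainder is left to estimate. *)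
  set (L := fun z => (F p + l * (z - p))%C).
  assert (HL : forall z, der idC (fun z => (F p - l * p) * z + l / 2 * (z * z))%C z (L z)).
  { intros z. eapply der_eq. apply der_plus; apply der_scal. apply der_id. apply der_mult; apply der_id.
    unfold L. field. }
  assert (CL : forall z, cont idC L z).
  { intros z. apply cont_plus. apply cont_const. apply cont_mult. apply cont_const. apply cont_minus. apply cont_id. apply cont_const. }
  assert (Hc' : forall z, in_rect x (x + w') y (y + h') z -> cont idC F z).
  { intros z [K1 K2]. apply Hc. unfold in_rect. lra. }
  assert (K : Cmod (rect_int F x (x + w') y (y + h')) <= M / 2 / T * (w' + h') * (2 * (x + w' - x) + 2 * (y + h' - y))).
  { replace (rect_int F x (x + w') y (y + h')) with (rect_int (fun z => F z - L z)%C x (x + w') y (y + h')).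
    2:{ rewrite rect_int_minus; auto; try lra. rewrite (rect_int_prim _ L x (x + w') y (y + h') ltac:(lra) ltac:(lra) HL CL). ring. }
    apply rect_int_bound; try lra.
    - intros z Hz. apply cont_minus; auto.
    - intros z [K1 K2].
      assert (Hzp : Cmod (z - p) <= w' + h').
      { eapply Rle_trans. apply Cmod_le_re_im. rewrite re_minus, im_minus. unfold p. simpl (Re (px, py)). simpl (Im (px, py)).
        apply Rplus_le_compat; apply Rabs_le; lra. }
      unfold L. replace (F z - (F p + l * (z - p)))%C with (F z - F p - l * (idC z - idC p))%C by (unfold idC; ring).
      eapply Rle_trans. apply Hd. unfold idC. lra. unfold idC. apply Rmult_le_compat_l; auto.
      left. apply Rdiv_lt_0_compat; lra. }
  assert (P4 : 4 ^ n = 2 ^ n * 2 ^ n). { rewrite <- Rpow_mult_distr. f_equal; lra. }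
  assert (K5 : 4 ^ n * (M / 2 / T * (w' + h') * (2 * (x + w' - x) + 2 * (y + h' - y))) = M / 2 / T * (2 * (w + h) * (w + h))).
  { rewrite P4. unfold w', h'. field. specialize (P2 n). split; lra. }
  assert (K6 : M <= M / 2 / T * (2 * (w + h) * (w + h))).
  { rewrite <- K5. eapply Rle_trans. apply B5. apply Rmult_le_compat_l; auto. left. apply pow_lt. lra. }
  assert (K7 : M / 2 / T * (2 * (w + h) * (w + h)) <= M / 2 / T * T).
  { apply Rmult_le_compat_l. left. apply Rdiv_lt_0_compat; lra. unfold T. lra. }
  replace (M / 2 / T * T) with (M / 2) in K7 by (field; lra). lra.
Qed.

(** Integration is in the angle: this is 2 pi times the mean of [F] on the circle, that is, the
    contour integral of F(z) / (i (z - z0)). *)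
Definition circ (F : C -> C) (z0 : C) (r : R) : C := cint (fun t => F (z0 + RtoC r * cis t)%C) 0 (2 * PI).

Lemma circle_cont z0 r t : cont RtoC (fun t => z0 + RtoC r * cis t)%C t.
Proof. apply cont_plus. apply cont_const. apply cont_mult. apply cont_const. apply cis_cont. Qed.

Lemma circle_Cmod z0 r t : 0 <= r -> Cmod (z0 + RtoC r * cis t - z0) = r.
Proof.
  intros Hr. replace (z0 + RtoC r * cis t - z0)%C with (RtoC r * cis t)%C by ring.
  rewrite Cmod_mult, Cmod_cis, Cmod_R, Rabs_pos_eq; auto. lra.
Qed.

Lemma two_PI_pos : 0 < 2 * PI.
Proof. generalize PI_RGT_0. lra. Qed.

(* In the coordinate log (z - z0), an annulus is a rectangle whose horizontal sides are identified. *)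
Lemma circ_invariant F z0 r1 r2 : 0 < r1 -> r1 <= r2 ->
  (forall z, r1 <= Cmod (z - z0) <= r2 -> holo F z) -> circ F z0 r1 = circ F z0 r2.
Proof.
  intros H1 H12 HF.
  set (G := fun z => F (z0 + cexp z)%C).
  assert (HG : forall z, in_rect (ln r1) (ln r2) 0 (2 * PI) z -> holo G z).
  { intros z [[K1 K2] _]. apply (holo_comp F (fun z => z0 + cexp z)%C).
    - apply HF. replace (z0 + cexp z - z0)%C with (cexp z) by ring. unfold cexp.
      rewrite Cmod_mult, Cmod_cis, Cmod_R, Rmult_1_r, Rabs_pos_eq by (left; apply exp_pos).
      split. rewrite <- (exp_ln r1) by auto. destruct K1 as [K1| ->]; [left; now apply exp_increasing|lra].
      rewrite <- (exp_ln r2) by lra. destruct K2 as [K2| ->]; [left; now apply exp_increasing|lra].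
    - apply holo_plus. apply holo_const. eexists. apply cexp_der. }
  assert (Hln : ln r1 <= ln r2). { destruct H12 as [H12| ->]; [left; now apply ln_increasing|lra]. }
  assert (HP := two_PI_pos).
  assert (E := goursat G _ _ _ _ Hln (Rlt_le _ _ HP) HG). unfold rect_int in E.
  replace (cint (fun x => G (x, 2 * PI)) (ln r1) (ln r2)) with (cint (fun x => G (x, 0)) (ln r1) (ln r2)) in E.
  2:{ apply cint_ext; auto. intros t _. unfold G, cexp. simpl. now rewrite cis_0, cis_2PI. }
  assert (Ec : forall r, 0 < r -> cint (fun y => G (ln r, y)) 0 (2 * PI) = circ F z0 r).
  { intros r Hr. unfold circ, G, cexp. simpl. now rewrite exp_ln. }
  rewrite !Ec in E by lra.
  assert (E2 : (Ci * (circ F z0 r2 - circ F z0 r1))%C = 0%C). { rewrite <- E. ring. }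
  apply NNPP. intro Hn. revert E2. apply Cmult_neq_0. apply Ci_nz. apply Csub_neq_0. congruence.
Qed.

(** The mean does not depend on the radius, and by continuity it tends to the central value as the
    radius shrinks. Mere continuity at [z0] is assumed so that difference quotients, not yet known
    to be holomorphic at their centre, are covered. *)
Lemma mean_value F z0 R r : 0 < r < R -> cont idC F z0 ->
  (forall z, 0 < Cmod (z - z0) < R -> holo F z) -> circ F z0 r = (RtoC (2 * PI) * F z0)%C.
Proof.
  intros Hr Hc HF. assert (HP := two_PI_pos).
  apply NNPP. intro Hn. apply Cmod_sub_pos in Hn. set (e := Cmod _) in Hn.
  destruct (Hc (e / (2 * (2 * PI)))) as [d [Hd Hd']]. apply Rdiv_lt_0_compat; lra.
  set (s := Rmin r (d / 2)). assert (Hs1 : s <= r) by apply Rmin_l. assert (Hs2 : s <= d / 2) by apply Rmin_r.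
  assert (Hs : 0 < s) by (apply Rmin_pos; lra).
  assert (E : circ F z0 r = circ F z0 s). { symmetry. apply circ_invariant; auto. intros z Hz. apply HF. lra. }
  assert (K : Cmod (circ F z0 s - RtoC (2 * PI) * F z0) <= e / (2 * (2 * PI)) * (2 * PI - 0)).
  { replace (RtoC (2 * PI) * F z0)%C with (cint (fun _ => F z0) 0 (2 * PI)).
    2:{ rewrite cint_const. f_equal. f_equal. ring. }
    assert (Hcc : rcont_on (fun t => F (z0 + RtoC s * cis t)%C) 0 (2 * PI)).
    { intros t _. apply (cont_comp RtoC F). apply holo_cont, HF. rewrite circle_Cmod; lra. apply circle_cont. }
    unfold circ. rewrite <- cint_minus; [|lra|auto|apply rcont_on_const].
    apply cint_bound. lra. intros t Ht. apply cont_minus; auto. apply cont_const.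
    intros t Ht. left. apply Hd'. unfold idC. rewrite circle_Cmod; lra. }
  rewrite <- E in K. fold e in K. replace (e / (2 * (2 * PI)) * (2 * PI - 0)) with (e / 2) in K by (field; lra). lra.
Qed.

(** * Cauchy estimates and removable singularities *)

Implicit Types (F G : C -> C) (c z : C).


Definition holo_ball (F : C -> C) (c : C) (Rd : R) : Prop := forall z, Cmod (z - c) < Rd -> holo F z.

Lemma Cmod_diag (z : C) : Cmod (z - z) = 0.
Proof. replace (z - z)%C with (RtoC 0) by ring. apply Cmod_0. Qed.

Lemma holo_ball_sub F c Rd c' Rd' : holo_ball F c Rd -> Cmod (c' - c) + Rd' <= Rd -> holo_ball F c' Rd'.
Proof. intros H Hs z Hz. apply H. generalize (Cmod_sub_tri z c' c). lra. Qed.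

(** The cofactor of z - c in F(z) - F(c), completed at [c] by the derivative. *)
Definition dd (F : C -> C) (c z : C) : C :=
  if excluded_middle_informative (z = c) then Cder F c else ((F z - F c) / (z - c))%C.

Lemma dd_diag F c : dd F c c = Cder F c.
Proof. unfold dd. destruct (excluded_middle_informative (c = c)); congruence. Qed.

Lemma dd_off F c z : z <> c -> dd F c z = ((F z - F c) / (z - c))%C.
Proof. intro H. unfold dd. destruct (excluded_middle_informative (z = c)); congruence. Qed.

Lemma dd_spec F c z : (F z - F c)%C = ((z - c) * dd F c z)%C.
Proof.
  destruct (classic (z = c)) as [->|H]. ring. rewrite dd_off by auto. field. now apply Csub_neq_0.
Qed.

Lemma dd_cont F c : holo F c -> cont idC (dd F c) c.
Proof.
  intros H. destruct (Cder_spec F c H) as [p [H1 [H2 H3]]].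
  revert H1. apply cont_loc with 1. lra. intros y _.
  destruct (classic (y = c)) as [->|Hy]. now rewrite dd_diag. rewrite dd_off, H3 by auto. unfold idC. field.
  now apply Csub_neq_0.
Qed.

Lemma dd_holo_off F c z : holo F z -> z <> c -> holo (dd F c) z.
Proof.
  intros H Hz. assert (K := Cmod_sub_pos _ _ Hz).
  apply holo_loc with (fun w => (F w - F c) / (w - c))%C (Cmod (z - c)); auto.
  - intros w Hw. rewrite dd_off; auto. intros ->. rewrite Cmod_sub_sym in Hw. lra.
  - apply holo_div. apply holo_minus; auto. apply holo_const. apply holo_minus. apply holo_id. apply holo_const.
    now apply Csub_neq_0.
Qed.

Lemma rcont_circle F c Rd r t : holo_ball F c Rd -> 0 <= r < Rd -> cont RtoC (fun t => F (c + RtoC r * cis t)%C) t.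
Proof.
  intros HF Hr. apply (cont_comp RtoC F). apply holo_cont, HF. rewrite circle_Cmod; lra. apply circle_cont.
Qed.

Lemma inv_cis_cont t : cont RtoC (fun t => / cis t)%C t.
Proof. apply cont_inv. apply cis_cont. apply cis_neq_0. Qed.

Lemma cint_inv_cis : cint (fun t => / cis t)%C 0 (2 * PI) = 0%C.
Proof.
  assert (HP := two_PI_pos).
  rewrite (cint_FTC (fun t => Ci * / cis t)%C).
  - rewrite cis_2PI, cis_0. ring.
  - lra.
  - intros t _. assert (H := cis_neq_0 t). eapply der_eq. apply der_scal. apply der_inv. apply cis_der. auto.
    assert (Ci * Ci = -1)%C by (apply C_ext; simpl; ring).
    replace (Ci * (- (Ci * cis t) / (cis t * cis t)))%C with (- (Ci * Ci) / cis t)%C by (field; auto). rewrite H0. field; auto.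
  - intros t _. apply inv_cis_cont.
Qed.

(** This is the mean value property of the difference quotient [dd F c], whose central value is the
    derivative; the contribution of the constant F(c) integrates to 0. *)
Lemma cauchy_deriv F c Rd r : holo_ball F c Rd -> 0 < r < Rd ->
  (RtoC (2 * PI * r) * Cder F c)%C = cint (fun t => F (c + RtoC r * cis t)%C * / cis t)%C 0 (2 * PI).
Proof.
  intros HF Hr. assert (HP := two_PI_pos).
  assert (Hr0 : RtoC r <> 0%C) by (apply RtoC_neq_0; lra).
  assert (Hc : holo F c). { apply HF. rewrite Cmod_diag. lra. }
  assert (E := mean_value (dd F c) c Rd r Hr (dd_cont F c Hc)). rewrite dd_diag in E.
  rewrite RtoC_mult, <- Cmult_assoc, (Cmult_comm (RtoC r)), Cmult_assoc, <- E.
  2:{ intros z Hz. apply dd_holo_off. apply HF; lra. intros ->. rewrite Cmod_diag in Hz. lra. }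
  unfold circ. rewrite Cmult_comm, <- cint_scal; [|lra|].
  2:{ intros t _. apply (cont_comp RtoC (dd F c)); [|apply circle_cont].
      apply holo_cont, dd_holo_off. apply HF. rewrite circle_Cmod; lra.
      intro H. assert (K := circle_Cmod c r t ltac:(lra)). rewrite H, Cmod_diag in K. lra. }
  rewrite (cint_ext _ (fun t => F (c + RtoC r * cis t)%C * / cis t - F c * / cis t)%C); [|lra|].
  - rewrite cint_minus, cint_scal, cint_inv_cis. ring. lra. intros t _. apply inv_cis_cont. lra.
    intros t _. apply cont_mult. now apply rcont_circle with Rd; auto; lra. apply inv_cis_cont.
    intros t _. apply cont_mult. apply cont_const. apply inv_cis_cont.
  - intros t _. rewrite dd_off. 2:{ intro H. assert (K := circle_Cmod c r t ltac:(lra)). rewrite H, Cmod_diag in K. lra. }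
    assert (H := cis_neq_0 t). field. repeat split; auto. intro K. apply H.
    replace (cis t) with ((c + RtoC r * cis t - c) / RtoC r)%C by (field; auto). rewrite K. field; auto.
Qed.

Lemma cauchy_estimate F c Rd r M : holo_ball F c Rd -> 0 < r < Rd ->
  (forall t, Cmod (F (c + RtoC r * cis t)%C) <= M) -> Cmod (Cder F c) <= M / r.
Proof.
  intros HF Hr HM. assert (HP := two_PI_pos).
  assert (E := cauchy_deriv F c Rd r HF Hr).
  assert (K : Cmod (RtoC (2 * PI * r) * Cder F c) <= M * (2 * PI - 0)).
  { rewrite E. apply cint_bound. lra.
    intros t _. apply cont_mult. now apply rcont_circle with Rd; auto; lra. apply inv_cis_cont.
    intros t _. rewrite Cmod_mult, Cmod_inv, Cmod_cis by apply cis_neq_0. rewrite Rinv_1, Rmult_1_r. auto. }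
  assert (Hpr : 0 < 2 * PI * r) by (apply Rmult_lt_0_compat; lra).
  rewrite Cmod_mult, Cmod_R, Rabs_pos_eq in K by lra.
  apply Rmult_le_reg_l with (2 * PI * r); auto.
  replace (2 * PI * r * (M / r)) with (M * (2 * PI - 0)) by (field; lra). auto.
Qed.

Lemma holo_lip F c r M x y : 0 < r -> holo_ball F c (2 * r) -> (forall z, Cmod (z - c) < 2 * r -> Cmod (F z) <= M) ->
  Cmod (x - c) < r -> Cmod (y - c) < r -> Cmod (F y - F x) <= 2 * M / r * Cmod (y - x).
Proof.
  intros Hr HF HM Hx Hy. apply (ball_bound F (Cder F) c r); auto.
  - intros z Hz. apply Cder_spec, HF. lra.
  - intros z Hz. replace (2 * M / r) with (M / (r / 2)) by (field; lra). apply cauchy_estimate with r.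
    apply holo_ball_sub with c (2 * r); auto. lra. lra.
    intros t. apply HM. generalize (Cmod_sub_tri (z + RtoC (r / 2) * cis t) z c). rewrite circle_Cmod by lra. lra.
Qed.

(** The Lipschitz bound for [F] is applied under the integral of [cauchy_deriv], so that no second
    derivative is needed yet. *)
Lemma Cder_lip F c r M x y : 0 < r -> holo_ball F c (2 * r) -> (forall z, Cmod (z - c) < 2 * r -> Cmod (F z) <= M) ->
  Cmod (x - c) < r / 2 -> Cmod (y - c) < r / 2 -> Cmod (Cder F y - Cder F x) <= 4 * M / (r * r) * Cmod (y - x).
Proof.
  intros Hr HF HM Hx Hy. assert (HP := two_PI_pos).
  set (s := r / 2).
  assert (Hxb : holo_ball F x r). { apply holo_ball_sub with c (2 * r); auto. lra. }
  assert (Hyb : holo_ball F y r). { apply holo_ball_sub with c (2 * r); auto. lra. }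
  assert (Ex := cauchy_deriv F x r s Hxb ltac:(unfold s; lra)). assert (Ey := cauchy_deriv F y r s Hyb ltac:(unfold s; lra)).
  assert (Cx : rcont_on (fun t => F (x + RtoC s * cis t)%C * / cis t)%C 0 (2 * PI)).
  { intros t _. apply cont_mult. apply rcont_circle with r; auto; unfold s; lra. apply inv_cis_cont. }
  assert (Cy : rcont_on (fun t => F (y + RtoC s * cis t)%C * / cis t)%C 0 (2 * PI)).
  { intros t _. apply cont_mult. apply rcont_circle with r; auto; unfold s; lra. apply inv_cis_cont. }
  assert (K : Cmod (RtoC (2 * PI * s) * (Cder F y - Cder F x)) <= 2 * M / r * Cmod (y - x) * (2 * PI - 0)).
  { replace (RtoC (2 * PI * s) * (Cder F y - Cder F x))%C with (RtoC (2 * PI * s) * Cder F y - RtoC (2 * PI * s) * Cder F x)%C by ring.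
    rewrite Ex, Ey, <- cint_minus; auto; [|lra]. apply cint_bound. lra.
    intros t Ht. apply cont_minus. apply Cy; auto. apply Cx; auto.
    intros t _.
    replace (F (y + RtoC s * cis t)%C * / cis t - F (x + RtoC s * cis t)%C * / cis t)%C
      with ((F (y + RtoC s * cis t)%C - F (x + RtoC s * cis t)%C) * / cis t)%C by ring.
    rewrite Cmod_mult, Cmod_inv, Cmod_cis, Rinv_1, Rmult_1_r by apply cis_neq_0.
    replace (y - x)%C with (y + RtoC s * cis t - (x + RtoC s * cis t))%C by ring.
    apply holo_lip with c; auto.
    - generalize (Cmod_sub_tri (x + RtoC s * cis t) x c). rewrite circle_Cmod; unfold s; lra.
    - generalize (Cmod_sub_tri (y + RtoC s * cis t) y c). rewrite circle_Cmod; unfold s; lra. }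
  assert (Hs : 0 < 2 * PI * s) by (apply Rmult_lt_0_compat; unfold s; lra).
  rewrite Cmod_mult, Cmod_R, Rabs_pos_eq in K by lra.
  apply Rmult_le_reg_l with (2 * PI * s); auto. eapply Rle_trans. apply K. right. unfold s. field. lra.
Qed.

Lemma holo_second_order F c r M x y : 0 < r -> holo_ball F c (2 * r) -> (forall z, Cmod (z - c) < 2 * r -> Cmod (F z) <= M) ->
  Cmod (x - c) < r / 2 -> Cmod (y - c) < r / 2 ->
  Cmod (F y - F x - Cder F x * (y - x)) <= 4 * M / (r * r) * Cmod (y - x) * Cmod (y - x).
Proof.
  intros Hr HF HM Hx Hy.
  replace (F y - F x - Cder F x * (y - x))%C with ((F y - Cder F x * y) - (F x - Cder F x * x))%C by ring.
  assert (HM0 : 0 <= 4 * M / (r * r)).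
  { assert (0 <= M). { eapply Rle_trans. apply Cmod_ge_0. apply (HM x). lra. }
    apply Rmult_le_pos. lra. left. apply Rinv_0_lt_compat. nra. }
  apply (seg_bound (fun z => F z - Cder F x * z)%C (fun z => Cder F z - Cder F x)%C).
  - intros t Ht. apply der_minus. apply Cder_spec, HF. assert (K := seg_in_ball c x y (r / 2) t Ht Hx Hy). lra.
    eapply der_eq. apply der_scal. apply der_id. ring.
  - intros t Ht. assert (K := seg_in_ball c x y (r / 2) t Ht Hx Hy).
    eapply Rle_trans. apply (Cder_lip F c r M); auto. apply Rmult_le_compat_l; auto.
    replace (x + RtoC t * (y - x) - x)%C with (RtoC t * (y - x))%C by ring.
    rewrite Cmod_mult, Cmod_R, Rabs_pos_eq by lra. generalize (Cmod_ge_0 (y - x)). nra.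
Qed.

Lemma cont_bounded F z : cont idC F z -> exists r M, 0 < r /\ forall w, Cmod (w - z) < r -> Cmod (F w) <= M.
Proof.
  intros H. destruct (H 1 Rlt_0_1) as [d [Hd K]]. exists d, (Cmod (F z) + 1). split; auto. intros w Hw.
  specialize (K w Hw). generalize (Cmod_tri_inv (F w) (F z)). lra.
Qed.

Lemma holo_ball_bounded F c Rd : 0 < Rd -> holo_ball F c Rd ->
  exists r M, 0 < r /\ 2 * r <= Rd /\ holo_ball F c (2 * r) /\ forall w, Cmod (w - c) < 2 * r -> Cmod (F w) <= M.
Proof.
  intros HR HF. destruct (cont_bounded F c) as [d [M [Hd K]]]. { apply holo_cont, HF. now rewrite Cmod_diag. }
  assert (H1 := Rmin_l Rd d). assert (H2 := Rmin_r Rd d). assert (H3 := Rmin_pos Rd d HR Hd).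
  exists (Rmin Rd d / 2), M. repeat split; try lra. intros z Hz. apply HF. lra. intros w Hw. apply K. lra.
Qed.

Lemma Cder_cont F c Rd : 0 < Rd -> holo_ball F c Rd -> cont idC (Cder F) c.
Proof.
  intros HR HF. destruct (holo_ball_bounded F c Rd HR HF) as [r [M [Hr [_ [HB HM]]]]].
  intros eps He. set (L := 4 * M / (r * r) + 1).
  assert (HM0 : 0 <= 4 * M / (r * r)).
  { assert (0 <= M). { eapply Rle_trans. apply Cmod_ge_0. apply (HM c). rewrite Cmod_diag. lra. }
    apply Rmult_le_pos. lra. left. apply Rinv_0_lt_compat. nra. }
  assert (HL : 0 < L) by (unfold L; lra).
  assert (He2 : 0 < eps / L) by (apply Rdiv_lt_0_compat; lra).
  exists (Rmin (r / 2) (eps / L)). split. apply Rmin_pos; lra.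
  intros y Hy. unfold idC in Hy. assert (K1 := Rmin_l (r / 2) (eps / L)). assert (K2 := Rmin_r (r / 2) (eps / L)).
  eapply Rle_lt_trans. apply (Cder_lip F c r M); auto. rewrite Cmod_diag; lra. lra.
  apply Rle_lt_trans with (L * Cmod (y - c)). apply Rmult_le_compat_r. apply Cmod_ge_0. unfold L; lra.
  apply Rlt_le_trans with (L * (eps / L)). apply Rmult_lt_compat_l; lra. right. field. lra.
Qed.

(* Differentiation under the integral sign: a uniform bound makes the second-order estimate uniform. *)
Lemma der_param (K : C -> R -> C) c r M a b : a <= b -> 0 < r ->
  (forall t, a <= t <= b -> holo_ball (fun z => K z t) c (2 * r)) ->
  (forall t z, a <= t <= b -> Cmod (z - c) < 2 * r -> Cmod (K z t) <= M) ->
  (forall z, Cmod (z - c) < 2 * r -> rcont_on (K z) a b) ->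
  rcont_on (fun t => Cder (fun z => K z t) c) a b ->
  der idC (fun z => cint (K z) a b) c (cint (fun t => Cder (fun z => K z t) c) a b).
Proof.
  intros Hab Hr HK HM HC HD. apply der_eps. intros eps He.
  set (L := (4 * M / (r * r)) * (b - a) + 1).
  assert (HM0 : 0 <= 4 * M / (r * r)).
  { assert (0 <= M). { eapply Rle_trans. apply Cmod_ge_0. apply (HM a c). lra. rewrite Cmod_diag. lra. }
    apply Rmult_le_pos. lra. left. apply Rinv_0_lt_compat. nra. }
  assert (HL0 : 0 <= (4 * M / (r * r)) * (b - a)) by (apply Rmult_le_pos; lra).
  assert (HL : 0 < L) by (unfold L; lra).
  assert (He2 : 0 < eps / L) by (apply Rdiv_lt_0_compat; lra).
  exists (Rmin (r / 2) (eps / L)). split. apply Rmin_pos; lra.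
  intros y Hy. unfold idC in *. assert (K1 := Rmin_l (r / 2) (eps / L)). assert (K2 := Rmin_r (r / 2) (eps / L)).
  assert (Cy : rcont_on (K y) a b) by (apply HC; lra).
  assert (Cc : rcont_on (K c) a b) by (apply HC; rewrite Cmod_diag; lra).
  rewrite <- cint_minus, (Cmult_comm _ (y - c)), <- cint_scal, <- cint_minus; auto.
  2:{ intros t Ht. apply cont_minus; auto. }
  2:{ intros t Ht. apply cont_mult. apply cont_const. auto. }
  apply Rle_trans with (4 * M / (r * r) * Cmod (y - c) * Cmod (y - c) * (b - a)).
  - apply cint_bound; auto. intros t Ht. apply cont_minus. apply cont_minus; auto. apply cont_mult. apply cont_const. auto.
    intros t Ht. rewrite (Cmult_comm (y - c)).
    apply (holo_second_order (fun z => K z t) c r M c y); auto. rewrite Cmod_diag; lra. lra.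
  - replace (4 * M / (r * r) * Cmod (y - c) * Cmod (y - c) * (b - a)) with (4 * M / (r * r) * (b - a) * Cmod (y - c) * Cmod (y - c)) by ring.
    apply Rmult_le_compat_r. apply Cmod_ge_0.
    apply Rle_trans with (L * (eps / L)); [|right; field; lra].
    apply Rmult_le_compat; auto. apply Cmod_ge_0. unfold L; lra. lra.
Qed.

(** Cauchy's formula for the derivative is differentiated under the integral sign with respect to
    the centre. *)
Lemma Cder_holo F c Rd : 0 < Rd -> holo_ball F c Rd -> holo (Cder F) c.
Proof.
  intros HR HF0. assert (HP := two_PI_pos).
  destruct (holo_ball_bounded F c Rd HR HF0) as [r [M [Hr [_ [HF HM]]]]]. clear Rd HR HF0.
  set (s := r / 2). assert (Hs : 0 < s) by (unfold s; lra).
  assert (Hps : 0 < 2 * PI * s) by (apply Rmult_lt_0_compat; lra).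
  assert (HD : forall t z, Cmod (z - c) < 2 * s -> der idC (fun z => F (z + RtoC s * cis t)%C * / cis t)%C z (Cder F (z + RtoC s * cis t)%C * / cis t)%C).
  { intros t z Hz. eapply der_eq. apply der_mult; [|apply der_const]. apply (der_comp idC F (fun z => z + RtoC s * cis t)%C).
    apply Cder_spec, HF. generalize (Cmod_sub_tri (z + RtoC s * cis t) z c). rewrite circle_Cmod; unfold s in *; lra.
    apply der_plus. apply der_id. apply der_const. cbv beta. ring. }
  assert (H : der idC (fun z => cint (fun t => F (z + RtoC s * cis t)%C * / cis t)%C 0 (2 * PI)) c
     (cint (fun t => Cder (fun z => F (z + RtoC s * cis t)%C * / cis t)%C c) 0 (2 * PI))).
  { apply (der_param (fun z t => F (z + RtoC s * cis t)%C * / cis t)%C c s M); auto.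
    - lra.
    - intros t _ z Hz. eexists. apply HD; auto.
    - intros t z _ Hz. rewrite Cmod_mult, Cmod_inv, Cmod_cis, Rinv_1, Rmult_1_r by apply cis_neq_0. apply HM.
      generalize (Cmod_sub_tri (z + RtoC s * cis t) z c). rewrite circle_Cmod; unfold s in *; lra.
    - intros z Hz t _. apply cont_mult; [|apply inv_cis_cont]. apply rcont_circle with r; [|unfold s; lra].
      apply holo_ball_sub with c (2 * r); auto. unfold s in *. lra.
    - intros t _. apply cont_loc with (fun t => Cder F (c + RtoC s * cis t)%C * / cis t)%C 1. lra.
      intros u _. symmetry. apply Cder_eq, HD. rewrite Cmod_diag. lra.
      apply cont_mult; [|apply inv_cis_cont]. apply (cont_comp RtoC (Cder F)); [|apply circle_cont].
      apply Cder_cont with s; auto. apply holo_ball_sub with c (2 * r); auto. rewrite circle_Cmod; unfold s; lra. }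
  apply (der_scal idC (/ RtoC (2 * PI * s))%C) in H.
  apply holo_loc with (fun z => / RtoC (2 * PI * s) * cint (fun t => F (z + RtoC s * cis t) * / cis t) 0 (2 * PI))%C s;
  [exact Hs| |eexists; exact H].
  intros y Hy.
  rewrite <- (cauchy_deriv F y r s); [field; apply RtoC_neq_0; lra| |unfold s; lra].
  apply holo_ball_sub with c (2 * r); auto. unfold s in *. lra.
Qed.

Lemma dd_holo F c Rd z : 0 < Rd -> holo_ball F c Rd -> holo F z -> holo (dd F c) z.
Proof.
  intros HR HF Hz. destruct (classic (z = c)) as [->|Hn]; [|now apply dd_holo_off].
  assert (H2 := Cder_holo F c Rd HR HF). destruct H2 as [m Hm].
  (* The derivative at [c] is half the second derivative of [F]. [G] below is the Taylor remainder
     of order two, estimated along the segment from [c] through its derivative. *)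
  exists (m / 2)%C. apply der_eps. intros eps He.
  destruct (proj1 (der_eps _ _ _ _) Hm eps He) as [d [Hd K]].
  exists (Rmin Rd d). split. now apply Rmin_pos. intros y Hy. unfold idC in *.
  assert (Y1 := Rmin_l Rd d). assert (Y2 := Rmin_r Rd d).
  destruct (classic (y = c)) as [->|Hy0].
  { replace (dd F c c - dd F c c - m / 2 * (c - c))%C with (RtoC 0) by ring. rewrite Cmod_0, Cmod_diag. lra. }
  rewrite dd_diag, dd_off by auto. assert (Hyc := Csub_neq_0 _ _ Hy0). assert (Hyp := Cmod_sub_pos _ _ Hy0).
  set (G := fun z => (F z - F c - Cder F c * (z - c) - m / 2 * ((z - c) * (z - c)))%C).
  assert (KG : Cmod (G y - G c) <= eps * Cmod (y - c) * Cmod (y - c)).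
  { apply (seg_bound G (fun z => Cder F z - Cder F c - m * (z - c))%C).
    - intros t Ht. assert (Hb := seg_in_ball c c y (Rmin Rd d) t Ht ltac:(rewrite Cmod_diag; lra) Hy).
      assert (Dc : forall z, der idC (fun z => z - c)%C z 1%C).
      { intros w. eapply der_eq. apply der_minus. apply der_id. apply der_const. ring. }
      eapply der_eq. apply der_minus. apply der_minus. apply der_minus. apply Cder_spec, HF. lra.
      apply der_const. apply der_scal. apply Dc. apply der_scal. apply der_mult; apply Dc. cbv beta. field.
    - intros t Ht. assert (Hb := seg_in_ball c c y (Rmin Rd d) t Ht ltac:(rewrite Cmod_diag; lra) Hy).
      eapply Rle_trans. apply K. lra. apply Rmult_le_compat_l. lra.
      replace (c + RtoC t * (y - c) - c)%C with (RtoC t * (y - c))%C by ring.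
      rewrite Cmod_mult, Cmod_R, Rabs_pos_eq by lra. nra. }
  replace (G c) with (RtoC 0) in KG by (unfold G; ring). 
  replace ((F y - F c) / (y - c) - Cder F c - m / 2 * (y - c))%C with ((G y - 0) / (y - c))%C.
  2:{ unfold G. field. auto. }
  rewrite Cmod_div by auto. apply Rmult_le_reg_r with (Cmod (y - c)); auto. unfold Rdiv at 1.
  rewrite Rmult_assoc, Rinv_l by lra. lra.
Qed.

(** The function (z - c) F(z) is differentiable at [c] too, with derivative F(c), and [F] is its
    difference quotient. *)
Lemma removable F c Rd : 0 < Rd -> cont idC F c -> (forall z, 0 < Cmod (z - c) < Rd -> holo F z) -> holo F c.
Proof.
  intros HR Hc HF.
  set (H := fun z => ((z - c) * F z)%C).
  assert (Dc : forall z, der idC (fun z => z - c)%C z 1%C).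
  { intros w. eapply der_eq. apply der_minus. apply der_id. apply der_const. ring. }
  assert (HHc : der idC H c (F c)).
  { exists F. split; auto. split; auto. intros y. unfold H, idC. ring. }
  assert (HH : holo_ball H c Rd).
  { intros z Hz. destruct (classic (z = c)) as [->|Hn]. now exists (F c).
    apply holo_mult. eexists; apply Dc. apply HF. split; auto. now apply Cmod_sub_pos. }
  apply holo_loc with (dd H c) 1. lra.
  - intros w _. destruct (classic (w = c)) as [->|Hn]. rewrite dd_diag. now apply Cder_eq.
    rewrite dd_off by auto. unfold H. field. now apply Csub_neq_0.
  - apply dd_holo with Rd; auto. apply HH. now rewrite Cmod_diag.
Qed.

(** * Zeros, open mapping and inverse functions *)

Lemma rcont_max (f : R -> C) a b : a <= b -> rcont_on f a b -> exists M, forall t, a <= t <= b -> Cmod (f t) <= M.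
Proof.
  intros Hab Hf. destruct (continuity_ab_maj (fun t => Cmod (f t)) a b Hab) as [x [Hx _]].
  intros t Ht. apply rcont_Cmod, Hf, Ht. eexists. exact Hx.
Qed.

Lemma rcont_min (f : R -> C) a b : a <= b -> rcont_on f a b -> (forall t, a <= t <= b -> f t <> 0%C) ->
  exists m, 0 < m /\ forall t, a <= t <= b -> m <= Cmod (f t).
Proof.
  intros Hab Hf H0. destruct (continuity_ab_min (fun t => Cmod (f t)) a b Hab) as [x [Hx Hx']].
  intros t Ht. apply rcont_Cmod, Hf, Ht. exists (Cmod (f x)). split; auto. now apply Cmod_gt_0, H0.
Qed.

Lemma mean_value_bound F c Rd r M : holo_ball F c Rd -> 0 < r < Rd ->
  (forall t, 0 <= t <= 2 * PI -> Cmod (F (c + RtoC r * cis t)%C) <= M) -> Cmod (F c) <= M.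
Proof.
  intros HF Hr HM. assert (HP := two_PI_pos).
  assert (E : circ F c r = (RtoC (2 * PI) * F c)%C).
  { apply mean_value with Rd; auto. apply holo_cont, HF. rewrite Cmod_diag; lra. intros z Hz. apply HF. lra. }
  assert (K : Cmod (circ F c r) <= M * (2 * PI - 0)).
  { apply cint_bound; auto. lra. intros t _. apply rcont_circle with Rd; auto. lra. }
  rewrite E, Cmod_mult, Cmod_R, Rabs_pos_eq in K by lra. nra.
Qed.

(** Without a zero, 1 / F would be holomorphic and larger at the centre than anywhere on the circle,
    against the mean value property. *)
Lemma exists_zero F c Rd r m : holo_ball F c Rd -> 0 < r < Rd ->
  (forall t, 0 <= t <= 2 * PI -> m <= Cmod (F (c + RtoC r * cis t)%C)) -> Cmod (F c) < m ->
  exists z, Cmod (z - c) < Rd /\ F z = 0%C.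
Proof.
  intros HF Hr Hm Hc. apply NNPP. intro Hn.
  assert (H0 : forall z, Cmod (z - c) < Rd -> F z <> 0%C).
  { intros z Hz E. apply Hn. now exists z. }
  assert (Hcz := H0 c ltac:(rewrite Cmod_diag; lra)).
  assert (Hcm : 0 < Cmod (F c)) by now apply Cmod_gt_0.
  assert (K : Cmod (/ F c)%C <= / m).
  { apply (mean_value_bound (fun z => / F z)%C c Rd r); auto.
    - intros z Hz. apply holo_inv; auto.
    - intros t Ht. rewrite Cmod_inv. apply Rinv_le_contravar. lra. auto. apply H0. rewrite circle_Cmod; lra. }
  rewrite Cmod_inv in K by auto. assert (/ m < / Cmod (F c)) by (apply Rinv_lt_contravar; nra). lra.
Qed.

Definition lin_prod (zs : list C) (z : C) : C := fold_right (fun a p => ((z - a) * p)%C) 1%C zs.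

Lemma factor_step F c Rd a : holo_ball F c Rd -> Cmod (a - c) < Rd -> F a = 0%C ->
  exists q, holo_ball q c Rd /\ forall z, F z = ((z - a) * q z)%C.
Proof.
  intros HF Ha H0. exists (dd F a). split.
  - intros z Hz. apply dd_holo with (Rd - Cmod (a - c)); auto. lra. apply holo_ball_sub with c Rd; auto. lra.
  - intros z. rewrite <- dd_spec, H0. ring.
Qed.

Definition factors_as F c Rd e (zs : list C) (q : C -> C) : Prop :=
  (forall a, In a zs -> Cmod (a - c) < e) /\ holo_ball q c Rd /\ forall z, F z = (lin_prod zs z * q z)%C.

(** Zeros near [c] are divided out one at a time, with multiplicity. Either this stops, or
    arbitrarily many factors can be produced; the second case is then shown to mean that [F]
    vanishes. *)
Lemma factor_or_many F c Rd e : e <= Rd -> holo_ball F c Rd ->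
  (exists zs q, factors_as F c Rd e zs q /\ forall z, Cmod (z - c) < e -> q z <> 0%C) \/
  (forall k, exists zs q, length zs = k /\ factors_as F c Rd e zs q).
Proof.
  intros He HF. destruct (classic (exists zs q, factors_as F c Rd e zs q /\ forall z, Cmod (z - c) < e -> q z <> 0%C)) as [H|H].
  now left. right. induction k as [|k [zs [q [Hl (H1 & H2 & H3)]]]].
  - exists nil, F. split; auto. split; [|split]; auto. intros a []. intros z. simpl. ring.
  - assert (Hz : exists a, Cmod (a - c) < e /\ q a = 0%C).
    { apply NNPP. intro Hn. apply H. exists zs, q. split. split; auto. intros z Hz E. apply Hn. now exists z. }
    destruct Hz as [a [Ha Hqa]]. destruct (factor_step q c Rd a) as [q' [Hq1 Hq2]]; auto. lra.
    exists (a :: zs), q'. split. simpl. now rewrite Hl. split; [|split]; auto.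
    intros b [<-|Hb]; auto. intros z. rewrite H3, Hq2. simpl. ring.
Qed.

Lemma lin_prod_lower zs z d : 0 <= d -> (forall a, In a zs -> d <= Cmod (z - a)) -> d ^ length zs <= Cmod (lin_prod zs z).
Proof.
  intros Hd. induction zs as [|a zs IH]; intros H; simpl. rewrite Cmod_1. lra.
  rewrite Cmod_mult. apply Rmult_le_compat; auto. apply pow_le; auto. apply H. now left. apply IH. intros; apply H; now right.
Qed.

Lemma lin_prod_upper zs z d : 0 <= d -> (forall a, In a zs -> Cmod (z - a) <= d) -> Cmod (lin_prod zs z) <= d ^ length zs.
Proof.
  intros Hd. induction zs as [|a zs IH]; intros H; simpl. rewrite Cmod_1. lra.
  rewrite Cmod_mult. apply Rmult_le_compat; try apply Cmod_ge_0. apply H. now left. apply IH. intros; apply H; now right.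
Qed.

(* With k zeros in the small disk, Schwarz's lemma bounds F there by M / 3 ^ k. *)
Lemma many_zeros F c Rd : 0 < Rd -> holo_ball F c Rd ->
  (forall k, exists zs q, length zs = k /\ factors_as F c Rd (Rd / 16) zs q) ->
  forall z, Cmod (z - c) < Rd / 16 -> F z = 0%C.
Proof.
  intros HR HF H z Hz. assert (HP := two_PI_pos).
  assert (Hb : holo_ball F z (15 * Rd / 16)). { apply holo_ball_sub with c Rd; auto. lra. }
  destruct (rcont_max (fun t => F (z + RtoC (Rd / 2) * cis t)%C) 0 (2 * PI)) as [M HM]. lra.
  { intros t _. apply rcont_circle with (15 * Rd / 16); auto. lra. }
  assert (HM0 : 0 <= M). { eapply Rle_trans; [|apply (HM 0); lra]. apply Cmod_ge_0. }
  apply NNPP. intro Hn. apply Cmod_gt_0 in Hn.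
  destruct (pow2_small M (Cmod (F z)) Hn) as [k Hk].
  destruct (H k) as [zs [q [Hl (H1 & H2 & H3)]]].
  (* Zeros lie within Rd / 8 = d / 3 of [z], and at least Rd / 2 - Rd / 8 = d from the circle of
     radius Rd / 2 about [z]: each zero thus gains a factor 3. *)
  set (d := 3 * Rd / 8). assert (Hd : 0 < d) by (unfold d; lra).
  assert (Hdk : 0 < d ^ k) by now apply pow_lt.
  assert (Hq : Cmod (q z) <= M / d ^ k).
  { apply (mean_value_bound q z (15 * Rd / 16) (Rd / 2)). apply holo_ball_sub with c Rd; auto. lra. lra.
    intros t Ht. apply Rmult_le_reg_r with (d ^ k); auto.
    replace (M / d ^ k * d ^ k) with M by (unfold Rdiv; rewrite Rmult_assoc, Rinv_l, Rmult_1_r; [reflexivity|lra]).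
    eapply Rle_trans; [|apply (HM t Ht)]. rewrite H3, Cmod_mult, Rmult_comm.
    apply Rmult_le_compat_r. apply Cmod_ge_0. rewrite <- Hl. apply lin_prod_lower. lra.
    intros a Ha. specialize (H1 a Ha).
    generalize (Cmod_sub_tri (z + RtoC (Rd / 2) * cis t) a z) (Cmod_sub_tri a c z). rewrite circle_Cmod by lra.
    rewrite (Cmod_sub_sym c z). unfold d. lra. }
  assert (Hp : Cmod (lin_prod zs z) <= (d / 3) ^ k).
  { rewrite <- Hl. apply lin_prod_upper. lra. intros a Ha. specialize (H1 a Ha).
    generalize (Cmod_sub_tri z c a). rewrite (Cmod_sub_sym c a). unfold d. lra. }
  assert (K : Cmod (F z) <= (d / 3) ^ k * (M / d ^ k)).
  { rewrite H3, Cmod_mult. apply Rmult_le_compat; auto; apply Cmod_ge_0. }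
  assert (E : (d / 3) ^ k * (M / d ^ k) = M / 3 ^ k).
  { unfold Rdiv at 1. rewrite Rpow_mult_distr, pow_inv. field. split; apply pow_nonzero; lra. }
  rewrite E in K.
  assert (M / 3 ^ k <= M / 2 ^ k).
  { apply Rmult_le_compat_l; auto. apply Rinv_le_contravar. apply pow_lt; lra. apply pow_incr; lra. }
  lra.
Qed.

Lemma factorization F c Rd : 0 < Rd -> holo_ball F c Rd ->
  (exists zs q, factors_as F c Rd (Rd / 16) zs q /\ forall z, Cmod (z - c) < Rd / 16 -> q z <> 0%C) \/
  (forall z, Cmod (z - c) < Rd / 16 -> F z = 0%C).
Proof.
  intros HR HF. destruct (factor_or_many F c Rd (Rd / 16) ltac:(lra) HF) as [H|H]; auto.
  right. now apply many_zeros.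
Qed.

Lemma lin_prod_zero zs z : lin_prod zs z = 0%C <-> In z zs.
Proof.
  induction zs as [|a zs IH]; simpl. split; [intro H; now apply C1_nz in H|tauto].
  rewrite <- IH. split.
  - intro H. destruct (classic (a = z)) as [|Hn]; auto. right. apply NNPP. intro K. revert H. apply Cmult_neq_0; auto.
    apply Csub_neq_0. congruence.
  - intros [->| ->]; ring.
Qed.

(** Applied to distances from a centre, it yields a punctured disk free of the finitely many listed
    zeros, the centre itself being allowed among them. *)
Lemma list_gap (l : list R) : exists d, 0 < d /\ forall r, 0 < r < d -> ~ In r l.
Proof.
  induction l as [|a l [d [Hd IH]]]. exists 1. split. lra. intros r _ [].
  destruct (Rlt_dec 0 a) as [Hp|Hp].
  - exists (Rmin d a). split. now apply Rmin_pos. intros r Hr [->|Hin].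
    generalize (Rmin_r d r). lra. apply (IH r); auto. generalize (Rmin_l d a). lra.
  - exists d. split; auto. intros r Hr [->|Hin]. lra. now apply (IH r).
Qed.

Lemma isolated_zeros F c Rd : 0 < Rd -> holo_ball F c Rd ->
  (exists d, 0 < d /\ forall z, 0 < Cmod (z - c) < d -> F z <> 0%C) \/
  (forall z, Cmod (z - c) < Rd / 16 -> F z = 0%C).
Proof.
  intros HR HF. destruct (factorization F c Rd HR HF) as [[zs [q [(H1 & H2 & H3) H4]]]|H]; [left|now right].
  destruct (list_gap (map (fun a => Cmod (a - c)) zs)) as [d [Hd Hg]].
  exists (Rmin d (Rd / 16)). split. apply Rmin_pos; lra.
  intros z Hz. assert (K1 := Rmin_l d (Rd / 16)). assert (K2 := Rmin_r d (Rd / 16)).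
  rewrite H3. apply Cmult_neq_0; [|apply H4; lra]. intro E. apply lin_prod_zero in E.
  apply (Hg (Cmod (z - c))). lra. now apply (in_map (fun a => Cmod (a - c))).
Qed.

(* F - F c does not vanish on some circle around c, hence F - w has a zero inside it for w near F c. *)
Lemma open_at F c Rd d : 0 < Rd -> holo_ball F c Rd -> 0 < d -> (forall z, 0 < Cmod (z - c) < d -> F z <> F c) ->
  forall eps, 0 < eps -> exists del, 0 < del /\ forall w, Cmod (w - F c) < del -> exists z, Cmod (z - c) < eps /\ F z = w.
Proof.
  intros HR HF Hd Hn eps He. assert (HP := two_PI_pos).
  set (s := Rmin Rd (Rmin d eps)).
  assert (K1 := Rmin_l Rd (Rmin d eps)). assert (K2 := Rmin_r Rd (Rmin d eps)). fold s in K1, K2.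
  assert (K3 := Rmin_l d eps). assert (K4 := Rmin_r d eps).
  assert (Hs : 0 < s) by (unfold s; repeat apply Rmin_pos; auto).
  destruct (rcont_min (fun t => F (c + RtoC (s / 2) * cis t) - F c)%C 0 (2 * PI)) as [m [Hm Hm']]. lra.
  { intros t _. apply cont_minus. apply rcont_circle with Rd; auto. lra. apply cont_const. }
  { intros t _. apply Csub_neq_0, Hn. rewrite circle_Cmod; lra. }
  exists (m / 2). split. lra. intros w Hw.
  destruct (exists_zero (fun z => F z - w)%C c s (s / 2) (m / 2)) as [z [Hz E]].
  - intros z Hz. apply holo_minus. apply HF; lra. apply holo_const.
  - lra.
  - intros t Ht. specialize (Hm' t Ht).
    generalize (Cmod_sub_tri (F (c + RtoC (s / 2) * cis t)%C) w (F c)). lra.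
  - rewrite Cmod_sub_sym. auto.
  - exists z. split. lra. replace w with (F z - (F z - w))%C by ring. rewrite E. ring.
Qed.

Lemma open_mapping F c Rd a : 0 < Rd -> holo_ball F c Rd -> Cmod (a - c) < Rd / 16 -> F a <> F c ->
  forall eps, 0 < eps -> exists del, 0 < del /\ forall w, Cmod (w - F c) < del -> exists z, Cmod (z - c) < eps /\ F z = w.
Proof.
  intros HR HF Ha Hn.
  assert (HG : holo_ball (fun z => F z - F c)%C c Rd). { intros z Hz. apply holo_minus; auto. apply holo_const. }
  destruct (isolated_zeros _ c Rd HR HG) as [[d [Hd H]]|H].
  - apply (open_at F c Rd d); auto. intros z Hz E. apply (H z Hz). rewrite E. ring.
  - exfalso. apply Hn. specialize (H a Ha). simpl in H. replace (F a) with (F a - F c + F c)%C by ring. rewrite H. ring.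
Qed.

Section Inverse.
Context (V : C -> Prop) (F : C -> C) (iota : C -> C).
Hypothesis V_open : forall z, V z -> exists d, 0 < d /\ forall w, Cmod (w - z) < d -> V w.
Hypothesis F_holo : forall z, V z -> holo F z.
Hypothesis iotaK : forall z, V z -> iota (F z) = z.

(** Injectivity makes F(z) an isolated value at [z], so [F] is open there; the preimage that
    openness provides is the one that [iota] recovers. *)
Lemma inv_near z : V z -> forall eps, 0 < eps -> exists del, 0 < del /\
  forall w, Cmod (w - F z) < del -> V (iota w) /\ F (iota w) = w /\ Cmod (iota w - z) < eps.
Proof.
  intros Hz eps He. destruct (V_open z Hz) as [d [Hd HV]].
  destruct (open_at F z d d) with (eps := Rmin d eps) as [del [Hdel H]]; auto.
  - intros w Hw. now apply F_holo, HV.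
  - intros w Hw E. assert (K : w = z). { rewrite <- (iotaK w), E. now apply iotaK. now apply HV. }
    rewrite K, Cmod_diag in Hw. lra.
  - now apply Rmin_pos.
  - exists del. split; auto. intros w Hw. destruct (H w Hw) as [y [Hy <-]].
    assert (K1 := Rmin_l d eps). assert (K2 := Rmin_r d eps).
    assert (Vy : V y) by (apply HV; lra). rewrite iotaK by auto. repeat split; auto. lra.
Qed.

Lemma inv_cont z : V z -> cont idC iota (F z).
Proof.
  intros Hz eps He. destruct (inv_near z Hz eps He) as [d [Hd H]]. exists d. split; auto. intros w Hw.
  rewrite (iotaK z) by auto. now apply H.
Qed.

(** If p is the slope function of [F] at [z], then w -> 1 / p(iota w) is that of the inverse;
    continuity of [iota] makes it continuous, and p stays away from 0 near F(z). *)
Lemma inv_holo_regular z : V z -> Cder F z <> 0%C -> holo iota (F z).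
Proof.
  intros Hz Hl. destruct (Cder_spec F z (F_holo z Hz)) as [p [H1 [H2 H3]]].
  destruct (inv_near z Hz 1 Rlt_0_1) as [d [Hd H]].
  exists (/ Cder F z)%C.
  assert (K : der idC (fun w => z + / p (iota w) * (w - F z))%C (F z) (/ Cder F z)%C).
  { exists (fun w => / p (iota w))%C. split; [|split].
    - apply cont_inv. apply (cont_comp idC p iota). rewrite iotaK; auto. now apply inv_cont.
      rewrite iotaK by auto. now rewrite H2.
    - rewrite iotaK by auto. now rewrite H2.
    - intros y. unfold idC. ring. }
  destruct (cont_inv idC (fun w => p (iota w)) (F z)) with (eps := Cmod (/ Cder F z)) as [d2 [Hd2 Hp]].
  { apply (cont_comp idC p iota). rewrite iotaK; auto. now apply inv_cont. }
  { rewrite iotaK by auto. now rewrite H2. }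
  { rewrite Cmod_inv by auto. now apply Rinv_0_lt_compat, Cmod_gt_0. }
  assert (Hc : cont idC (fun w => p (iota w)) (F z)).
  { apply (cont_comp idC p iota). rewrite iotaK; auto. now apply inv_cont. }
  destruct (Hc (Cmod (Cder F z))) as [d3 [Hd3 Hp3]]. now apply Cmod_gt_0.
  revert K. apply der_loc with (Rmin d d3). now apply Rmin_pos.
  intros w Hw. assert (K1 := Rmin_l d d3). assert (K2 := Rmin_r d d3).
  destruct (H w ltac:(unfold idC in Hw; lra)) as [Vw [Ew _]].
  assert (Hpw : p (iota w) <> 0%C).
  { intro E. specialize (Hp3 w ltac:(lra)). cbv beta in Hp3. rewrite E, iotaK, H2 in Hp3 by auto.
    replace (0 - Cder F z)%C with (- Cder F z)%C in Hp3 by ring. rewrite Cmod_opp in Hp3. lra. }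
  specialize (H3 (iota w)). rewrite Ew in H3. rewrite H3. unfold idC. field. auto.
Qed.

(* The zeros of F' are isolated, so the inverse is continuous with isolated singularities, which are removable. *)
Lemma inv_holo z : V z -> holo iota (F z).
Proof.
  intros Hz. destruct (V_open z Hz) as [d [Hd HV]].
  assert (HF : holo_ball F z d) by (intros w Hw; now apply F_holo, HV).
  assert (HF' : holo_ball (Cder F) z (d / 2)).
  { intros w Hw. apply Cder_holo with (d / 2). lra. apply holo_ball_sub with z d; auto. lra. }
  destruct (isolated_zeros (Cder F) z (d / 2) ltac:(lra) HF') as [[d2 [Hd2 H2]]|H2].
  - destruct (inv_near z Hz d2 Hd2) as [d3 [Hd3 H3]].
    apply removable with d3; auto. now apply inv_cont.
    intros w Hw. destruct (H3 w ltac:(lra)) as [Vw [Ew Hw3]]. rewrite <- Ew. apply inv_holo_regular; auto.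
    apply H2. split; auto. apply Cmod_sub_pos. intros E. rewrite E in Ew. rewrite Ew, Cmod_diag in Hw. lra.
  (* If the derivative vanished on the ball of radius d / 32, [F] would be constant there; a second
     point at distance d / 64 contradicts injectivity. *)
  - exfalso. set (w := (z + RtoC (d / 64))%C).
    assert (Ew : Cmod (w - z) = d / 64).
    { unfold w. replace (z + RtoC (d / 64) - z)%C with (RtoC (d / 64)) by ring. rewrite Cmod_R. apply Rabs_pos_eq. lra. }
    assert (E : F w = F z).
    { apply Cmod_sub_0. apply Rle_antisym; [|apply Cmod_ge_0]. replace 0 with (0 * Cmod (w - z)) by ring.
      apply (ball_bound F (Cder F) z (d / 2 / 16)).
      intros y Hy. apply Cder_spec, HF. lra. intros y Hy. rewrite H2; auto. rewrite Cmod_0. lra.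
      rewrite Cmod_diag. lra. lra. }
    assert (K : w = z). { rewrite <- (iotaK w), E. now apply iotaK. apply HV. lra. }
    rewrite K, Cmod_diag in Ew. lra.
Qed.

(** Once the inverse is known to be holomorphic, the chain rule for iota(F(w)) = w gives a product
    of derivatives equal to 1. *)
Lemma inj_Cder_neq_0 z : V z -> Cder F z <> 0%C.
Proof.
  intros Hz E0. destruct (inv_holo z Hz) as [l Hl]. destruct (V_open z Hz) as [d [Hd HV]].
  assert (K : der idC (fun w => iota (F w)) z (l * Cder F z)%C).
  { apply (der_comp idC iota); auto. now apply Cder_spec, F_holo. }
  assert (K2 : der idC (fun w => w) z (l * Cder F z)%C).
  { revert K. apply der_loc with d; auto. }
  assert (E := der_unique _ _ _ _ K2 (der_id z)). rewrite E0 in E.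
  apply C1_nz. rewrite <- E. ring.
Qed.
End Inverse.

(** * Connectedness of intervals and of the plane, polar coordinates *)

Lemma interval_connected (P : R -> Prop) a b : a <= b ->
  (forall t, a <= t <= b -> exists d, 0 < d /\ forall s, a <= s <= b -> Rabs (s - t) < d -> (P s <-> P t)) ->
  P a -> P b.
Proof.
  intros Hab Hl Ha.
  set (E := fun x => a <= x <= b /\ forall y, a <= y <= x -> P y).
  assert (Ea : E a). { split. lra. intros y Hy. replace y with a by lra. auto. }
  destruct (completeness E) as [x [Hx1 Hx2]].
  - exists b. intros x [Hx _]. lra.
  - now exists a.
  - assert (Hax : a <= x) by now apply Hx1.
    assert (Hxb : x <= b). { apply Hx2. intros y [Hy _]. lra. }
    destruct (Hl x ltac:(lra)) as [d [Hd Hd']].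
    assert (Hy : exists y, E y /\ x - d < y).
    { apply NNPP. intro Hn. assert (x <= x - d); [|lra]. apply Hx2. intros y Hy.
      destruct (Rle_dec y (x - d)); auto. exfalso. apply Hn. exists y. split; auto. lra. }
    destruct Hy as [y [[Hy1 Hy2] Hy3]].
    assert (Hyx : y <= x) by (apply Hx1; split; auto).
    assert (Px : P x). { apply (Hd' y). auto. apply Rabs_def1; lra. apply Hy2. lra. }
    assert (Ez : E (Rmin b (x + d / 2))).
    { assert (M1 := Rmin_l b (x + d / 2)). assert (M2 := Rmin_r b (x + d / 2)).
      assert (M3 : x <= Rmin b (x + d / 2)) by (apply Rmin_glb; lra).
      split. lra. intros t Ht. destruct (Rle_dec t y). apply Hy2; lra.
      apply (Hd' t). lra. apply Rabs_def1; lra. auto. }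
    assert (M : Rmin b (x + d / 2) <= x) by now apply Hx1.
    destruct (Rle_dec b (x + d / 2)) as [Hb|Hb].
    + rewrite Rmin_left in M by auto. replace b with x by lra. auto.
    + rewrite Rmin_right in M by lra. lra.
Qed.

Definition loc_const {T : Type} (S : C -> T) (z : C) : Prop := exists d, 0 < d /\ forall w, Cmod (w - z) < d -> S w = S z.

Lemma path_connected {T : Type} (S : C -> T) (g : R -> C) a b : a <= b -> rcont_on g a b ->
  (forall t, a <= t <= b -> loc_const S (g t)) -> S (g a) = S (g b).
Proof.
  intros Hab Hg HS. symmetry. apply (interval_connected (fun t => S (g t) = S (g a)) a b); auto.
  intros t Ht. destruct (HS t Ht) as [d [Hd H]]. destruct (Hg t Ht d Hd) as [d2 [Hd2 H2]].
  exists d2. split; auto. intros s _ Hs. rewrite (H (g s)). tauto.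
  apply H2. rewrite <- RtoC_minus, Cmod_R. auto.
Qed.

Definition loc_const_pred (S : C -> Prop) (z : C) : Prop := exists d, 0 < d /\ forall w, Cmod (w - z) < d -> (S w <-> S z).

(** The common engine of the separation arguments: [S] combines sides of curves with membership in a
    Fatou component, and the conclusion is absurd at a second point, usually one far away. *)
Lemma plane_connected (S : C -> Prop) a b : (forall z, loc_const_pred S z) -> S a -> S b.
Proof.
  intros HS Ha.
  assert (K := interval_connected (fun t => S (a + RtoC t * (b - a))%C) 0 1). cbv beta in K.
  replace (a + RtoC 0 * (b - a))%C with a in K by ring. replace (a + RtoC 1 * (b - a))%C with b in K by ring.
  apply K; auto. lra.
  intros t Ht. destruct (HS (a + RtoC t * (b - a))%C) as [d [Hd H]].
  destruct (rcont_line a (b - a) t d Hd) as [d2 [Hd2 H2]].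
  exists d2. split; auto. intros s _ Hs. apply H. apply H2. rewrite <- RtoC_minus, Cmod_R. auto.
Qed.

Lemma polar (u : C) : exists t, 0 <= t <= 2 * PI /\ u = (RtoC (Cmod u) * cis t)%C.
Proof.
  assert (HP := PI_RGT_0).
  destruct (classic (u = 0%C)) as [->|Hu]. { exists 0. split. lra. rewrite Cmod_0. ring. }
  set (m := Cmod u). assert (Hm : 0 < m) by now apply Cmod_gt_0.
  set (x := Re u / m). set (y := Im u / m).
  assert (E : x * x + y * y = 1).
  { assert (K := Cmod2_alt u). fold m in K. unfold x, y. 
    replace (Re u / m * (Re u / m) + Im u / m * (Im u / m)) with ((Re u ^ 2 + Im u ^ 2) / (m * m)) by (field; lra).
    rewrite <- K. field. lra. }
  assert (Hx : -1 <= x <= 1) by nra.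
  assert (Hc := cos_acos x Hx). assert (Hb := acos_bound x).
  assert (Hs : sin (acos x) * sin (acos x) = y * y).
  { generalize (sin2_cos2 (acos x)). unfold Rsqr. rewrite Hc. lra. }
  assert (Hsp : 0 <= sin (acos x)) by (apply sin_ge_0; lra).
  assert (Eu : u = (m * x, m * y)).
  { apply C_ext; unfold x, y; simpl; field; lra. }
  destruct (Rle_dec 0 y).
  - exists (acos x). split. lra. rewrite Eu at 1. unfold cis, RtoC, Cmult; simpl. rewrite Hc.
    assert (sin (acos x) = y) by nra. rewrite H. f_equal; ring.
  - exists (2 * PI - acos x). split. lra. rewrite Eu at 1. unfold cis, RtoC, Cmult; simpl.
    rewrite cos_minus, sin_minus, cos_2PI, sin_2PI, Hc.
    assert (sin (acos x) = - y) by nra. rewrite H. f_equal; ring.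
Qed.

(** * Winding numbers of loops *)

Definition per (n : Z) : C := (RtoC (2 * PI * IZR n) * Ci)%C.
Definition is_period (z : C) : Prop := exists n : Z, z = per n.

Lemma per_plus n m : per (n + m) = (per n + per m)%C.
Proof. unfold per. rewrite plus_IZR, Rmult_plus_distr_l, RtoC_plus. ring. Qed.

Lemma per_opp n : per (- n) = (- per n)%C.
Proof. unfold per. rewrite opp_IZR, Ropp_mult_distr_r_reverse, RtoC_opp. ring. Qed.

Lemma per_0 : per 0 = 0%C.
Proof. unfold per. rewrite Rmult_0_r. ring. Qed.

Lemma Cmod_per n : Cmod (per n) = 2 * PI * Rabs (IZR n).
Proof.
  unfold per. rewrite Cmod_mult, Cmod_Ci, Cmod_R, Rabs_mult, (Rabs_pos_eq (2 * PI)). ring. left. apply two_PI_pos.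
Qed.

Lemma per_small n : Cmod (per n) < 2 * PI -> n = 0%Z.
Proof.
  rewrite Cmod_per. intro H. assert (HP := two_PI_pos).
  assert (K : Rabs (IZR n) < 1). { apply Rmult_lt_reg_l with (2 * PI); lra. }
  rewrite <- abs_IZR in K. apply lt_IZR in K. lia.
Qed.

Lemma per_inj n m : per n = per m -> n = m.
Proof.
  intro H. assert (K : (n - m)%Z = 0%Z); [|lia]. apply per_small.
  unfold Z.sub. rewrite per_plus, per_opp, H. replace (per m + - per m)%C with (RtoC 0) by ring.
  rewrite Cmod_0. apply two_PI_pos.
Qed.

Lemma is_period_eq z w : is_period z -> is_period w -> Cmod (z - w) < 2 * PI -> z = w.
Proof.
  intros [n ->] [m ->] H. replace (per n - per m)%C with (per (n - m)) in H.
  apply per_small in H. f_equal. lia. unfold Z.sub. now rewrite per_plus, per_opp.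
Qed.

Lemma cexp_eq_1 z : cexp z = 1%C -> is_period z.
Proof.
  intro H. assert (Hm : Cmod (cexp z) = 1) by (rewrite H; apply Cmod_1).
  unfold cexp in *. rewrite Cmod_mult, Cmod_cis, Cmod_R, Rmult_1_r, Rabs_pos_eq in Hm by (left; apply exp_pos).
  rewrite Hm in H. rewrite Cmult_1_l in H.
  assert (Hre : Re z = 0). { apply exp_inv. now rewrite Hm, exp_0. }
  assert (Hcos : cos (Im z) = 1) by (apply (f_equal fst) in H; exact H).
  assert (Hs : sin (Im z / 2) = 0).
  { replace (Im z) with (2 * (Im z / 2)) in Hcos by field. rewrite cos_2a_sin in Hcos. nra. }
  apply sin_eq_0_0 in Hs. destruct Hs as [k Hk]. exists k. apply C_ext; unfold per.
  - rewrite Hre. simpl. ring.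
  - simpl. lra.
Qed.

(** Periodicity takes the weak form that every value is attained on [0, 2 pi], which is what extends
    compactness bounds to the whole line. *)
Record loop (g dg : R -> C) : Prop := {
  loop_der : forall t, der RtoC g t (dg t);
  loop_cont : forall t, cont RtoC dg t;
  loop_closed : g 0 = g (2 * PI);
  loop_periodic : forall t, exists s, 0 <= s <= 2 * PI /\ g t = g s }.

(** 2 pi i times the usual winding number; its values are the periods [per n]. *)
Definition wind (g dg : R -> C) (a : C) : C := cint (fun t => dg t / (g t - a))%C 0 (2 * PI).

(** With K a primitive of h' / h, the product h exp(-K) is constant. Equal end values of h give
    exp(-K) = 1 at 2 pi, so K is a period there. *)
Lemma dlog_period (h dh : R -> C) : (forall t, der RtoC h t (dh t)) -> (forall t, cont RtoC dh t) ->
  (forall t, h t <> 0%C) -> h 0 = h (2 * PI) -> is_period (cint (fun t => dh t / h t)%C 0 (2 * PI)).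
Proof.
  intros Hd Hc H0 He. assert (HP := two_PI_pos).
  set (f := fun t => (dh t / h t)%C). assert (Hf : forall t, cont RtoC f t).
  { intro t. apply cont_div; auto. eapply der_cont; apply Hd. }
  set (K := cint f 0). assert (HK : forall t, der RtoC K t (f t)) by (intro t; now apply cint_der).
  set (u := fun t => (h t * cexp (- K t))%C).
  assert (Hu : forall t, der RtoC u t 0%C).
  { intro t. eapply der_eq. apply der_mult. apply Hd. apply (der_comp RtoC cexp). apply cexp_der. apply der_opp, HK.
    unfold f. field. auto. }
  assert (E : (u (2 * PI)%R - u 0)%C = 0%C).
  { rewrite <- (cint_FTC u (fun _ => 0%C)). rewrite cint_const. ring. lra. auto. intros t _. apply cont_const. }
  assert (K0 : K 0 = 0%C). { unfold K, cint. rewrite !RInt_point. reflexivity. }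
  unfold u in E. rewrite K0, <- He in E. replace (- 0)%C with (RtoC 0) in E by ring.
  replace (cexp 0) with (RtoC 1) in E by (unfold cexp; simpl; rewrite exp_0, cis_0; ring).
  destruct (cexp_eq_1 (- K (2 * PI)%R)%C) as [n Hn].
  { apply NNPP. intro Hn. revert E.
    replace (h 0 * cexp (- K (2 * PI)%R) - h 0 * 1)%C with (h 0 * (cexp (- K (2 * PI)%R) - 1))%C by ring.
    apply Cmult_neq_0; auto. now apply Csub_neq_0. }
  exists (- n)%Z. rewrite per_opp, <- Hn. unfold K. ring.
Qed.

Section Loop.
Context (g dg : R -> C) (L : loop g dg).

Definition off (a : C) : Prop := forall t, g t <> a.

Lemma loop_rcont t : cont RtoC g t.
Proof. eapply der_cont. apply (loop_der _ _ L). Qed.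

Lemma wind_integrand_cont a : off a -> forall t, cont RtoC (fun t => dg t / (g t - a))%C t.
Proof.
  intros H t. apply cont_div. apply (loop_cont _ _ L). apply cont_minus. apply loop_rcont. apply cont_const.
  apply Csub_neq_0, H.
Qed.

Lemma wind_period a : off a -> is_period (wind g dg a).
Proof.
  intros H. apply (dlog_period (fun t => g t - a)%C dg).
  - intro t. eapply der_eq. apply der_minus. apply (loop_der _ _ L). apply der_const. ring.
  - apply (loop_cont _ _ L).
  - intro t. apply Csub_neq_0, H.
  - now rewrite (loop_closed _ _ L).
Qed.

Lemma off_dist a : off a -> exists m, 0 < m /\ forall t, m <= Cmod (g t - a).
Proof.
  intros H. destruct (rcont_min (fun t => g t - a)%C 0 (2 * PI)) as [m [Hm K]].
  - left. apply two_PI_pos.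
  - intros t _. apply cont_minus. apply loop_rcont. apply cont_const.
  - intros t _. apply Csub_neq_0, H.
  - exists m. split; auto. intro t. destruct (loop_periodic _ _ L t) as [s [Hs ->]]. auto.
Qed.

Lemma loop_bounds : exists M B, 0 <= B /\ (forall t, Cmod (g t) <= M) /\ (forall t, 0 <= t <= 2 * PI -> Cmod (dg t) <= B).
Proof.
  assert (HP := two_PI_pos).
  destruct (rcont_max g 0 (2 * PI)) as [M HM]. lra. intros t _. apply loop_rcont.
  destruct (rcont_max dg 0 (2 * PI)) as [B HB]. lra. intros t _. apply (loop_cont _ _ L).
  exists M, B. repeat split; auto. eapply Rle_trans. apply Cmod_ge_0. apply (HB 0). lra.
  intro t. destruct (loop_periodic _ _ L t) as [s [Hs ->]]. auto.
Qed.

(** Distinct periods are at least 2 pi apart, so continuity in the point already means local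
    constancy: it suffices to bound the change below 2 pi. *)
Lemma wind_loc a : off a -> exists d, 0 < d /\ forall b, Cmod (b - a) < d -> off b /\ wind g dg b = wind g dg a.
Proof.
  intros H. assert (HP := two_PI_pos). destruct (off_dist a H) as [m [Hm Hm']].
  destruct loop_bounds as [_ [B [HB0 [_ HB]]]].
  (* Chosen so that the difference of the integrands is at most B e / (m (m / 2)) = B / (B + 1),
     which is less than 1. *)
  set (e := m * m / (2 * (B + 1))). assert (He : 0 < e) by (apply Rdiv_lt_0_compat; nra).
  exists (Rmin (m / 2) e). split. apply Rmin_pos; lra.
  intros b Hb. assert (K1 := Rmin_l (m / 2) e). assert (K2 := Rmin_r (m / 2) e).
  assert (Hb2 : forall t, m / 2 <= Cmod (g t - b)).
  { intro t. specialize (Hm' t). generalize (Cmod_sub_tri (g t) b a). lra. }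
  assert (Hob : off b). { intros t E. specialize (Hb2 t). rewrite E, Cmod_diag in Hb2. lra. }
  split; auto. apply is_period_eq; try now apply wind_period.
  unfold wind. rewrite <- cint_minus; [|lra| intros t _; now apply wind_integrand_cont..].
  apply Rle_lt_trans with (B * e / (m * (m / 2)) * (2 * PI - 0)).
  - apply cint_bound. lra. intros t _. apply cont_minus; now apply wind_integrand_cont.
    intros t Ht.
    assert (N1 : (g t - b)%C <> 0%C) by apply Csub_neq_0, Hob. assert (N2 : (g t - a)%C <> 0%C) by apply Csub_neq_0, H.
    replace (dg t / (g t - b) - dg t / (g t - a))%C with (dg t * (b - a) / ((g t - a) * (g t - b)))%C by (field; auto).
    rewrite Cmod_div, !Cmod_mult by (now apply Cmult_neq_0).
    apply Rmult_le_compat.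
    + apply Rmult_le_pos; apply Cmod_ge_0.
    + left. apply Rinv_0_lt_compat. apply Rmult_lt_0_compat; now apply Cmod_gt_0.
    + apply Rmult_le_compat; try apply Cmod_ge_0; auto. lra.
    + apply Rinv_le_contravar. apply Rmult_lt_0_compat; lra. apply Rmult_le_compat; auto; lra.
  - replace (B * e / (m * (m / 2))) with (B / (B + 1)) by (unfold e; field; lra).
    assert (B / (B + 1) < 1). { apply Rmult_lt_reg_r with (B + 1). lra. unfold Rdiv. rewrite Rmult_assoc, Rinv_l; lra. }
    nra.
Qed.

Lemma wind_far : exists M, forall a, M < Cmod a -> off a /\ wind g dg a = 0%C.
Proof.
  assert (HP := two_PI_pos). destruct loop_bounds as [M [B [HB0 [HM HB]]]].
  (* At such distances the integrand is at most B / (B + 1), so the integral is a period of modulus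
     below 2 pi, hence 0. *)
  exists (M + B + 1). intros a Ha.
  assert (Hd : forall t, B + 1 <= Cmod (g t - a)).
  { intro t. specialize (HM t). generalize (Cmod_tri_inv a (g t)). rewrite Cmod_sub_sym. lra. }
  assert (Ho : off a). { intros t E. specialize (Hd t). rewrite E, Cmod_diag in Hd. lra. }
  split; auto. apply is_period_eq. now apply wind_period. exists 0%Z. now rewrite per_0.
  replace (wind g dg a - 0)%C with (wind g dg a) by ring.
  apply Rle_lt_trans with (B / (B + 1) * (2 * PI - 0)).
  - apply cint_bound. lra. intros t _. now apply wind_integrand_cont. intros t Ht.
    assert (N : (g t - a)%C <> 0%C) by apply Csub_neq_0, Ho.
    rewrite Cmod_div by auto. apply Rmult_le_compat; try apply Cmod_ge_0; auto.
    left. now apply Rinv_0_lt_compat, Cmod_gt_0. apply Rinv_le_contravar; auto. lra.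
  - assert (B / (B + 1) < 1). { apply Rmult_lt_reg_r with (B + 1). lra. unfold Rdiv. rewrite Rmult_assoc, Rinv_l; lra. }
    nra.
Qed.
End Loop.

Definition circle (rho t : R) : C := (RtoC rho * cis t)%C.

Lemma circle_der rho t : der RtoC (circle rho) t (Ci * circle rho t)%C.
Proof. unfold circle. eapply der_eq. apply der_scal. apply cis_der. ring. Qed.

Lemma Cmod_circle rho t : 0 <= rho -> Cmod (circle rho t) = rho.
Proof. intro H. unfold circle. rewrite Cmod_mult, Cmod_cis, Cmod_R, Rabs_pos_eq; lra. Qed.

Lemma circle_surj u : exists t, 0 <= t <= 2 * PI /\ u = circle (Cmod u) t.
Proof. apply polar. Qed.

Lemma circ_0 F rho : circ F 0 rho = cint (fun t => F (circle rho t)) 0 (2 * PI).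
Proof. apply cint_ext. left; apply two_PI_pos. intros t _. unfold circle. f_equal. ring. Qed.

Definition ploop (h : C -> C) (rho t : R) : C := h (circle rho t).
Definition dploop (h : C -> C) (rho t : R) : C := (Cder h (circle rho t) * (Ci * circle rho t))%C.

Lemma ploop_loop (h : C -> C) rho : 0 < rho ->
  (forall u, Cmod u = rho -> exists d, 0 < d /\ holo_ball h u d) -> loop (ploop h rho) (dploop h rho).
Proof.
  intros Hr Hh. assert (Hu : forall t, Cmod (circle rho t) = rho) by (intro; apply Cmod_circle; lra).
  split.
  - intros t. destruct (Hh _ (Hu t)) as [d [Hd H]]. apply (der_comp RtoC h (circle rho)).
    apply Cder_spec, H. rewrite Cmod_diag. lra. apply circle_der.
  - intros t. destruct (Hh _ (Hu t)) as [d [Hd H]].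
    assert (Cc : cont RtoC (circle rho) t) by (eapply der_cont, circle_der).
    apply cont_mult. apply (cont_comp RtoC (Cder h) (circle rho)); auto. apply Cder_cont with d; auto.
    apply cont_mult. apply cont_const. auto.
  - unfold ploop, circle. now rewrite cis_2PI, cis_0.
  - intros t. destruct (circle_surj (circle rho t)) as [s [Hs E]]. exists s. split; auto.
    unfold ploop. rewrite Hu in E. now rewrite <- E.
Qed.

(** For |a| < rho the integrand u / (u - a) is singular inside, but on the circle u = rho v it is
    the conjugate of 1 / (1 - be v) with be = conj(a) / rho, which is holomorphic beyond the unit
    disk. The mean value property thus replaces a contour deformation around a. *)
Lemma circle_residue rho a : 0 < rho -> 1 < Cmod a -> Cmod a <> rho ->
  circ (fun u => Ci * u / (u - a))%C 0 rho = if Rlt_dec (Cmod a) rho then per 1 else 0%C.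
Proof.
  intros Hr Ha Hn. assert (HP := two_PI_pos).
  destruct (Rlt_dec (Cmod a) rho) as [H|H].
  - assert (Ha0 : (RtoC rho <> 0)%C) by (apply RtoC_neq_0; lra).
    set (be := (Cconj a / RtoC rho)%C).
    assert (Hbe : Cmod be = Cmod a / rho).
    { unfold be. rewrite Cmod_div, Cmod_conj, Cmod_R, Rabs_pos_eq; auto; lra. }
    assert (Hbe1 : 0 < Cmod be). { rewrite Hbe. apply Rdiv_lt_0_compat; lra. }
    set (Q := / Cmod be). assert (HQ : 1 < Q).
    { unfold Q. rewrite <- Rinv_1. apply Rinv_lt_contravar. lra. rewrite Hbe.
      apply Rmult_lt_reg_r with rho; auto. unfold Rdiv. rewrite Rmult_assoc, Rinv_l; lra. }
    assert (Hnv : forall v, Cmod v < Q -> (1 - be * v)%C <> 0%C).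
    { intros v Hv E. assert (E' : (be * v)%C = 1%C). { replace (be * v)%C with (1 - (1 - be * v))%C by ring. rewrite E. ring. }
      assert (K : Cmod be * Cmod v = 1) by (rewrite <- Cmod_mult, E'; apply Cmod_1).
      assert (Cmod be * Cmod v < Cmod be * Q) by (apply Rmult_lt_compat_l; auto).
      unfold Q in H0. rewrite Rinv_r in H0; lra. }
    assert (HG : forall v, Cmod v < Q -> holo (fun v => / (1 - be * v))%C v).
    { intros v Hv. apply holo_inv; auto. apply holo_minus. apply holo_const. apply holo_mult. apply holo_const. apply holo_id. }
    assert (E1 := mean_value (fun v => / (1 - be * v))%C 0%C Q 1 ltac:(lra)).
    rewrite (circ_0 (fun v => / (1 - be * v))%C) in E1.
    assert (E2 : cint (fun t => / (1 - be * circle 1 t))%C 0 (2 * PI) = RtoC (2 * PI)).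
    { rewrite E1. replace (1 - be * 0)%C with (RtoC 1) by ring. field.
      apply holo_cont, HG. rewrite Cmod_0. lra. intros z Hz. apply HG. replace (z - 0)%C with z in Hz by ring. lra. }
    assert (Hcc : rcont_on (fun t => / (1 - be * circle 1 t))%C 0 (2 * PI)).
    { intros t _. apply (cont_comp RtoC (fun v => / (1 - be * v))%C (circle 1)). apply holo_cont, HG.
      rewrite Cmod_circle; lra. eapply der_cont, circle_der. }
    rewrite (circ_0 (fun u => Ci * u / (u - a))%C).
    rewrite (cint_ext _ (fun t => Ci * Cconj (/ (1 - be * circle 1 t)))%C); [|lra|].
    + rewrite cint_scal, (cint_conj (fun t => / (1 - be * circle 1 t))%C), E2; auto; try lra.
      * unfold per. apply C_ext; simpl; ring.
      * intros t Ht. apply continuous_rcont. apply (rcont_continuous _ t (Hcc t Ht)).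
        apply continuity_pt_opp. apply (rcont_continuous _ t (Hcc t Ht)).
    + intros t _. rewrite Cinv_conj, Cminus_conj, Cmult_conj by (apply Hnv; rewrite Cmod_circle; lra).
      unfold be, circle. rewrite Cdiv_conj, Cconj_conj by auto.
      replace (Cconj 1) with (RtoC 1) by (apply C_ext; simpl; ring).
      replace (Cconj (RtoC rho)) with (RtoC rho) by (apply C_ext; simpl; ring).
      replace (Cconj (1 * cis t)) with (/ cis t)%C.
      2:{ assert (K := cis_neq_0 t). replace (1 * cis t)%C with (cis t) by ring.
          assert (K2 := Cmod2_conj (cis t)). rewrite Cmod_cis in K2.
          replace (/ cis t)%C with ((cis t * Cconj (cis t)) / cis t)%C. field; auto.
          rewrite <- K2. replace (1 ^ 2) with 1 by ring. field; auto. }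
      assert (K := cis_neq_0 t).
      assert (K2 : (RtoC rho * cis t - a)%C <> 0%C).
      { apply Csub_neq_0. intros E. apply Hn. rewrite <- E. apply Cmod_circle. lra. }
      field. repeat split; auto.
  - assert (E1 := mean_value (fun u => Ci * u / (u - a))%C 0%C (Cmod a) rho ltac:(lra)).
    assert (HG : forall u, Cmod u < Cmod a -> holo (fun u => Ci * u / (u - a))%C u).
    { intros u Hu. apply holo_div. apply holo_mult. apply holo_const. apply holo_id. apply holo_minus. apply holo_id. apply holo_const.
      apply Csub_neq_0. intros ->. lra. }
    rewrite E1.
    + assert (a <> 0%C) by (apply Cmod_gt_0; lra). field. intro K. apply H0. rewrite <- K. ring_simplify.
      replace a with (- (0 - a))%C by ring. rewrite K. ring.
    + apply holo_cont, HG. rewrite Cmod_0. lra.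
    + intros z Hz. apply HG. replace (z - 0)%C with z in Hz by ring. lra.
Qed.

(** * Core curves of conformal annuli *)

Definition ann (r : R) (u : C) : Prop := 1 < Cmod u < r.

(* A conformal image of the annulus 1 < |u| < r; the circle |u| = rho gives its core curve. *)
Record ring (r rho : R) (iota : C -> C) : Prop := {
  ring_rho : 1 < rho < r;
  ring_holo : forall u, ann r u -> holo iota u;
  ring_inj : forall u v, ann r u -> ann r v -> iota u = iota v -> u = v }.

Definition wd (rho : R) (iota : C -> C) (a : C) : C := wind (ploop iota rho) (dploop iota rho) a.
Definition on (rho : R) (iota : C -> C) (a : C) : Prop := exists u, Cmod u = rho /\ iota u = a.
(** Sides are defined by the winding number, with no reference to Jordan domains; a nonzero value of
    either sign counts as inside, so orientation does not matter. *)
Definition ins (rho : R) (iota : C -> C) (a : C) : Prop := ~ on rho iota a /\ wd rho iota a <> 0%C.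
Definition out (rho : R) (iota : C -> C) (a : C) : Prop := ~ on rho iota a /\ wd rho iota a = 0%C.

Lemma ann_ball r u : ann r u -> exists d, 0 < d /\ forall v, Cmod (v - u) < d -> ann r v.
Proof.
  intros [H1 H2]. exists (Rmin (Cmod u - 1) (r - Cmod u)). split. apply Rmin_pos; lra.
  intros v Hv. assert (K1 := Rmin_l (Cmod u - 1) (r - Cmod u)). assert (K2 := Rmin_r (Cmod u - 1) (r - Cmod u)).
  generalize (Cmod_tri_inv v u) (Cmod_tri_inv u v). rewrite (Cmod_sub_sym u v). unfold ann. lra.
Qed.

Lemma off_on rho iota a : 0 < rho -> (off (ploop iota rho) a <-> ~ on rho iota a).
Proof.
  intros Hr. split.
  - intros H [u [Hu E]]. destruct (circle_surj u) as [t [_ Et]]. rewrite Hu in Et. apply (H t). unfold ploop. now rewrite <- Et.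
  - intros H t E. apply H. exists (circle rho t). split; auto. apply Cmod_circle. lra.
Qed.

Section Ring.
Context (r rho : R) (iota : C -> C) (HR : ring r rho iota).

Lemma ring_holo_ball u : ann r u -> exists d, 0 < d /\ holo_ball iota u d.
Proof.
  intro Hu. destruct (ann_ball r u Hu) as [d [Hd H]]. exists d. split; auto. intros v Hv.
  now apply (ring_holo _ _ _ HR), H.
Qed.

Lemma ring_with rho' : 1 < rho' < r -> ring r rho' iota.
Proof. intro H. split; auto. apply HR. apply HR. Qed.

Lemma ring_loop : loop (ploop iota rho) (dploop iota rho).
Proof.
  assert (H := ring_rho _ _ _ HR). apply ploop_loop. lra. intros u Hu. apply ring_holo_ball. unfold ann. lra.
Qed.

Lemma ring_Cder u : ann r u -> Cder iota u <> 0%C.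
Proof.
  intro Hu.
  apply (inj_Cder_neq_0 (ann r) iota (fun a => @epsilon C (inhabits (RtoC 0)) (fun v => ann r v /\ iota v = a))); auto.
  - apply ann_ball.
  - apply (ring_holo _ _ _ HR).
  - intros v Hv. assert (K : exists w, ann r w /\ iota w = iota v) by now exists v.
    apply (epsilon_spec (inhabits (RtoC 0))) in K. destruct K as [K1 K2]. now apply (ring_inj _ _ _ HR).
Qed.

Lemma ring_open u : ann r u -> forall eps, 0 < eps -> exists del, 0 < del /\
  forall a, Cmod (a - iota u) < del -> exists v, ann r v /\ Cmod (v - u) < eps /\ iota v = a.
Proof.
  intros Hu eps He. destruct (ann_ball r u Hu) as [d [Hd H]].
  destruct (open_at iota u d d) with (eps := Rmin d eps) as [del [Hdel K]]; auto.
  - intros v Hv. now apply (ring_holo _ _ _ HR), H.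
  - intros v Hv E. apply (ring_inj _ _ _ HR) in E; auto. rewrite E, Cmod_diag in Hv. lra. apply H. lra.
  - now apply Rmin_pos.
  - exists del. split; auto. intros a Ha. destruct (K a Ha) as [v [Hv E]].
    assert (K1 := Rmin_l d eps). assert (K2 := Rmin_r d eps).
    exists v. repeat split; auto; try lra; apply H; lra.
Qed.

(** Injectivity gives this off the diagonal, and nonvanishing of the derivative gives it on the
    diagonal. *)
Lemma ring_dd_neq_0 u v : ann r u -> ann r v -> dd iota u v <> 0%C.
Proof.
  intros Hu Hv E. destruct (classic (v = u)) as [->|Hn].
  - rewrite dd_diag in E. now apply (ring_Cder u).
  - assert (K := dd_spec iota u v). rewrite E in K. apply Hn. apply (ring_inj _ _ _ HR); auto.
    apply Cmod_sub_0. rewrite K. replace ((v - u) * 0)%C with (RtoC 0) by ring. apply Cmod_0.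
Qed.

Lemma ring_dd_holo u v : ann r u -> ann r v -> holo (dd iota u) v.
Proof.
  intros Hu Hv. destruct (ring_holo_ball u Hu) as [d [Hd H]]. apply dd_holo with d; auto. now apply (ring_holo _ _ _ HR).
Qed.

Lemma ring_dd_D_holo u v : ann r u -> ann r v -> holo (Cder (dd iota u)) v.
Proof.
  intros Hu Hv. destruct (ann_ball r v Hv) as [d [Hd H]]. apply Cder_holo with d; auto. intros w Hw.
  apply ring_dd_holo; auto.
Qed.

(* The part of the winding number about iota u that comes from (iota v - iota u) / (v - u). *)
Definition regular_part (u : C) : C := circ (fun v => Cder (dd iota u) v * (Ci * v) / dd iota u v)%C 0 rho.

Lemma regular_part_holo u v : ann r u -> ann r v -> holo (fun v => Cder (dd iota u) v * (Ci * v) / dd iota u v)%C v.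
Proof.
  intros Hu Hv. apply holo_div. apply holo_mult. now apply ring_dd_D_holo. apply holo_mult. apply holo_const. apply holo_id.
  now apply ring_dd_holo. now apply ring_dd_neq_0.
Qed.

Lemma off_iota u : ann r u -> Cmod u <> rho -> ~ on rho iota (iota u).
Proof.
  intros Hu Hn [v [Hv E]]. assert (H := ring_rho _ _ _ HR). apply (ring_inj _ _ _ HR) in E; auto. congruence.
  unfold ann. lra.
Qed.

(** The difference iota(v) - iota(u) is (v - u) times the difference quotient, and logarithmic
    derivatives add: the first factor gives the residue on a round circle, the second the regular
    part. *)
Lemma wd_iota u : ann r u -> Cmod u <> rho ->
  wd rho iota (iota u) = (regular_part u + if Rlt_dec (Cmod u) rho then per 1 else 0)%C.
Proof.
  intros Hu Hn. assert (HP := two_PI_pos). assert (Hrho := ring_rho _ _ _ HR).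
  rewrite <- (circle_residue rho u) by (unfold ann in Hu; lra). unfold regular_part.
  rewrite !circ_0. unfold wd, wind.
  assert (Hann : forall t, ann r (circle rho t)) by (intro t; unfold ann; rewrite Cmod_circle; lra).
  assert (Hne : forall t, (circle rho t - u)%C <> 0%C).
  { intros t. apply Csub_neq_0. intros E. apply Hn. rewrite <- E. apply Cmod_circle. lra. }
  assert (Cc : forall t, cont RtoC (circle rho) t) by (intro; eapply der_cont, circle_der).
  rewrite <- cint_plus.
  - apply cint_ext. lra. intros t _. unfold ploop, dploop.
    rewrite dd_spec. set (v := circle rho t) in *.
    assert (E : Cder iota v = (dd iota u v + (v - u) * Cder (dd iota u) v)%C).
    { apply Cder_eq. assert (Hv := Hann t). fold v in Hv.
      assert (K : der idC (fun w => iota u + (w - u) * dd iota u w)%C v ((1 - 0) * dd iota u v + (v - u) * Cder (dd iota u) v)%C).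
      { eapply der_eq. apply der_plus. apply der_const. apply der_mult. apply der_minus. apply der_id. apply der_const.
        apply Cder_spec. now apply ring_dd_holo. cbv beta. ring. }
      assert (K2 : der idC iota v ((1 - 0) * dd iota u v + (v - u) * Cder (dd iota u) v)%C).
      { revert K. apply der_loc with 1. lra. intros w _. rewrite <- dd_spec. ring. }
      eapply der_eq. exact K2. ring. }
    rewrite E. assert (N1 := ring_dd_neq_0 u v Hu (Hann t)). assert (N2 := Hne t). fold v in N2. field. auto.
  - lra.
  - intros t _. apply (cont_comp RtoC (fun v => Cder (dd iota u) v * (Ci * v) / dd iota u v)%C (circle rho)); auto.
    apply holo_cont. now apply regular_part_holo.
  - intros t _. apply cont_div. apply cont_mult. apply cont_const. auto. apply cont_minus. auto. apply cont_const. auto.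
Qed.
End Ring.

(** The difference quotient has no zero for v anywhere in the annulus, so the integrand is
    holomorphic between the two circles. *)
Lemma regular_part_rho r rho rho' iota u : ring r rho iota -> 1 < rho' < r -> ann r u ->
  regular_part rho iota u = regular_part rho' iota u.
Proof.
  intros HR Hr' Hu. assert (Hr := ring_rho _ _ _ HR).
  assert (K : forall s s', 1 < s <= s' -> s' < r -> regular_part s iota u = regular_part s' iota u).
  { intros s s' Hs Hs'. apply circ_invariant; try lra. intros v Hv. replace (v - 0)%C with v in Hv by ring.
    apply (regular_part_holo r rho iota HR); auto. unfold ann. lra. }
  destruct (Rle_dec rho rho'). apply K; lra. symmetry. apply K; lra.
Qed.

Lemma wd_loc r rho iota a : ring r rho iota -> ~ on rho iota a ->
  exists d, 0 < d /\ forall b, Cmod (b - a) < d -> ~ on rho iota b /\ wd rho iota b = wd rho iota a.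
Proof.
  intros HR Ha. assert (Hr := ring_rho _ _ _ HR).
  destruct (wind_loc _ _ (ring_loop r rho iota HR) a) as [d [Hd H]]. apply off_on; auto. lra.
  exists d. split; auto. intros b Hb. destruct (H b Hb). split; auto. apply off_on in H0; auto. lra.
Qed.

(** On a circle of radius below |u| and |v| the residue term vanishes and the regular part is itself
    a winding number. It is therefore constant along a spiral from u to v that stays outside that
    circle. *)
Lemma regular_part_const r rho iota u v : ring r rho iota -> ann r u -> ann r v ->
  regular_part rho iota u = regular_part rho iota v.
Proof.
  intros HR Hu Hv. assert (Hr := ring_rho _ _ _ HR).
  set (rho' := (1 + Rmin (Cmod u) (Cmod v)) / 2).
  assert (M1 := Rmin_l (Cmod u) (Cmod v)). assert (M2 := Rmin_r (Cmod u) (Cmod v)).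
  assert (M3 : 1 < Rmin (Cmod u) (Cmod v)) by (unfold ann in *; apply Rmin_glb_lt; lra).
  assert (H' : 1 < rho' < r) by (unfold rho', ann in *; lra).
  assert (HR' := ring_with r rho iota HR rho' H').
  rewrite !(regular_part_rho r rho rho' iota) by auto.
  assert (E : forall w, ann r w -> rho' < Cmod w -> wd rho' iota (iota w) = regular_part rho' iota w).
  { intros w Hw Hl. rewrite (wd_iota r rho' iota HR' w Hw) by lra. destruct (Rlt_dec (Cmod w) rho') as [Hlt|Hlt]; [exfalso; lra|ring]. }
  rewrite <- !E; auto; try (unfold rho' in *; lra).
  destruct (circle_surj u) as [s [_ Es]]. destruct (circle_surj v) as [t [_ Et]].
  set (x := Cmod u) in *. set (y := Cmod v) in *.
  set (g := fun a => ((RtoC x + RtoC a * (RtoC y - RtoC x)) * cis (s + a * (t - s)))%C).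
  assert (Hg : forall a, 0 <= a <= 1 -> ann r (g a) /\ rho' < Cmod (g a)).
  { intros a Ha. unfold g. rewrite <- RtoC_minus, <- RtoC_mult, <- RtoC_plus.
    assert (K : rho' < x + a * (y - x) < r).
    { destruct Hu as [_ Hu]. destruct Hv as [_ Hv]. fold x in Hu. fold y in Hv.
      assert (0 <= (1 - a) * (x - Rmin x y)) by (apply Rmult_le_pos; lra).
      assert (0 <= a * (y - Rmin x y)) by (apply Rmult_le_pos; lra).
      assert (0 <= (1 - a) * (r - x)) by (apply Rmult_le_pos; lra).
      split. unfold rho'. lra. destruct (Req_dec a 0) as [->|Ha0]. lra.
      assert (0 < a * (r - y)) by (apply Rmult_lt_0_compat; lra). lra. }
    unfold ann. rewrite Cmod_mult, Cmod_cis, Cmod_R, Rabs_pos_eq, Rmult_1_r by lra. repeat split; lra. }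
  assert (E0 : g 0 = u). { unfold g. rewrite Es. unfold circle. rewrite Rmult_0_l, Rplus_0_r. ring. }
  assert (E1 : g 1 = v). { unfold g. rewrite Et. unfold circle. replace (s + 1 * (t - s)) with t by ring. ring. }
  rewrite <- E0, <- E1.
  apply (path_connected (wd rho' iota) (fun a => iota (g a)) 0 1). lra.
  - intros a Ha. apply (cont_comp RtoC iota g). apply holo_cont, (ring_holo _ _ _ HR). now apply Hg.
    apply cont_mult. apply rcont_line. 
    assert (L : cont RtoC (fun a => RtoC s + RtoC a * (RtoC t - RtoC s))%C a) by apply rcont_line.
    intros eps He. destruct (cis_cont (s + a * (t - s)) eps He) as [d [Hd K]]. destruct (L d Hd) as [d2 [Hd2 K2]].
    exists d2. split; auto. intros b Hb. apply K. specialize (K2 b Hb).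
    rewrite !RtoC_plus, !RtoC_mult, !RtoC_minus. exact K2.
  - intros a Ha. destruct (Hg a Ha) as [A1 A2].
    destruct (wd_loc r rho' iota (iota (g a)) HR') as [d [Hd K]]. apply (off_iota r); auto. lra.
    exists d. split; auto. intros w Hw. now apply K.
Qed.

Lemma ring_far r rho iota : ring r rho iota -> exists M, forall a, M < Cmod a -> out rho iota a.
Proof.
  intros HR. assert (Hr := ring_rho _ _ _ HR). destruct (wind_far _ _ (ring_loop r rho iota HR)) as [M H].
  exists M. intros a Ha. destruct (H a Ha). split; auto. apply off_on in H0; auto. lra.
Qed.

Lemma ring_near_circle r rho u eps : 1 < rho < r -> Cmod u = rho -> 0 < eps ->
  (exists v, ann r v /\ Cmod v < rho /\ Cmod (v - u) < eps) /\ (exists v, ann r v /\ rho < Cmod v /\ Cmod (v - u) < eps).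
Proof.
  intros Hr Hu He.
  assert (Hk : forall k, 0 < k -> Cmod (RtoC k * u) = k * rho).
  { intros k K. rewrite Cmod_mult, Hu, Cmod_R, Rabs_pos_eq; lra. }
  assert (Hd : forall k, Cmod (RtoC k * u - u) = Rabs (k - 1) * rho).
  { intros k. replace (RtoC k * u - u)%C with (RtoC (k - 1) * u)%C by (rewrite RtoC_minus; ring).
    now rewrite Cmod_mult, Hu, Cmod_R. }
  set (h := Rmin (eps / (2 * rho)) (Rmin ((rho - 1) / (2 * rho)) ((r - rho) / (2 * rho)))).
  assert (M1 := Rmin_l (eps / (2 * rho)) (Rmin ((rho - 1) / (2 * rho)) ((r - rho) / (2 * rho)))).
  assert (M2 := Rmin_r (eps / (2 * rho)) (Rmin ((rho - 1) / (2 * rho)) ((r - rho) / (2 * rho)))).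
  assert (M3 := Rmin_l ((rho - 1) / (2 * rho)) ((r - rho) / (2 * rho))).
  assert (M4 := Rmin_r ((rho - 1) / (2 * rho)) ((r - rho) / (2 * rho))). fold h in M1, M2.
  assert (Hh : 0 < h). { unfold h. repeat apply Rmin_pos; apply Rdiv_lt_0_compat; lra. }
  assert (N1 : h * rho <= eps / 2). { replace (eps / 2) with (eps / (2 * rho) * rho) by (field; lra). apply Rmult_le_compat_r; lra. }
  assert (N2 : h * rho <= (rho - 1) / 2). { replace ((rho - 1) / 2) with ((rho - 1) / (2 * rho) * rho) by (field; lra). apply Rmult_le_compat_r; lra. }
  assert (N3 : h * rho <= (r - rho) / 2). { replace ((r - rho) / 2) with ((r - rho) / (2 * rho) * rho) by (field; lra). apply Rmult_le_compat_r; lra. }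
  assert (N0 : 0 < h * rho) by (apply Rmult_lt_0_compat; lra).
  assert (h < 1). { apply Rmult_lt_reg_r with rho; lra. }
  split.
  - exists (RtoC (1 - h) * u)%C. unfold ann. rewrite Hk, Hd by lra. replace (1 - h - 1) with (- h) by ring.
    rewrite Rabs_Ropp, Rabs_pos_eq by lra. repeat split; lra.
  - exists (RtoC (1 + h) * u)%C. unfold ann. rewrite Hk, Hd by lra. replace (1 + h - 1) with h by ring.
    rewrite Rabs_pos_eq by lra. repeat split; lra.
Qed.

(** Here [c] is the winding value on the side |u| > rho of the curve. Far away the winding number is
    0, which must be one of the two values [c] and [c + per 1]. *)
Lemma ring_inner_values r rho iota : ring r rho iota -> exists c, (c = 0 \/ c = - per 1)%C /\
  (forall u, ann r u -> Cmod u <> rho -> wd rho iota (iota u) = (c + if Rlt_dec (Cmod u) rho then per 1 else 0)%C) /\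
  forall a, ~ on rho iota a -> wd rho iota a = c \/ wd rho iota a = (c + per 1)%C.
Proof.
  intros HR. assert (Hr := ring_rho _ _ _ HR).
  set (c := regular_part rho iota (RtoC rho)).
  assert (Hrr : ann r (RtoC rho)). { unfold ann. rewrite Cmod_R, Rabs_pos_eq; lra. }
  assert (Hc : forall u, ann r u -> Cmod u <> rho -> wd rho iota (iota u) = (c + if Rlt_dec (Cmod u) rho then per 1 else 0)%C).
  { intros u Hu Hn. rewrite (wd_iota r rho iota HR u Hu Hn). f_equal. now apply (regular_part_const r). }
  assert (Hv : forall a, ~ on rho iota a -> wd rho iota a = c \/ wd rho iota a = (c + per 1)%C).
  (* Points with a third winding value form a set that is open and closed: near the curve only the
     two values computed on the annulus occur. If nonempty, it would contain points of the curve. *)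
  { set (S := fun a => ~ on rho iota a /\ wd rho iota a <> c /\ wd rho iota a <> (c + per 1)%C).
    assert (HS : forall a, ~ S a).
    { intros a Ha. assert (K : S (iota (RtoC rho))).
      { apply plane_connected with a; auto. intros z. destruct (classic (on rho iota z)) as [[u [Hu <-]]|Hz].
        - assert (Hua : ann r u) by (unfold ann; lra).
          destruct (ring_open r rho iota HR u Hua 1 Rlt_0_1) as [d [Hd K]]. exists d. split; auto. intros w Hw.
          destruct (K w Hw) as [v [Hv [_ <-]]]. split.
          + intros [S1 [S2 S3]]. exfalso. destruct (Req_dec (Cmod v) rho) as [E|E]. apply S1. now exists v.
            rewrite (Hc v Hv E) in S2, S3. destruct (Rlt_dec (Cmod v) rho). now apply S3. apply S2. ring.
          + intros [S1 _]. exfalso. apply S1. now exists u.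
        - destruct (wd_loc r rho iota z HR Hz) as [d [Hd K]]. exists d. split; auto. intros w Hw.
          destruct (K w Hw) as [K1 K2]. unfold S. rewrite K2. tauto. }
      destruct K as [K _]. apply K. exists (RtoC rho). split; auto. rewrite Cmod_R, Rabs_pos_eq; lra. }
    intros a Ha. apply NNPP. intro Hn. apply (HS a). unfold S. tauto. }
  exists c. split; [|split]; auto.
  destruct (ring_far r rho iota HR) as [M HM].
  destruct (HM (RtoC (Rabs M + 1))) as [K1 K2].
  { rewrite Cmod_R. assert (0 <= Rabs M) by apply Rabs_pos. rewrite Rabs_pos_eq by lra. generalize (Rle_abs M). lra. }
  destruct (Hv _ K1) as [E|E]; rewrite K2 in E. now left. right.
  replace c with (c + per 1 - per 1)%C by ring. rewrite <- E. ring.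
Qed.

(** The sign of [sg] records whether the side |u| < rho of the curve is its inside or its outside;
    in both cases the two sides accumulate at every point of the curve. *)
Lemma ring_values r rho iota : ring r rho iota -> exists sg, (sg = per 1 \/ sg = - per 1)%C /\
  (forall a, ~ on rho iota a -> wd rho iota a = 0%C \/ wd rho iota a = sg) /\
  (forall a eps, on rho iota a -> 0 < eps ->
    (exists u, ann r u /\ Cmod u <> rho /\ Cmod (iota u - a) < eps /\ ins rho iota (iota u)) /\
    (exists u, ann r u /\ Cmod u <> rho /\ Cmod (iota u - a) < eps /\ out rho iota (iota u))).
Proof.
  intros HR. assert (Hr := ring_rho _ _ _ HR).
  destruct (ring_inner_values r rho iota HR) as [c [Hc [Hu Hv]]].
  assert (Hp : per 1 <> 0%C). { rewrite <- per_0. intro E. apply per_inj in E. discriminate. }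
  assert (Hp' : (- per 1 <> 0)%C). { intro E. apply Hp. replace (per 1) with (- - per 1)%C by ring. rewrite E. ring. }
  assert (Hnear : forall a eps, on rho iota a -> 0 < eps ->
    (exists v, ann r v /\ Cmod v <> rho /\ Cmod (iota v - a) < eps /\ wd rho iota (iota v) = (c + per 1)%C) /\
    (exists v, ann r v /\ Cmod v <> rho /\ Cmod (iota v - a) < eps /\ wd rho iota (iota v) = c)).
  { intros a eps [u [Eu <-]] He. assert (Hua : ann r u) by (unfold ann; lra).
    destruct (holo_cont iota u (ring_holo _ _ _ HR u Hua) eps He) as [d [Hd K]].
    destruct (ring_near_circle r rho u d Hr Eu Hd) as [[v [V1 [V2 V3]]] [w [W1 [W2 W3]]]].
    split.
    - exists v. repeat split; try apply V1; try lra. now apply K. rewrite Hu by (auto; lra). destruct (Rlt_dec (Cmod v) rho); [auto|lra].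
    - exists w. repeat split; try apply W1; try lra. now apply K. rewrite Hu by (auto; lra). destruct (Rlt_dec (Cmod w) rho); [lra|ring]. }
  destruct Hc as [-> | ->].
  - exists (per 1). split; auto. split.
    + intros a Ha. destruct (Hv a Ha) as [E|E]; rewrite E; auto. right. ring.
    + intros a eps Ha He. destruct (Hnear a eps Ha He) as [[v [V1 [V2 [V3 V4]]]] [w [W1 [W2 [W3 W4]]]]]. split.
      * exists v. repeat split; try apply V1; auto. now apply (off_iota r). rewrite V4. now replace (0 + per 1)%C with (per 1) by ring.
      * exists w. repeat split; try apply W1; auto. now apply (off_iota r).
  - exists (- per 1)%C. split; auto. split.
    + intros a Ha. destruct (Hv a Ha) as [E|E]; rewrite E; auto. left. ring.
    + intros a eps Ha He. destruct (Hnear a eps Ha He) as [[v [V1 [V2 [V3 V4]]]] [w [W1 [W2 [W3 W4]]]]]. split.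
      * exists w. repeat split; try apply W1; auto. now apply (off_iota r). now rewrite W4.
      * exists v. repeat split; try apply V1; auto. now apply (off_iota r). rewrite V4. ring.
Qed.

(** * The argument principle *)

Lemma real_subsequence (u : nat -> R) M : (forall n, Rabs (u n) <= M) ->
  exists (phi : nat -> nat) (l : R), (forall n, (phi n < phi (S n))%nat) /\
    forall eps, 0 < eps -> exists N, forall n, (N <= n)%nat -> Rabs (u (phi n) - l) < eps.
Proof.
  intros HM.
  destruct (Bolzano_Weierstrass u (fun x => - M <= x <= M) (compact_P3 (- M) M)) as [l Hl].
  { intros n. specialize (HM n). revert HM. unfold Rabs. destruct Rcase_abs; lra. }
  assert (Hk : forall n N, exists p, (N <= p)%nat /\ Rabs (u p - l) < / INR (S n)).
  { intros n N. assert (Hp : 0 < / INR (S n)) by (apply Rinv_0_lt_compat, lt_0_INR; lia).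
    destruct (Hl (fun x => Rabs (x - l) < / INR (S n)) N) as [p [H1 H2]].
    - exists (mkposreal _ Hp). intros x Hx. exact Hx.
    - now exists p. }
  destruct (dependent_choice (fun n p => Rabs (u p - l) < / INR (S n)) (fun n p q => (p < q)%nat)
    (proj1_sig (constructive_indefinite_description _ (Hk O O)))) as [phi [_ Hphi]].
  - apply (proj2_sig (constructive_indefinite_description _ (Hk O O))).
  - intros n p _. destruct (Hk (S n) (S p)) as [q [H1 H2]]. exists q. split; auto.
  - exists phi, l. split. intro n. apply Hphi.
    intros eps He. destruct (archimed_cor1 eps He) as [N [HN HN0]]. exists N. intros n Hn.
    eapply Rlt_trans. apply Hphi. eapply Rle_lt_trans; [|apply HN].
    apply Rinv_le_contravar. apply lt_0_INR; lia. apply le_INR. lia.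
Qed.

Lemma increasing_ge (phi : nat -> nat) : (forall n, (phi n < phi (S n))%nat) -> forall n, (n <= phi n)%nat.
Proof. intros H n. induction n. lia. specialize (H n). lia. Qed.

Lemma complex_subsequence (u : nat -> C) M : (forall n, Cmod (u n) <= M) ->
  exists (phi : nat -> nat) (l : C), (forall n, (phi n < phi (S n))%nat) /\
    forall eps, 0 < eps -> exists N, forall n, (N <= n)%nat -> Cmod (u (phi n) - l) < eps.
Proof.
  intros HM.
  destruct (real_subsequence (fun n => Re (u n)) M) as [phi [x [Hp Hx]]].
  { intro n. eapply Rle_trans. apply re_le_Cmod. auto. }
  destruct (real_subsequence (fun n => Im (u (phi n))) M) as [psi [y [Hq Hy]]].
  { intro n. eapply Rle_trans. apply im_le_Cmod. auto. }
  assert (Hmono : forall a b, (a < b)%nat -> (phi a < phi b)%nat).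
  { intros a b H. induction H. apply Hp. eapply Nat.lt_trans. apply IHle. apply Hp. }
  exists (fun n => phi (psi n)), (x, y). split. intro n. apply Hmono, Hq.
  intros eps He. destruct (Hx (eps / 2)) as [N1 H1]. lra. destruct (Hy (eps / 2)) as [N2 H2]. lra.
  exists (Nat.max N1 N2). intros n Hn. eapply Rle_lt_trans. apply Cmod_le_re_im.
  rewrite re_minus, im_minus. unfold Re at 2, Im at 2. simpl fst. simpl snd.
  assert (K1 := H1 (psi n)). assert (K2 := H2 n). assert (K3 := increasing_ge psi Hq n).
  specialize (K1 ltac:(lia)). specialize (K2 ltac:(lia)). lra.
Qed.

Lemma bounded_on_closed_ball F a : (forall z, Cmod z <= a -> cont idC F z) -> exists M, forall z, Cmod z <= a -> Cmod (F z) <= M.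
Proof.
  intros HF. apply NNPP. intro Hn.
  assert (H : forall n : nat, exists z, Cmod z <= a /\ INR n < Cmod (F z)).
  { intro n. apply NNPP. intro K. apply Hn. exists (INR n). intros z Hz. destruct (Rle_dec (Cmod (F z)) (INR n)); auto.
    exfalso. apply K. exists z. split; auto. lra. }
  set (u := fun n => proj1_sig (constructive_indefinite_description _ (H n))).
  assert (Hu : forall n, Cmod (u n) <= a /\ INR n < Cmod (F (u n))).
  { intro n. apply (proj2_sig (constructive_indefinite_description _ (H n))). }
  destruct (complex_subsequence u a) as [phi [l [Hp Hl]]]. { intro n. apply Hu. }
  assert (Hla : Cmod l <= a).
  { destruct (Rle_dec (Cmod l) a) as [|Hd]; auto. exfalso. destruct (Hl (Cmod l - a)) as [N HN]. lra.
    specialize (HN N (le_n N)). destruct (Hu (phi N)) as [K _]. generalize (Cmod_tri_inv l (u (phi N))). rewrite Cmod_sub_sym. lra. }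
  destruct (cont_bounded F l (HF l Hla)) as [d [M [Hd HM]]]. destruct (Hl d Hd) as [N HN].
  destruct (INR_unbounded M) as [k Hk].
  set (n := Nat.max N k). specialize (HM (u (phi n)) (HN n ltac:(lia))). destruct (Hu (phi n)) as [_ K].
  assert (INR k <= INR (phi n)). { apply le_INR. generalize (increasing_ge phi Hp n). lia. } lra.
Qed.

(** The primitive integrates along radii. Differentiating under the integral produces the
    s-derivative of s F(s c), which integrates to F(c). *)
Lemma primitive F Rd : holo_ball F 0 Rd -> exists P, forall c, Cmod c < Rd -> der idC P c (F c).
Proof.
  intros HF. exists (fun z => cint (fun s => F (RtoC s * z) * z)%C 0 1). intros c Hc.
  set (r := (Rd - Cmod c) / 4). assert (Hr : 0 < r) by (unfold r; lra).
  assert (Hs : forall s z, 0 <= s <= 1 -> Cmod (RtoC s * z) <= Cmod z).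
  { intros s z Hs. rewrite Cmod_mult, Cmod_R, Rabs_pos_eq by lra. generalize (Cmod_ge_0 z). nra. }
  assert (HF' : forall z, Cmod z < Rd -> holo F z).
  { intros z Hz. apply HF. now replace (z - 0)%C with z by ring. }
  destruct (bounded_on_closed_ball F (Cmod c + 2 * r)) as [M HM].
  { intros z Hz. apply holo_cont, HF'. unfold r in *. lra. }
  assert (Hz : forall z, Cmod (z - c) < 2 * r -> Cmod z <= Cmod c + 2 * r).
  { intros z Hz. generalize (Cmod_tri_inv z c). lra. }
  assert (HD : forall s z, Cmod (RtoC s * z) < Rd ->
    der idC (fun z => F (RtoC s * z) * z)%C z (Cder F (RtoC s * z) * RtoC s * z + F (RtoC s * z))%C).
  { intros s z K.
    eapply der_eq. apply der_mult; [|apply der_id]. apply (der_comp idC F (fun z => RtoC s * z)%C). now apply Cder_spec, HF'.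
    apply der_scal, der_id. cbv beta. ring. }
  assert (Rc : forall s z, cont RtoC (fun s => RtoC s * z)%C s).
  { intros s z. apply cont_mult. apply cont_e. apply cont_const. }
  assert (Hcc : Cmod (c - c) < 2 * r) by (rewrite Cmod_diag; lra).
  assert (Cd : rcont_on (fun s => Cder F (RtoC s * c) * RtoC s * c + F (RtoC s * c))%C 0 1).
  { intros s H1. assert (K := Hs s c H1). apply cont_plus.
    - apply cont_mult; [|apply cont_const]. apply cont_mult; [|apply cont_e].
      apply (cont_comp RtoC (Cder F)); auto. apply Cder_cont with (Rd - Cmod c). lra.
      intros w Hw. apply HF'. generalize (Cmod_tri_inv w (RtoC s * c)). lra.
    - apply (cont_comp RtoC F); auto. apply holo_cont, HF'. lra. }
  eapply der_eq. apply (der_param (fun z s => F (RtoC s * z) * z)%C c r (M * (Cmod c + 2 * r)) 0 1).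
  - lra. - auto.
  - intros s H1 z H2. eexists. apply HD. generalize (Hs s z H1) (Hz z H2). unfold r in *. lra.
  - intros s z H1 H2. rewrite Cmod_mult. specialize (Hz z H2). apply Rmult_le_compat; try apply Cmod_ge_0; auto.
    apply HM. generalize (Hs s z H1). lra.
  - intros z H2 s H1. apply cont_mult; [|apply cont_const]. apply (cont_comp RtoC F); auto. apply holo_cont, HF'.
    generalize (Hs s z H1) (Hz z H2). unfold r in *. lra.
  - intros s H1. assert (K := Cd s H1). destruct (Rc s c (Rd - Cmod c)) as [d [Hd K2]]. lra.
    revert K. apply cont_loc with d; auto. intros y Hy. symmetry. apply Cder_eq, HD.
    specialize (K2 y Hy). generalize (Cmod_tri_inv (RtoC y * c) (RtoC s * c)) (Hs s c H1). lra.
  - rewrite (cint_ext _ (fun s => Cder F (RtoC s * c) * RtoC s * c + F (RtoC s * c))%C); [|lra|].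
    rewrite (cint_FTC (fun s => RtoC s * F (RtoC s * c))%C).
    + replace (RtoC 1 * c)%C with c by ring. ring.
    + lra.
    + intros s H1. assert (K := Hs s c H1).
      eapply der_eq. apply (der_mult RtoC RtoC (fun s => F (RtoC s * c)%C)). apply der_e.
      apply (der_comp RtoC F (fun s => RtoC s * c)%C). apply Cder_spec, HF'. lra.
      apply (der_mult RtoC RtoC (fun _ => c)). apply der_e. apply der_const. cbv beta. ring.
    + auto.
    + intros s H1. apply Cder_eq, HD. generalize (Hs s c H1). lra.
Qed.

Definition entire (g : C -> C) : Prop := forall z, holo g z.

Definition dlog (rho : R) (iota F : C -> C) : C :=
  cint (fun t => Cder F (ploop iota rho t) * dploop iota rho t / F (ploop iota rho t))%C 0 (2 * PI).

Definition wd_sum (rho : R) (iota : C -> C) (zs : list C) : C := fold_right (fun a s => (wd rho iota a + s)%C) (RtoC 0) zs.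

Lemma dlog_lin_prod r rho iota zs q Rd : ring r rho iota -> (forall u, Cmod u = rho -> Cmod (iota u) < Rd) ->
  holo_ball q 0 Rd -> (forall u, Cmod u = rho -> q (iota u) <> 0%C) ->
  (forall a, In a zs -> ~ on rho iota a) ->
  dlog rho iota (fun z => lin_prod zs z * q z)%C = (wd_sum rho iota zs + dlog rho iota q)%C.
Proof.
  intros HR Hb Hq Hq0 Hzs. assert (HP := two_PI_pos). assert (Hr := ring_rho _ _ _ HR).
  assert (HL := ring_loop r rho iota HR).
  assert (Hu : forall t, Cmod (circle rho t) = rho) by (intro; apply Cmod_circle; lra).
  set (ga := ploop iota rho) in *. set (dga := dploop iota rho) in *.
  assert (Hga : forall t, Cmod (ga t) < Rd) by (intro t; apply Hb, Hu).
  assert (HB : forall t, exists d, 0 < d /\ forall w, Cmod (w - ga t) < d -> Cmod w < Rd).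
  { intro t. exists (Rd - Cmod (ga t)). split. specialize (Hga t); lra. intros w Hw. generalize (Cmod_tri_inv w (ga t)). lra. }
  assert (Hq' : forall z, Cmod z < Rd -> holo q z). { intros z Hz. apply Hq. now replace (z - 0)%C with z by ring. }
  assert (Hlp : forall l z, holo (lin_prod l) z).
  { induction l as [|a l IH]; intro z. apply holo_const. apply (holo_mult (fun z => z - a)%C (lin_prod l)); auto.
    apply holo_minus. apply holo_id. apply holo_const. }
  induction zs as [|a zs IH].
  - simpl. replace (0 + dlog rho iota q)%C with (dlog rho iota q) by ring. f_equal. apply functional_extensionality. intro z. ring.
  - simpl wd_sum. rewrite <- Cplus_assoc, <- IH by (intros; apply Hzs; now right).
    assert (Ha : ~ on rho iota a) by (apply Hzs; now left).
    set (F := fun z => (lin_prod zs z * q z)%C).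
    assert (HF : forall t, holo F (ga t)). { intro t. apply holo_mult. apply Hlp. apply Hq', Hga. }
    assert (HFb : forall t, exists d, 0 < d /\ holo_ball F (ga t) d).
    { intro t. destruct (HB t) as [d [Hd K]]. exists d. split; auto. intros w Hw. apply holo_mult. apply Hlp. apply Hq'. now apply K. }
    assert (HF0 : forall t, F (ga t) <> 0%C).
    { intro t. apply Cmult_neq_0. intro E. apply lin_prod_zero in E. apply (Hzs (ga t)). now right.
      exists (circle rho t). split; auto. apply Hq0, Hu. }
    assert (Hoff : off ga a) by (apply off_on; auto; lra).
    unfold dlog, wd, wind. fold ga dga. rewrite <- cint_plus.
    + apply cint_ext. lra. intros t _. simpl lin_prod.
      rewrite (Cder_eq (fun z => (z - a) * lin_prod zs z * q z)%C (ga t) (F (ga t) + (ga t - a) * Cder F (ga t))%C).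
      * fold (F (ga t)). replace ((ga t - a) * lin_prod zs (ga t) * q (ga t))%C with ((ga t - a) * F (ga t))%C by (unfold F; ring).
        field. split. apply HF0. apply Csub_neq_0, Hoff.
      * assert (K : der idC (fun z => (z - a) * F z)%C (ga t) ((1 - 0) * F (ga t) + (ga t - a) * Cder F (ga t))%C).
        { apply (der_mult idC (fun z => z - a)%C F). apply der_minus. apply der_id. apply der_const. apply Cder_spec, HF. }
        apply (der_eq _ _ _ _ (F (ga t) + (ga t - a) * Cder F (ga t))%C) in K; [|ring].
        revert K. apply der_loc with 1. lra. intros y _. unfold F. ring.
    + lra.
    + intros t _. now apply wind_integrand_cont.
    + intros t _. assert (Cg : cont RtoC ga t) by now apply loop_rcont with dga. destruct (HFb t) as [d [Hd K]].
      apply cont_div. apply cont_mult. apply (cont_comp RtoC (Cder F) ga); auto. now apply Cder_cont with d.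
      apply (loop_cont _ _ HL). apply (cont_comp RtoC F ga); auto. apply holo_cont, HF. apply HF0.
Qed.

Lemma dlog_nonvanishing r rho iota q Rd : ring r rho iota -> (forall u, Cmod u = rho -> Cmod (iota u) < Rd) ->
  holo_ball q 0 Rd -> (forall z, Cmod z < Rd -> q z <> 0%C) -> dlog rho iota q = 0%C.
Proof.
  intros HR Hb Hq Hq0. assert (HP := two_PI_pos). assert (Hr := ring_rho _ _ _ HR).
  assert (HL := ring_loop r rho iota HR).
  assert (Hu : forall t, Cmod (circle rho t) = rho) by (intro; apply Cmod_circle; lra).
  set (ga := ploop iota rho) in *. set (dga := dploop iota rho) in *.
  assert (Hga : forall t, Cmod (ga t) < Rd) by (intro t; apply Hb, Hu).
  assert (Hq' : forall z, Cmod z < Rd -> holo q z). { intros z Hz. apply Hq. now replace (z - 0)%C with z by ring. }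
  assert (HqD : forall z, Cmod z < Rd -> holo (Cder q) z).
  { intros z Hz. apply Cder_holo with (Rd - Cmod z). lra. intros w Hw. apply Hq'. generalize (Cmod_tri_inv w z). lra. }
  destruct (primitive (fun z => Cder q z / q z)%C Rd) as [P HPr].
  { intros z Hz. replace (z - 0)%C with z in Hz by ring. apply holo_div; auto. }
  unfold dlog. fold ga dga. rewrite (cint_FTC (fun t => P (ga t))).
  - rewrite (loop_closed _ _ HL). ring.
  - lra.
  - intros t _. eapply der_eq. apply (der_comp RtoC P ga). now apply HPr. apply (loop_der _ _ HL).
    fold (dga t). field. now apply Hq0.
  - intros t _. assert (Cg : cont RtoC ga t) by now apply loop_rcont with dga.
    apply cont_div. apply cont_mult. apply (cont_comp RtoC (Cder q) ga); auto. apply holo_cont; auto.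
    apply (loop_cont _ _ HL). apply (cont_comp RtoC q ga); auto. apply holo_cont; auto. auto.
Qed.

(** All nonzero winding values equal the same [sg], so nothing cancels: [n] is the number of listed
    points inside, with multiplicity. *)
Lemma wd_sum_count r rho iota sg zs : ring r rho iota -> (sg = per 1 \/ sg = - per 1)%C ->
  (forall a, ~ on rho iota a -> wd rho iota a = 0%C \/ wd rho iota a = sg) ->
  (forall a, In a zs -> ~ on rho iota a) ->
  exists n, wd_sum rho iota zs = (RtoC (INR n) * sg)%C /\
    (n = O -> forall a, In a zs -> ~ ins rho iota a) /\
    (n <> O -> exists a, In a zs /\ ins rho iota a) /\
    (n = 1%nat -> forall a b, In a zs -> In b zs -> ins rho iota a -> ins rho iota b -> a = b).
Proof.
  intros HR Hsg Hv. induction zs as [|a zs IH]; intros Hzs.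
  - exists O. repeat split; simpl; try tauto; try lia. ring.
  - destruct IH as [n [H1 [H2 [H3 H4]]]]. intros; apply Hzs; now right.
    assert (Ha : ~ on rho iota a) by (apply Hzs; now left).
    destruct (classic (wd rho iota a = 0%C)) as [E|E].
    + assert (Hna : ~ ins rho iota a) by (unfold ins; tauto).
      exists n. simpl. rewrite E, H1. split. ring. split; [|split].
      * intros Hn b [<-|Hb]; auto.
      * intros Hn. destruct (H3 Hn) as [b [Hb1 Hb2]]. exists b. auto.
      * intros Hn b c [<-|Hb] [<-|Hc] Ib Ic; auto; tauto.
    + destruct (Hv a Ha) as [K|K]; [tauto|]. exists (S n). split; [|split; [|split]].
      * rewrite S_INR, RtoC_plus. simpl. rewrite K, H1. ring.
      * discriminate.
      * intros _. exists a. split. now left. split; auto.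
      * intros Hn. assert (Hn0 : n = O) by lia. intros b c [<-|Hb] [<-|Hc] Ib Ic; auto.
        exfalso; apply (H2 Hn0 c); auto. exfalso; apply (H2 Hn0 b); auto. exfalso; apply (H2 Hn0 b); auto.
Qed.

(** The zeros of g - v inside the curve are counted by the winding of the image curve about v. Since
    that curve is again the core of a conformal annulus, its winding has modulus 0 or 2 pi, so the
    count is 0 or 1. *)
Lemma argument_principle r rho iota g v : ring r rho iota -> entire g -> ring r rho (fun u => g (iota u)) ->
  ~ on rho (fun u => g (iota u)) v ->
  (ins rho (fun u => g (iota u)) v <-> exists z, ins rho iota z /\ g z = v) /\
  (forall z z', ins rho iota z -> ins rho iota z' -> g z = v -> g z' = v -> z = z').
Proof.
  intros HR Hg HK Hv. set (ka := fun u => g (iota u)) in *. assert (HP := two_PI_pos). assert (Hr := ring_rho _ _ _ HR).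
  destruct (ring_far r rho iota HR) as [M0 HM0].
  destruct (loop_bounds _ _ (ring_loop r rho iota HR)) as [M1 [_ [_ [HM1 _]]]].
  (* [factorization] controls zeros only in the disk of radius Rd / 16, which must contain the curve
     together with its inside. *)
  set (Rd := 16 * (Rabs M0 + Rabs M1 + 1)).
  assert (B0 := Rle_abs M0). assert (B1 := Rle_abs M1). assert (B2 := Rabs_pos M0). assert (B3 := Rabs_pos M1).
  assert (HRd : 0 < Rd) by (unfold Rd; lra).
  assert (Hin : forall z, ins rho iota z -> Cmod z < Rd / 16).
  { intros z [_ Hz]. destruct (Rlt_dec M0 (Cmod z)) as [K|K]. destruct (HM0 z K). tauto. unfold Rd. lra. }
  assert (Hcirc : forall u, Cmod u = rho -> Cmod (iota u) < Rd / 16).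
  { intros u Hu. destruct (circle_surj u) as [t [_ Et]]. rewrite Hu in Et. specialize (HM1 t). unfold ploop in HM1.
    rewrite <- Et in HM1. unfold Rd. lra. }
  set (F := fun z => (g z - v)%C).
  assert (HF : entire F) by (intro z; apply holo_minus; [apply Hg|apply holo_const]).
  assert (HF0 : forall u, Cmod u = rho -> F (iota u) <> 0%C).
  { intros u Hu. apply Csub_neq_0. intro E. apply Hv. now exists u. }
  destruct (factorization F 0%C Rd HRd) as [[zs [q [(F1 & F2 & F3) F4]]]|Hz].
  { intros z _. apply HF. }
  2:{ exfalso. assert (Hu : Cmod (circle rho 0) = rho) by (apply Cmod_circle; lra). apply (HF0 _ Hu). apply Hz.
      replace (iota (circle rho 0) - 0)%C with (iota (circle rho 0)) by ring. now apply Hcirc. }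
  assert (F1' : forall a, In a zs -> Cmod a < Rd / 16). { intros a Ha. specialize (F1 a Ha). now replace (a - 0)%C with a in F1 by ring. }
  assert (F4' : forall z, Cmod z < Rd / 16 -> q z <> 0%C). { intros z Hz. apply F4. now replace (z - 0)%C with z by ring. }
  assert (F2' : holo_ball q 0 (Rd / 16)). { intros z Hz. apply F2. lra. }
  assert (Hzer : forall z, Cmod z < Rd / 16 -> (In z zs <-> g z = v)).
  { intros z Hz. rewrite <- lin_prod_zero. split.
    - intro E. apply Cmod_sub_0. fold (F z). rewrite F3, E. replace (0 * q z)%C with (RtoC 0) by ring. apply Cmod_0.
    - intro E. apply NNPP. intro K. apply (Cmult_neq_0 _ _ K (F4' z Hz)). rewrite <- F3. unfold F. rewrite E. ring. }
  assert (Hzoff : forall a, In a zs -> ~ on rho iota a).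
  { intros a Ha [u [Hu E]]. apply (HF0 u Hu). rewrite F3, E. replace (lin_prod zs a) with (RtoC 0). ring.
    symmetry. now apply lin_prod_zero. }
  assert (E1 : wd rho ka v = wd_sum rho iota zs).
  { transitivity (dlog rho iota (fun z => lin_prod zs z * q z)%C).
    - replace (fun z => lin_prod zs z * q z)%C with F by (apply functional_extensionality; auto).
      unfold wd, wind, dlog. apply cint_ext. lra. intros t _. unfold ploop, dploop.
      assert (Hu : ann r (circle rho t)) by (unfold ann; rewrite Cmod_circle; lra).
      assert (Hh := ring_holo _ _ _ HR _ Hu).
      rewrite (Cder_eq ka (circle rho t) (Cder g (iota (circle rho t)) * Cder iota (circle rho t))%C).
      2:{ apply (der_comp idC g iota); now apply Cder_spec. }
      rewrite (Cder_eq F (iota (circle rho t)) (Cder g (iota (circle rho t)))).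
      2:{ eapply der_eq. apply der_minus. apply Cder_spec, Hg. apply der_const. ring. }
      unfold F, ka. field. apply (HF0 (circle rho t)). apply Cmod_circle. lra.
    - rewrite (dlog_lin_prod r rho iota zs q (Rd / 16)); auto.
      rewrite (dlog_nonvanishing r rho iota q (Rd / 16)); auto. ring. }
  destruct (ring_values r rho iota HR) as [sg [Hsg [Hval _]]].
  destruct (ring_values r rho ka HK) as [sg' [Hsg' [Hval' _]]].
  destruct (wd_sum_count r rho iota sg zs HR Hsg Hval Hzoff) as [n [N1 [N2 [N3 N4]]]].
  assert (Hper : Cmod (per 1) = 2 * PI) by (rewrite Cmod_per, Rabs_R1; ring).
  assert (Hms : Cmod sg = 2 * PI) by (destruct Hsg as [->| ->]; rewrite ?Cmod_opp; auto).
  assert (Hms' : Cmod sg' = 2 * PI) by (destruct Hsg' as [->| ->]; rewrite ?Cmod_opp; auto).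
  assert (Hnm : Cmod (wd rho ka v) = INR n * (2 * PI)).
  { rewrite E1, N1, Cmod_mult, Cmod_R, Hms, Rabs_pos_eq; auto. apply pos_INR. }
  assert (Hn : n = O \/ n = 1%nat).
  { destruct (Hval' v Hv) as [E|E]; rewrite E in Hnm.
    - left. rewrite Cmod_0 in Hnm. apply INR_eq. simpl. nra.
    - right. rewrite Hms' in Hnm. apply INR_eq. simpl. nra. }
  split.
  - split.
    + intros [_ Hi]. assert (n <> O). { intros ->. apply Hi. rewrite E1, N1. simpl. ring. }
      destruct (N3 H) as [a [Ha1 Ha2]]. exists a. split; auto. apply Hzer; auto.
    + intros [z [Hz E]]. split; auto. intro E0. assert (n = O).
      { apply INR_eq. rewrite E0, Cmod_0 in Hnm. simpl. nra. }
      apply (N2 H z); auto. apply Hzer; auto.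
  - intros z z' Hz Hz' E E'. destruct Hn as [Hn|Hn].
    + exfalso. apply (N2 Hn z); auto. apply Hzer; auto.
    + apply (N4 Hn); auto; apply Hzer; auto.
Qed.

Lemma ins_open r rho iota a : ring r rho iota -> ins rho iota a -> exists d, 0 < d /\ forall b, Cmod (b - a) < d -> ins rho iota b.
Proof.
  intros HR [H1 H2]. destruct (wd_loc r rho iota a HR H1) as [d [Hd K]]. exists d. split; auto. intros b Hb.
  destruct (K b Hb) as [K1 K2]. split; auto. congruence.
Qed.

Lemma out_open r rho iota a : ring r rho iota -> out rho iota a -> exists d, 0 < d /\ forall b, Cmod (b - a) < d -> out rho iota b.
Proof.
  intros HR [H1 H2]. destruct (wd_loc r rho iota a HR H1) as [d [Hd K]]. exists d. split; auto. intros b Hb.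
  destruct (K b Hb) as [K1 K2]. split; auto. congruence.
Qed.

(** If g(z) were on the image curve, points outside that curve would lie arbitrarily close to g(z).
    By openness one of them is the image of a point inside the original curve, which the argument
    principle forbids. *)
Lemma image_off_curve r rho iota g z : ring r rho iota -> entire g -> ring r rho (fun u => g (iota u)) ->
  ins rho iota z -> ~ on rho (fun u => g (iota u)) (g z).
Proof.
  intros HR Hg HK Hz Hon. assert (Hr := ring_rho _ _ _ HR).
  destruct (ins_open r rho iota z HR Hz) as [e [He Hi]].
  (* A constant [g] could not be injective on the ring; nonconstancy is what the open mapping
     theorem requires. *)
  assert (Ha : exists a, g a <> g z).
  { apply NNPP. intro Hn. assert (K : forall a, g a = g z) by (intro a; apply NNPP; intro K; apply Hn; now exists a).
    assert (E : RtoC rho = RtoC (- rho)).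
    { apply (ring_inj _ _ _ HK); try (unfold ann; rewrite Cmod_R; split_Rabs; lra). now rewrite !K. }
    apply RtoC_inj in E. lra. }
  destruct Ha as [a Ha].
  destruct (open_mapping g z (16 * (Cmod (a - z) + 1)) a) with (eps := e) as [d [Hd K]]; auto.
  { generalize (Cmod_ge_0 (a - z)). lra. } { intros w _. apply Hg. } { lra. }
  destruct (ring_values r rho _ HK) as [_ [_ [_ Hnear]]].
  destruct (Hnear (g z) d Hon Hd) as [_ [u [U1 [U2 [U3 U4]]]]].
  destruct (K _ U3) as [w [W1 W2]].
  destruct (argument_principle r rho iota g (g (iota u)) HR Hg HK) as [[_ A] _]. apply U4.
  destruct A as [_ A]. exists w. split; auto. apply A, U4.
Qed.

(** * Nested curves and their images *)

Lemma trichotomy rho iota a : on rho iota a \/ ins rho iota a \/ out rho iota a.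
Proof. unfold ins, out. tauto. Qed.

Lemma ins_not_on rho iota a : ins rho iota a -> ~ on rho iota a.
Proof. now intros []. Qed.
Lemma ins_not_out rho iota a : ins rho iota a -> ~ out rho iota a.
Proof. unfold ins, out. tauto. Qed.
Lemma out_not_on rho iota a : out rho iota a -> ~ on rho iota a.
Proof. now intros []. Qed.

Lemma loc_true (S : C -> Prop) z : (exists d, 0 < d /\ forall w, Cmod (w - z) < d -> S w) -> loc_const_pred S z.
Proof.
  intros [d [Hd H]]. exists d. split; auto. intros w Hw. assert (S z) by (apply H; rewrite Cmod_diag; lra).
  specialize (H w Hw). tauto.
Qed.

Lemma loc_not (S : C -> Prop) z : loc_const_pred S z -> loc_const_pred (fun w => ~ S w) z.
Proof. intros [d [Hd H]]. exists d. split; auto. intros w Hw. specialize (H w Hw). tauto. Qed.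

Lemma loc_false (S : C -> Prop) z : (exists d, 0 < d /\ forall w, Cmod (w - z) < d -> ~ S w) -> loc_const_pred S z.
Proof.
  intros H. apply loc_true, loc_not in H. destruct H as [d [Hd H]]. exists d. split; auto. intros w Hw. specialize (H w Hw).
  split; intro K; apply NNPP; tauto.
Qed.

Lemma loc_and (S T : C -> Prop) z : loc_const_pred S z -> loc_const_pred T z -> loc_const_pred (fun w => S w /\ T w) z.
Proof.
  intros [d1 [D1 H1]] [d2 [D2 H2]]. exists (Rmin d1 d2). split. now apply Rmin_pos. intros w Hw.
  specialize (H1 w (Rlt_le_trans _ _ _ Hw (Rmin_l _ _))). specialize (H2 w (Rlt_le_trans _ _ _ Hw (Rmin_r _ _))). tauto.
Qed.

Lemma loc_or (S T : C -> Prop) z : loc_const_pred S z -> loc_const_pred T z -> loc_const_pred (fun w => S w \/ T w) z.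
Proof.
  intros [d1 [D1 H1]] [d2 [D2 H2]]. exists (Rmin d1 d2). split. now apply Rmin_pos. intros w Hw.
  specialize (H1 w (Rlt_le_trans _ _ _ Hw (Rmin_l _ _))). specialize (H2 w (Rlt_le_trans _ _ _ Hw (Rmin_r _ _))). tauto.
Qed.

Lemma ins_loc r rho iota z : ring r rho iota -> ~ on rho iota z -> loc_const_pred (ins rho iota) z.
Proof.
  intros HR Hz. destruct (wd_loc r rho iota z HR Hz) as [d [Hd K]]. exists d. split; auto. intros w Hw.
  destruct (K w Hw) as [K1 K2]. unfold ins. rewrite K2. tauto.
Qed.

Lemma near_not_ins r rho iota z : ring r rho iota -> out rho iota z ->
  exists d, 0 < d /\ forall w, Cmod (w - z) < d -> ~ ins rho iota w.
Proof.
  intros HR Hz. destruct (out_open r rho iota z HR Hz) as [d [Hd H]]. exists d. split; auto. intros w Hw K.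
  apply ins_not_out in K. auto.
Qed.

Lemma exists_out2 r rho iota r' rho' eta : ring r rho iota -> ring r' rho' eta -> exists a, out rho iota a /\ out rho' eta a.
Proof.
  intros H1 H2. destruct (ring_far r rho iota H1) as [M1 K1]. destruct (ring_far r' rho' eta H2) as [M2 K2].
  exists (RtoC (Rabs M1 + Rabs M2 + 1)).
  assert (A1 := Rle_abs M1). assert (A2 := Rle_abs M2). assert (A3 := Rabs_pos M1). assert (A4 := Rabs_pos M2).
  split; [apply K1|apply K2]; rewrite Cmod_R, Rabs_pos_eq; lra.
Qed.

Definition curves_disjoint (rho : R) (iota : C -> C) (rho' : R) (eta : C -> C) : Prop :=
  forall a, on rho iota a -> ~ on rho' eta a.

Definition nested (rho : R) (iota : C -> C) (rho' : R) (eta : C -> C) : Prop :=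
  forall a, ins rho' eta a \/ on rho' eta a -> ins rho iota a.

Lemma curve_one_side r rho iota r' rho' eta : ring r rho iota -> ring r' rho' eta -> curves_disjoint rho iota rho' eta ->
  (forall a, on rho' eta a -> ins rho iota a) \/ (forall a, on rho' eta a -> out rho iota a).
Proof.
  intros H1 H2 Hd. assert (Hr := ring_rho _ _ _ H2).
  assert (Hoff : forall a, on rho' eta a -> ~ on rho iota a) by (intros a K K'; now apply (Hd a)).
  assert (Hu : forall t, on rho' eta (ploop eta rho' t)).
  { intro t. exists (circle rho' t). split; auto. apply Cmod_circle. lra. }
  assert (Hc : forall a b, on rho' eta a -> on rho' eta b -> wd rho iota a = wd rho iota b).
  { assert (Hc0 : forall a, on rho' eta a -> wd rho iota (ploop eta rho' 0) = wd rho iota a).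
    { intros a [u [Eu <-]]. destruct (circle_surj u) as [t [Ht Et]].
      replace (eta u) with (ploop eta rho' t) by (unfold ploop; now rewrite Et, Eu).
      apply path_connected. lra. intros s _. apply loop_rcont with (dploop eta rho'). now apply (ring_loop r').
      intros s _. destruct (wd_loc r rho iota _ H1 (Hoff _ (Hu s))) as [d [Hd' K]]. exists d. split; auto. intros w Hw. now apply K. }
    intros a b Ha Hb. now rewrite <- (Hc0 a), <- (Hc0 b). }
  destruct (classic (wd rho iota (ploop eta rho' 0) = 0%C)) as [E|E]; [right|left]; intros a Ha; split; auto;
  now rewrite (Hc a _ Ha (Hu 0)).
Qed.

Section TwoRings.
Context (r rho : R) (iota : C -> C) (r' rho' : R) (eta : C -> C).
Context (H1 : ring r rho iota) (H2 : ring r' rho' eta) (Hd : curves_disjoint rho iota rho' eta).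

(** Suppose some point is inside [eta] but not inside [iota]. If the curve of [iota] lies inside
    [eta], the union of the two insides is open and closed; if it lies outside [eta], the inside of
    [eta] minus that of [iota] is. Either set would reach a point far away. *)
Lemma nested_of_inside : (forall a, on rho' eta a -> ins rho iota a) -> nested rho iota rho' eta.
Proof.
  intros Hin a [Ha|Ha]; [|auto]. apply NNPP. intro Hn.
  destruct (exists_out2 _ _ _ _ _ _ H1 H2) as [o [Ho1 Ho2]].
  assert (Hd' : curves_disjoint rho' eta rho iota) by (intros x Hx Hx'; now apply (Hd x)).
  destruct (curve_one_side _ _ _ _ _ _ H2 H1 Hd') as [K|K].
  - assert (Hs : ins rho iota o \/ ins rho' eta o).
    { apply (plane_connected (fun z => ins rho iota z \/ ins rho' eta z) a); auto. intros z.
      destruct (classic (on rho iota z)) as [Hz|Hz].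
      { apply loc_true. destruct (ins_open _ _ _ _ H2 (K z Hz)) as [d [D1 D2]]. exists d. auto. }
      destruct (classic (on rho' eta z)) as [Hz'|Hz'].
      { apply loc_true. destruct (ins_open _ _ _ _ H1 (Hin z Hz')) as [d [D1 D2]]. exists d. auto. }
      apply loc_or; eapply ins_loc; eauto. }
    destruct Hs as [Hs|Hs]; apply ins_not_out in Hs; contradiction.
  - assert (Hs : ins rho' eta o /\ ~ ins rho iota o).
    { apply (plane_connected (fun z => ins rho' eta z /\ ~ ins rho iota z) a); auto. intros z.
      destruct (classic (on rho iota z)) as [Hz|Hz].
      { apply loc_false. destruct (near_not_ins _ _ _ _ H2 (K z Hz)) as [d [D1 D2]]. exists d. split; auto.
        intros w Hw [Q _]. now apply (D2 w). }
      destruct (classic (on rho' eta z)) as [Hz'|Hz'].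
      { apply loc_false. destruct (ins_open _ _ _ _ H1 (Hin z Hz')) as [d [D1 D2]]. exists d. split; auto.
        intros w Hw [_ Q]. apply Q. auto. }
      apply loc_and; [|apply loc_not]; eapply ins_loc; eauto. }
    destruct Hs as [Hs _]; apply ins_not_out in Hs; contradiction.
Qed.
End TwoRings.

(** If each curve were outside the other, the intersection of the two insides would be open and
    closed, and [b] belongs to it. *)
Lemma nested_of_common r rho iota r' rho' eta b : ring r rho iota -> ring r' rho' eta -> curves_disjoint rho iota rho' eta ->
  ins rho iota b -> ins rho' eta b -> nested rho iota rho' eta \/ nested rho' eta rho iota.
Proof.
  intros H1 H2 Hd Hb Hb'.
  assert (Hd' : curves_disjoint rho' eta rho iota) by (intros x Hx Hx'; now apply (Hd x)).
  destruct (curve_one_side _ _ _ _ _ _ H1 H2 Hd) as [K|K]. { left. now apply (nested_of_inside r rho iota r' rho' eta). }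
  destruct (curve_one_side _ _ _ _ _ _ H2 H1 Hd') as [K'|K']. { right. now apply (nested_of_inside r' rho' eta r rho iota). }
  exfalso. destruct (exists_out2 _ _ _ _ _ _ H1 H2) as [o [Ho1 Ho2]].
  assert (Hs : ins rho iota o /\ ins rho' eta o).
  { apply (plane_connected (fun z => ins rho iota z /\ ins rho' eta z) b); auto.
    intros z. destruct (classic (on rho iota z)) as [Hz|Hz].
    { apply loc_false. destruct (near_not_ins _ _ _ _ H2 (K' z Hz)) as [d [D1 D2]]. exists d. split; auto.
      intros w Hw [_ Q]. now apply (D2 w). }
    destruct (classic (on rho' eta z)) as [Hz'|Hz'].
    { apply loc_false. destruct (near_not_ins _ _ _ _ H1 (K z Hz')) as [d [D1 D2]]. exists d. split; auto.
      intros w Hw [Q _]. now apply (D2 w). }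
    apply loc_and; eapply ins_loc; eauto. }
  destruct Hs as [Hs _]; apply ins_not_out in Hs; contradiction.
Qed.

(* This is f when g = 1 / (f - b), except at the poles of f, where g vanishes and the value is junk. *)
Definition fmap (b : C) (g : C -> C) (z : C) : C := (b + / g z)%C.

Lemma Cinv_inj (x y : C) : x <> 0%C -> y <> 0%C -> (/ x = / y)%C -> x = y.
Proof. intros Hx Hy E. replace x with (/ / x)%C by (field; auto). rewrite E. field. auto. Qed.

Lemma fmap_eq (b : C) (g : C -> C) z w : g z <> 0%C -> g w <> 0%C -> fmap b g z = fmap b g w -> g z = g w.
Proof.
  unfold fmap. intros H1 H2 E. apply Cinv_inj; auto.
  replace (/ g z)%C with (b + / g z - b)%C by ring. rewrite E. ring.
Qed.

Section Step.
Context (b : C) (g : C -> C) (Hg : entire g).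
Context (r rho : R) (iota : C -> C) (HR : ring r rho iota).
Context (Hnz : forall u, ann r u -> g (iota u) <> 0%C).
Context (HR' : ring r rho (fun u => fmap b g (iota u))).

Let iota' := fun u => fmap b g (iota u).
Let kappa := fun u => g (iota u).

Lemma circle_ann u : Cmod u = rho -> ann r u.
Proof. intros E. assert (K := ring_rho _ _ _ HR). unfold ann. lra. Qed.

Lemma kappa_ring : ring r rho kappa.
Proof.
  split. apply HR. intros u Hu. apply (holo_comp g iota). apply Hg. now apply (ring_holo _ _ _ HR).
  intros u v Hu Hv E. apply (ring_inj _ _ _ HR'); auto. unfold fmap. unfold kappa in E. now rewrite E.
Qed.

Lemma on_nz a : on rho iota a -> g a <> 0%C.
Proof. intros [u [Eu <-]]. apply Hnz. now apply circle_ann. Qed.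

Lemma on_image a : on rho iota a -> on rho iota' (fmap b g a).
Proof. intros [u [Eu <-]]. now exists u. Qed.

Lemma b_off : ~ on rho iota' b.
Proof.
  intros [u [Hu E]]. assert (K := Hnz u (circle_ann u Hu)). unfold iota', fmap in E.
  assert (E0 : (/ g (iota u))%C = 0%C).
  { apply Cmod_sub_0. replace (/ g (iota u) - 0)%C with (b + / g (iota u) - b)%C by ring. rewrite E. apply Cmod_diag. }
  apply C1_nz. rewrite <- (Cinv_r (g (iota u)) K), E0. ring.
Qed.

Lemma kappa_off (v : C) : v <> 0%C -> (on rho kappa v <-> on rho iota' (b + / v)%C).
Proof.
  intros Hv. split; intros [u [Hu E]]; exists u; split; auto.
  - unfold iota', fmap. unfold kappa in E. now rewrite E.
  - unfold iota', fmap in E. unfold kappa. apply Cinv_inj; auto. apply Hnz. now apply circle_ann.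
    replace (/ g (iota u))%C with (b + / g (iota u) - b)%C by ring. rewrite E. ring.
Qed.

Lemma kappa_off_0 : ~ on rho kappa 0.
Proof. intros [u [Hu E]]. apply (Hnz u); auto. now apply circle_ann. Qed.

Lemma iota'_Cder u : ann r u -> Cder iota' u = (- Cder kappa u / (kappa u * kappa u))%C.
Proof.
  intros Hu. apply Cder_eq. eapply der_eq. apply der_plus. apply der_const. apply (der_inv idC kappa).
  apply Cder_spec. apply (ring_holo _ _ _ kappa_ring u Hu). now apply Hnz. ring.
Qed.

Lemma wd_kappa_0 : wd rho kappa 0 = (- wd rho iota' b)%C.
Proof.
  assert (HP := two_PI_pos). assert (Hr := ring_rho _ _ _ HR).
  unfold wd, wind. replace (- cint (fun t => dploop iota' rho t / (ploop iota' rho t - b)) 0 (2 * PI))%C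
    with (-1 * cint (fun t => dploop iota' rho t / (ploop iota' rho t - b)) 0 (2 * PI))%C by ring.
  rewrite <- cint_scal.
  - apply cint_ext. lra. intros t _. unfold dploop, ploop.
    assert (Hu : ann r (circle rho t)) by (apply circle_ann, Cmod_circle; lra).
    rewrite (iota'_Cder _ Hu). assert (K : kappa (circle rho t) <> 0%C) by now apply Hnz.
    replace (iota' (circle rho t) - b)%C with (/ kappa (circle rho t))%C by (unfold iota', fmap, kappa; ring).
    replace (kappa (circle rho t) - 0)%C with (kappa (circle rho t)) by ring. field. auto.
  - lra.
  - intros t _. apply wind_integrand_cont. apply (ring_loop r). exact HR'. apply off_on. lra. apply b_off.
Qed.

(** On the curve, kappa = 1 / (iota' - b), so kappa - v is the constant -v times (iota' - (b + 1/v))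
    / (iota' - b); logarithmic derivatives subtract. *)
Lemma wd_kappa (v : C) : v <> 0%C -> ~ on rho kappa v -> wd rho kappa v = (wd rho iota' (b + / v) - wd rho iota' b)%C.
Proof.
  intros Hv Hon. assert (HP := two_PI_pos). assert (Hr := ring_rho _ _ _ HR).
  assert (Hon' := Hon). rewrite (kappa_off v Hv) in Hon'.
  unfold wd, wind. rewrite <- cint_minus.
  - apply cint_ext. lra. intros t _. unfold dploop, ploop.
    assert (Hu : ann r (circle rho t)) by (apply circle_ann, Cmod_circle; lra).
    rewrite (iota'_Cder _ Hu). assert (K : kappa (circle rho t) <> 0%C) by now apply Hnz.
    assert (K2 : (kappa (circle rho t) - v)%C <> 0%C).
    { apply Csub_neq_0. intros E. apply Hon. exists (circle rho t). split; auto. apply Cmod_circle. lra. }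
    assert (K3 : (v - kappa (circle rho t))%C <> 0%C).
    { intro E. apply K2. replace (kappa (circle rho t) - v)%C with (- (v - kappa (circle rho t)))%C by ring. rewrite E. ring. }
    replace (iota' (circle rho t) - b)%C with (/ kappa (circle rho t))%C by (unfold iota', fmap, kappa; ring).
    replace (iota' (circle rho t) - (b + / v))%C with ((v - kappa (circle rho t)) / (v * kappa (circle rho t)))%C
      by (unfold iota', fmap; fold (kappa (circle rho t)); field; auto).
    field. repeat split; auto.
  - lra.
  - intros t _. apply wind_integrand_cont. apply (ring_loop r). exact HR'. apply off_on. lra. auto.
  - intros t _. apply wind_integrand_cont. apply (ring_loop r). exact HR'. apply off_on. lra. apply b_off.
Qed.

Lemma inside_inj z w : ins rho iota z -> ins rho iota w -> g z = g w -> z = w.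
Proof.
  intros Hz Hw E. destruct (argument_principle r rho iota g (g z) HR Hg kappa_ring) as [_ H]; auto.
  apply (image_off_curve r); auto. apply kappa_ring.
Qed.

Lemma inside_image_off z : ins rho iota z -> g z <> 0%C -> ~ on rho iota' (fmap b g z).
Proof. intros Hz H0 K. apply kappa_off in K; auto. revert K. now apply (image_off_curve r rho iota g z HR Hg kappa_ring). Qed.

Lemma inside_iff (v : C) : ~ on rho kappa v -> (ins rho kappa v <-> exists z, ins rho iota z /\ g z = v).
Proof. intros H. now apply (argument_principle r rho iota g v HR Hg kappa_ring). Qed.

Lemma ins_kappa_iff (v : C) : v <> 0%C -> ~ on rho kappa v -> (ins rho kappa v <-> wd rho iota' (b + / v) <> wd rho iota' b).
Proof.
  intros Hv Hon. unfold ins. rewrite wd_kappa by auto. split.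
  - intros [_ K] E. apply K. rewrite E. ring.
  - intros K. split; auto. now apply Csub_neq_0.
Qed.

(** With [b] outside the image curve, [kappa] has winding 0 about 0, so [g] has no zero inside: the
    orbit meets no pole there. *)
Lemma step_out_1 z : out rho iota' b -> ins rho iota z -> g z <> 0%C /\ ins rho iota' (fmap b g z).
Proof.
  intros [_ Hb] Hz.
  assert (H0 : g z <> 0%C).
  { intro E. assert (K : ins rho kappa 0). { apply inside_iff. apply kappa_off_0. now exists z. }
    destruct K as [_ K]. apply K. rewrite wd_kappa_0, Hb. ring. }
  split; auto. assert (Hoff := inside_image_off z Hz H0). split; auto.
  assert (Hk : ~ on rho kappa (g z)) by (rewrite kappa_off; auto).
  assert (K : ins rho kappa (g z)) by (apply inside_iff; auto; now exists z).
  rewrite ins_kappa_iff, Hb in K; auto.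
Qed.

Lemma preimage w : w <> b -> ~ on rho iota' w -> wd rho iota' w <> wd rho iota' b ->
  exists z, ins rho iota z /\ g z <> 0%C /\ fmap b g z = w.
Proof.
  intros Hw Hon Hne. set (v := (/ (w - b))%C).
  assert (Hwb : (w - b)%C <> 0%C) by now apply Csub_neq_0.
  assert (Hv : v <> 0%C). { intro E. apply C1_nz. replace (RtoC 1) with (v * (w - b))%C by (unfold v; field; auto). rewrite E. ring. }
  assert (Ew : (b + / v)%C = w) by (unfold v; field; auto).
  assert (Hk : ~ on rho kappa v) by (rewrite kappa_off, Ew; auto).
  destruct (proj1 (inside_iff v Hk)) as [z [Hz E]].
  { apply ins_kappa_iff; auto. now rewrite Ew. }
  exists z. unfold fmap. rewrite E. auto.
Qed.

Lemma step_out_2 w : out rho iota' b -> ins rho iota' w -> exists z, ins rho iota z /\ g z <> 0%C /\ fmap b g z = w.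
Proof.
  intros [_ Hb] [Hw1 Hw2]. apply preimage; auto. intros ->. auto. now rewrite Hb.
Qed.

(** The argument principle gives a winding value different from the one at [b]. As only two values
    occur and [b] has the nonzero one, the value is 0. *)
Lemma step_ins_1 z : ins rho iota' b -> ins rho iota z -> g z = 0%C \/ out rho iota' (fmap b g z).
Proof.
  intros [Hb1 Hb] Hz. destruct (classic (g z = 0%C)) as [|H0]; auto. right.
  assert (Hoff := inside_image_off z Hz H0). split; auto.
  assert (Hk : ~ on rho kappa (g z)) by (rewrite kappa_off; auto).
  assert (K : ins rho kappa (g z)) by (apply inside_iff; auto; now exists z).
  rewrite ins_kappa_iff in K; auto.
  destruct (ring_values r rho iota' HR') as [sg [_ [Hv _]]].
  destruct (Hv b Hb1) as [E|E]; [contradiction|]. destruct (Hv _ Hoff) as [E'|E']; auto.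
  exfalso. apply K. unfold fmap in E'. now rewrite E', E.
Qed.

Lemma step_ins_2 w : ins rho iota' b -> out rho iota' w -> exists z, ins rho iota z /\ g z <> 0%C /\ fmap b g z = w.
Proof.
  intros [Hb1 Hb] [Hw1 Hw2]. apply preimage; auto. intros ->. auto. rewrite Hw2. auto.
Qed.

Lemma step_ins_pole : ins rho iota' b -> exists z, ins rho iota z /\ g z = 0%C.
Proof.
  intros [Hb1 Hb]. apply inside_iff. apply kappa_off_0. split. apply kappa_off_0. rewrite wd_kappa_0.
  intro E. apply Hb. replace (wd rho iota' b) with (- - wd rho iota' b)%C by ring. rewrite E. ring.
Qed.
End Step.

(** Both orders are allowed because a step that sends insides to outsides exchanges the larger and
    the smaller curve. *)
Definition in_between (rho : R) (iota : C -> C) (rho' : R) (eta : C -> C) (z : C) : Prop :=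
  (nested rho iota rho' eta /\ ins rho iota z /\ out rho' eta z) \/
  (nested rho' eta rho iota /\ ins rho' eta z /\ out rho iota z).

Lemma nested_step b g r rho iota r' rho' eta : entire g -> ring r rho iota -> ring r' rho' eta ->
  (forall u, ann r u -> g (iota u) <> 0%C) -> (forall u, ann r' u -> g (eta u) <> 0%C) ->
  ring r rho (fun u => fmap b g (iota u)) -> ring r' rho' (fun u => fmap b g (eta u)) ->
  curves_disjoint rho (fun u => fmap b g (iota u)) rho' (fun u => fmap b g (eta u)) ->
  (ins rho (fun u => fmap b g (iota u)) b <-> ins rho' (fun u => fmap b g (eta u)) b) ->
  nested rho iota rho' eta ->
  (nested rho (fun u => fmap b g (iota u)) rho' (fun u => fmap b g (eta u)) \/
   nested rho' (fun u => fmap b g (eta u)) rho (fun u => fmap b g (iota u))) /\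
  forall z, ins rho iota z -> out rho' eta z ->
    g z <> 0%C /\ in_between rho (fun u => fmap b g (iota u)) rho' (fun u => fmap b g (eta u)) (fmap b g z).
Proof.
  intros Hg H1 H2 N1 N2 H1' H2' Hd Hb Hn.
  set (iota' := fun u => fmap b g (iota u)) in *. set (eta' := fun u => fmap b g (eta u)) in *.
  (* [g] is injective inside the larger curve, so no point of the gap shares its value with a point
     on or inside the smaller one. This keeps images of the gap off the image of the smaller closed
     inside. *)
  assert (Huniq : forall z w, ins rho iota z -> out rho' eta z -> ins rho' eta w \/ on rho' eta w -> g z = g w -> False).
  { intros z w Hz Hz' Hw E. assert (E' : z = w).
    { apply (inside_inj b g Hg r rho iota H1 H1'); auto. }
    subst w. destruct Hw as [Hw|Hw]. apply ins_not_out in Hw. contradiction. apply out_not_on in Hz'. contradiction. }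
  assert (Hon : forall z, ins rho iota z -> out rho' eta z -> g z <> 0%C -> ~ on rho' eta' (fmap b g z)).
  { intros z Hz Hz' H0 [v [Ev E]]. apply (Huniq z (eta v)); auto. right. now exists v.
    symmetry. apply (fmap_eq b); auto. apply N2. now apply (circle_ann r' rho' eta). }
  destruct (trichotomy rho iota' b) as [K|[K|K]].
  { exfalso. revert K. apply (b_off b g r rho iota H1 N1). }
  - assert (K' : ins rho' eta' b) by tauto.
    assert (Hnn : nested rho' eta' rho iota').
    { destruct (nested_of_common r rho iota' r' rho' eta' b) as [Q|Q]; auto. exfalso.
      (* The other order is excluded by one point of the smaller curve: it lies inside [iota], hence
         is sent outside [iota']. *)
      assert (Hu : on rho' eta (eta (RtoC rho'))).
      { exists (RtoC rho'). split; auto. rewrite Cmod_R, Rabs_pos_eq; auto. generalize (ring_rho _ _ _ H2). lra. }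
      destruct (step_ins_1 b g Hg r rho iota H1 N1 H1' (eta (RtoC rho')) K) as [E|E].
      - apply Hn. now right.
      - revert E. now apply (on_nz g r' rho' eta H2 N2).
      - assert (Q' := Q (fmap b g (eta (RtoC rho'))) (or_intror (on_image b g rho' eta _ Hu))).
        apply ins_not_out in Q'. contradiction. }
    split; auto. intros z Hz Hz'.
    (* The pole that must occur inside the smaller curve is the only one inside the larger curve, so
       the gap contains none. *)
    assert (H0 : g z <> 0%C).
    { intro E. destruct (step_ins_pole b g Hg r' rho' eta H2 N2 H2' K') as [w [Hw Ew]].
      apply (Huniq z w); auto. now rewrite E. }
    split; auto. right. split; auto. 
    destruct (step_ins_1 b g Hg r rho iota H1 N1 H1' z K Hz) as [E|E]; [contradiction|]. split; auto.
    destruct (trichotomy rho' eta' (fmap b g z)) as [Q|[Q|Q]]; auto.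
    + exfalso. now apply (Hon z).
    + exfalso. destruct (step_ins_2 b g Hg r' rho' eta H2 N2 H2' _ K' Q) as [w [W1 [W2 W3]]].
      apply (Huniq z w); auto. symmetry. now apply (fmap_eq b).
  - assert (K' : out rho' eta' b).
    { destruct (trichotomy rho' eta' b) as [Q|[Q|Q]]; auto. exfalso. revert Q. apply (b_off b g r' rho' eta H2 N2).
      apply Hb in Q. apply ins_not_out in Q. contradiction. }
    assert (Hnn : nested rho iota' rho' eta').
    { intros a [Ha|Ha].
      - destruct (step_out_2 b g Hg r' rho' eta H2 N2 H2' a K' Ha) as [z [Z1 [Z2 <-]]].
        apply (step_out_1 b g Hg r rho iota H1 N1 H1' z K). apply Hn. auto.
      - destruct Ha as [v [Ev <-]]. apply (step_out_1 b g Hg r rho iota H1 N1 H1' (eta v) K). apply Hn. right. now exists v. }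
    split; auto. intros z Hz Hz'.
    destruct (step_out_1 b g Hg r rho iota H1 N1 H1' z K Hz) as [H0 Q1]. split; auto. left. split; auto. split; auto.
    destruct (trichotomy rho' eta' (fmap b g z)) as [Q|[Q|Q]]; auto.
    + exfalso. now apply (Hon z).
    + exfalso. destruct (step_out_2 b g Hg r' rho' eta H2 N2 H2' _ K' Q) as [w [W1 [W2 W3]]].
      apply (Huniq z w); auto. symmetry. now apply (fmap_eq b).
Qed.

(** * Normal families and Fatou components *)

Definition increasing (phi : nat -> nat) : Prop := forall n, (phi n < phi (S n))%nat.

Lemma increasing_lt phi : increasing phi -> forall a b, (a < b)%nat -> (phi a < phi b)%nat.
Proof. intros H a b K. induction K. apply H. eapply Nat.lt_trans. apply IHK. apply H. Qed.

Lemma increasing_comp phi psi : increasing phi -> increasing psi -> increasing (fun n => phi (psi n)).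
Proof. intros H K n. apply increasing_lt; auto. Qed.

Lemma increasing_shift phi k : increasing phi -> increasing (fun n => phi (n + k)%nat).
Proof. intros H n. apply (H (n + k)%nat). Qed.

Section Montel.
Context (h : nat -> C -> C) (z0 : C) (d M L : R).
Hypothesis Hd : 0 < d.
Hypothesis HM : forall n z, Cmod (z - z0) < d -> Cmod (h n z) <= M.
Hypothesis HL0 : 0 <= L.
Hypothesis HL : forall n x y, Cmod (x - z0) < d -> Cmod (y - z0) < d -> Cmod (h n y - h n x) <= L * Cmod (y - x).

(** Smallness is stated for oscillations, without a limit, so that such subsequences can be refined
    and the limit taken only after the diagonal extraction. *)
Lemma osc_list eps (l : list C) : 0 < eps -> forall sg, increasing sg -> exists tau, increasing tau /\
  forall x, In x l -> Cmod (x - z0) < d -> forall i j, Cmod (h (sg (tau i)) x - h (sg (tau j)) x) <= eps.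
Proof.
  intros He. induction l as [|x l IH]; intros sg Hsg.
  - exists (fun n => n). split. intro n; lia. intros x [].
  - destruct (IH sg Hsg) as [tau [Ht H]]. destruct (Rlt_dec (Cmod (x - z0)) d) as [Hx|Hx].
    + destruct (complex_subsequence (fun n => h (sg (tau n)) x) M) as [phi [y [Hp Hy]]]. { intro n. auto. }
      destruct (Hy (eps / 2)) as [N HN]. lra.
      exists (fun n => tau (phi (n + N)%nat)). split.
      { apply (increasing_comp tau); auto. now apply increasing_shift. }
      intros w [<-|Hw] Hwd i j; [|now apply H].
      assert (K1 := HN (i + N)%nat ltac:(lia)). assert (K2 := HN (j + N)%nat ltac:(lia)).
      eapply Rle_trans. apply (Cmod_sub_tri _ y). rewrite (Cmod_sub_sym y). lra.
    + exists tau. split; auto. intros w [<-|Hw] Hwd i j; [contradiction|now apply H].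
Qed.

Lemma finite_net del : 0 < del -> exists l : list C, forall x, Cmod (x - z0) < d -> exists y, In y l /\ Cmod (x - y) <= del.
Proof.
  intros Hdel. set (e := del / 2). assert (He : 0 < e) by (unfold e; lra).
  destruct (INR_unbounded (d / e + 2)) as [N HN].
  set (zs := map (fun n => (Z.of_nat n - Z.of_nat N)%Z) (seq 0 (2 * N + 1))).
  assert (Hzs : forall k : Z, (- Z.of_nat N <= k <= Z.of_nat N)%Z -> In k zs).
  { intros k Hk. unfold zs. apply in_map_iff. exists (Z.to_nat (k + Z.of_nat N)). split. lia. apply in_seq. lia. }
  assert (Hr : forall a, Rabs a < d -> exists k, In k zs /\ Rabs (a - e * IZR k) <= e).
  { intros a Ha. exists (up (a / e)). destruct (archimed (a / e)) as [A1 A2].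
    assert (Ea : a = e * (a / e)) by (field; lra). set (q := a / e) in *.
    assert (Hq : Rabs q < d / e).
    { unfold q. unfold Rdiv. rewrite Rabs_mult, (Rabs_pos_eq (/ e)). apply Rmult_lt_compat_r; auto. now apply Rinv_0_lt_compat.
      left. now apply Rinv_0_lt_compat. }
    apply Rabs_def2 in Hq. split.
    - apply Hzs. rewrite INR_IZR_INZ in HN. split; apply le_IZR; rewrite ?opp_IZR; lra.
    - rewrite Ea. replace (e * q - e * IZR (up q)) with (- (e * (IZR (up q) - q))) by ring.
      rewrite Rabs_Ropp, Rabs_pos_eq. rewrite <- (Rmult_1_r e) at 2. apply Rmult_le_compat_l; lra.
      apply Rmult_le_pos; lra. }
  exists (map (fun p => (z0 + ((e * IZR (fst p))%R, (e * IZR (snd p))%R))%C) (list_prod zs zs)).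
  intros x Hx. destruct (Hr (Re (x - z0))) as [i [I1 I2]]. { eapply Rle_lt_trans. apply re_le_Cmod. auto. }
  destruct (Hr (Im (x - z0))) as [j [J1 J2]]. { eapply Rle_lt_trans. apply im_le_Cmod. auto. }
  exists (z0 + ((e * IZR i)%R, (e * IZR j)%R))%C. split.
  - apply in_map_iff. exists (i, j). split; auto. now apply in_prod.
  - eapply Rle_trans. apply Cmod_le_re_im.
    replace (x - (z0 + ((e * IZR i)%R, (e * IZR j)%R)))%C with (x - z0 - ((e * IZR i)%R, (e * IZR j)%R))%C by ring.
    rewrite re_minus, im_minus. unfold Re at 2, Im at 2. simpl (fst (_, _)). simpl (snd (_, _)). unfold e in *. lra.
Qed.

Lemma osc_ball eps sg : 0 < eps -> increasing sg -> exists tau, increasing tau /\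
  forall x, Cmod (x - z0) < d / 2 -> forall i j, Cmod (h (sg (tau i)) x - h (sg (tau j)) x) <= eps.
Proof.
  (* Two Lipschitz errors L del, each at most eps / 4, and an oscillation eps / 2 on the net add up
     to eps; del at most d / 4 keeps the net points used within the ball. *)
  intros He Hsg. set (del := Rmin (d / 4) (eps / (4 * (L + 1)))).
  assert (D1 := Rmin_l (d / 4) (eps / (4 * (L + 1)))). assert (D2 := Rmin_r (d / 4) (eps / (4 * (L + 1)))). fold del in D1, D2.
  assert (Hdel : 0 < del). { apply Rmin_pos. lra. apply Rdiv_lt_0_compat; lra. }
  destruct (finite_net del Hdel) as [l Hl].
  destruct (osc_list (eps / 2) l ltac:(lra) sg Hsg) as [tau [Ht H]]. exists tau. split; auto.
  intros x Hx i j. destruct (Hl x ltac:(lra)) as [y [Y1 Y2]].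
  assert (Hy : Cmod (y - z0) < d). { generalize (Cmod_sub_tri y x z0). rewrite (Cmod_sub_sym y x). lra. }
  assert (K := H y Y1 Hy i j).
  assert (K1 := HL (sg (tau i)) y x Hy ltac:(lra)). assert (K2 := HL (sg (tau j)) x y ltac:(lra) Hy).
  rewrite (Cmod_sub_sym y x) in K2.
  assert (Q : L * Cmod (x - y) <= eps / 4).
  { apply Rle_trans with ((L + 1) * (eps / (4 * (L + 1)))); [|right; field; lra].
    apply Rmult_le_compat; try lra. apply Cmod_ge_0. }
  generalize (Cmod_sub_tri (h (sg (tau i)) x) (h (sg (tau i)) y) (h (sg (tau j)) x))
    (Cmod_sub_tri (h (sg (tau i)) y) (h (sg (tau j)) y) (h (sg (tau j)) x)). lra.
Qed.

(** The m-th subsequence oscillates by at most 2^-m on the ball. The diagonal is eventually a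
    subsequence of each, and its pointwise limits inherit the uniform rate. *)
Lemma montel : exists phi, increasing phi /\ exists H : C -> C, forall x, Cmod (x - z0) < d / 2 ->
  forall m k, (m <= k)%nat -> Cmod (h (phi k) x - H x) <= / 2 ^ m.
Proof.
  assert (Hp : forall m, 0 < / 2 ^ m) by (intro m; apply Rinv_0_lt_compat, pow_lt; lra).
  set (P := fun (m : nat) (sg : nat -> nat) => increasing sg /\
    forall x, Cmod (x - z0) < d / 2 -> forall i j, Cmod (h (sg i) x - h (sg j) x) <= / 2 ^ m).
  set (Q := fun (m : nat) (sg sg' : nat -> nat) => exists tau, increasing tau /\ forall n, sg' n = sg (tau n)).
  assert (Hid : increasing (fun n => n)) by (intro n; lia).
  destruct (osc_ball (/ 2 ^ 0) (fun n => n) (Hp O) Hid) as [s0 [S1 S2]].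
  destruct (dependent_choice P Q s0) as [s [_ Hs]].
  { split; auto. }
  { intros m sg [G1 _]. destruct (osc_ball (/ 2 ^ S m) sg (Hp (S m)) G1) as [tau [T1 T2]].
    exists (fun n => sg (tau n)). split. split; auto. now apply increasing_comp. exists tau. auto. }
  set (phi := fun k => s k k).
  assert (Hsub : forall m k, exists tau, increasing tau /\ forall n, s (m + k)%nat n = s m (tau n)).
  { intros m k. induction k as [|k [tau [T1 T2]]].
    - exists (fun n => n). split; auto. intro n. now rewrite Nat.add_0_r.
    - destruct (Hs (m + k)%nat) as [_ [ups [U1 U2]]]. exists (fun n => tau (ups n)). split. now apply increasing_comp.
      intro n. rewrite Nat.add_succ_r, U2. apply T2. }
  assert (Hosc : forall m k k' x, (m <= k)%nat -> (m <= k')%nat -> Cmod (x - z0) < d / 2 ->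
    Cmod (h (phi k) x - h (phi k') x) <= / 2 ^ m).
  { intros m k k' x Hk Hk' Hx. destruct (Hsub m (k - m)%nat) as [t1 [_ T1]]. destruct (Hsub m (k' - m)%nat) as [t2 [_ T2]].
    replace (m + (k - m))%nat with k in T1 by lia. replace (m + (k' - m))%nat with k' in T2 by lia.
    unfold phi. rewrite T1, T2. now apply (Hs m). }
  exists phi. split.
  - intro k. unfold phi. destruct (Hs k) as [[G1 _] [tau [T1 T2]]]. rewrite T2. apply increasing_lt; auto.
    generalize (increasing_ge tau T1 (S k)). lia.
  - assert (Hlim : forall x, exists y, Cmod (x - z0) < d / 2 -> forall m k, (m <= k)%nat -> Cmod (h (phi k) x - y) <= / 2 ^ m).
    { intro x. destruct (Rlt_dec (Cmod (x - z0)) (d / 2)) as [Hx|Hx]; [|exists (RtoC 0); contradiction].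
      destruct (complex_subsequence (fun n => h (phi n) x) M) as [psi [y [P1 P2]]]. { intro n. apply HM. lra. }
      exists y. intros _ m k Hk. apply Rnot_lt_le. intro Hlt.
      destruct (P2 (Cmod (h (phi k) x - y) - / 2 ^ m)) as [N HN]. lra.
      set (n := Nat.max N m). specialize (HN n ltac:(lia)).
      assert (K := Hosc m k (psi n) x Hk ltac:(generalize (increasing_ge psi P1 n); lia) Hx).
      generalize (Cmod_sub_tri (h (phi k) x) (h (phi (psi n)) x) y). lra. }
    exists (fun x => proj1_sig (constructive_indefinite_description _ (Hlim x))).
    intros x. apply (proj2_sig (constructive_indefinite_description _ (Hlim x))).
Qed.
End Montel.

Lemma chord_le (a b : C) : chord (Some a) (Some b) <= 2 * Cmod (a - b).
Proof.
  unfold chord.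
  assert (K : forall x : C, 1 <= sqrt (1 + Cmod x ^ 2)).
  { intro x. rewrite <- sqrt_1 at 1. apply sqrt_le_1_alt. generalize (pow2_ge_0 (Cmod x)). lra. }
  assert (K1 := K a). assert (K2 := K b). set (s := sqrt (1 + Cmod a ^ 2)) in *. set (t := sqrt (1 + Cmod b ^ 2)) in *.
  assert (1 <= s * t) by nra. assert (H0 := Cmod_ge_0 (a - b)).
  apply Rmult_le_reg_r with (s * t). lra. unfold Rdiv. rewrite Rmult_assoc, Rinv_l by lra. nra.
Qed.

(** Locally bounded holomorphic iterates are equi-Lipschitz on a smaller ball, and the chordal
    metric is at most twice the Euclidean one, so a uniformly convergent subsequence gives
    normality. *)
Lemma fatou_criterion (f : C -> sphere) (h : nat -> C -> C) z0 d M : 0 < d ->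
  (forall n w, Cmod (w - z0) < d -> fiter f n w = Some (h n w) /\ holo (h n) w /\ Cmod (h n w) <= M) -> fatou f z0.
Proof.
  intros Hd H. exists (d / 4). split. lra. split.
  - intros n w Hw. unfold ball_C in Hw. destruct (H n w ltac:(lra)) as [-> _]. discriminate.
  - intros s.
    (* The Lipschitz bound halves the radius and [montel] halves it again, which explains d / 4. *)
    destruct (montel (fun k => h (s k)) z0 (d / 2) M (2 * M / (d / 2))) as [phi [Hp [G HG]]].
    + lra.
    + intros n z Hz. apply H. lra.
    + assert (0 <= M). { eapply Rle_trans. apply Cmod_ge_0. apply (H O z0). rewrite Cmod_diag. lra. }
      apply Rmult_le_pos. lra. left. apply Rinv_0_lt_compat. lra.
    + intros n x y Hx Hy. apply holo_lip with z0; auto. lra. intros w Hw. apply H. lra. intros w Hw. apply H. lra.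
    + exists phi. split; auto. exists (fun x => Some (G x)). intros z Hz. unfold ball_C in *.
      exists (d / 4 - Cmod (z - z0)). split. lra.
      assert (Hsub : forall w, Cmod (w - z) < d / 4 - Cmod (z - z0) -> Cmod (w - z0) < d / 4).
      { intros w Hw. generalize (Cmod_sub_tri w z z0). lra. }
      split; auto. intros eps He. destruct (pow2_small 1 (eps / 2)) as [N HN]. lra.
      exists N. intros k Hk w Hw. specialize (Hsub w Hw). destruct (H (s (phi k)) w ltac:(lra)) as [-> _].
      eapply Rle_lt_trans. apply chord_le. specialize (HG w ltac:(lra) N k Hk). unfold Rdiv in HN. rewrite Rmult_1_l in HN. lra.
Qed.

Lemma fatou_open f z : fatou f z -> exists d, 0 < d /\ forall w, Cmod (w - z) < d -> fatou f w.
Proof.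
  intros [r [Hr [H1 H2]]]. exists r. split; auto. intros w Hw.
  assert (Hsub : forall u, ball_C w (r - Cmod (w - z)) u -> ball_C z r u).
  { unfold ball_C. intros u Hu. generalize (Cmod_sub_tri u w z). lra. }
  exists (r - Cmod (w - z)). split. lra. split. intros n u Hu. apply H1. auto.
  intros s. destruct (H2 s) as [phi [Hp [h Hh]]]. exists phi. split; auto. exists h. intros z0 Hz0.
  destruct (Hh z0 (Hsub z0 Hz0)) as [r0 [Hr0 [_ K]]].
  set (m := Rmin r0 (r - Cmod (w - z) - Cmod (z0 - w))). unfold ball_C in Hz0.
  assert (M1 := Rmin_l r0 (r - Cmod (w - z) - Cmod (z0 - w))). assert (M2 := Rmin_r r0 (r - Cmod (w - z) - Cmod (z0 - w))). fold m in M1, M2.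
  exists m. split. apply Rmin_pos; lra. split.
  - unfold ball_C. intros u Hu. generalize (Cmod_sub_tri u z0 w). lra.
  - intros eps He. destruct (K eps He) as [N HN]. exists N. intros k Hk u Hu. apply HN; auto. unfold ball_C in *. lra.
Qed.

Lemma connected_union (A B : C -> Prop) x : connected_C A -> connected_C B -> A x -> B x -> connected_C (fun z => A z \/ B z).
Proof.
  intros HA HB Ax Bx P Q OP OQ Hc [p [Hp Pp]] [q [Hq Qq]].
  apply NNPP. intro Hn.
  assert (Hno : forall z, A z \/ B z -> P z -> Q z -> False) by (intros z K1 K2 K3; apply Hn; now exists z).
  assert (KA : forall u v, A u -> A v -> P u -> Q v -> False).
  { intros u v Au Av Pu Qv. destruct (HA P Q OP OQ) as [z [Z1 [Z2 Z3]]]; eauto. }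
  assert (KB : forall u v, B u -> B v -> P u -> Q v -> False).
  { intros u v Au Av Pu Qv. destruct (HB P Q OP OQ) as [z [Z1 [Z2 Z3]]]; eauto. }
  destruct (Hc x (or_introl Ax)) as [Hx|Hx].
  - destruct Hq as [Hq|Hq]; eauto.
  - destruct Hp as [Hp|Hp]; eauto.
Qed.

Lemma ball_connected z d : connected_C (fun w => Cmod (w - z) < d).
Proof.
  intros P Q OP OQ Hc [p [Hp Pp]] [q [Hq Qq]]. apply NNPP. intro Hn.
  assert (Hseg : forall t, 0 <= t <= 1 -> Cmod (p + RtoC t * (q - p) - z) < d) by (intros; now apply seg_in_ball).
  assert (K : P q).
  { assert (K := interval_connected (fun t => P (p + RtoC t * (q - p))%C) 0 1). cbv beta in K.
    replace (p + RtoC 0 * (q - p))%C with p in K by ring. replace (p + RtoC 1 * (q - p))%C with q in K by ring.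
    apply K; auto. lra. intros t Ht.
    destruct (Hc _ (Hseg t Ht)) as [Ht'|Ht'].
    - destruct (OP _ Ht') as [e [He H]]. destruct (rcont_line p (q - p) t e He) as [d2 [Hd2 H2]].
      exists d2. split; auto. intros s Hs Hst. split; auto. intros _. apply H. apply H2. rewrite <- RtoC_minus, Cmod_R. auto.
    - destruct (OQ _ Ht') as [e [He H]]. destruct (rcont_line p (q - p) t e He) as [d2 [Hd2 H2]].
      exists d2. split; auto. intros s Hs Hst. split; intro K1; exfalso; apply Hn.
      + exists (p + RtoC s * (q - p))%C. split; [|split]; auto. apply H. apply H2. rewrite <- RtoC_minus, Cmod_R. auto.
      + exists (p + RtoC t * (q - p))%C. auto. }
  apply Hn. exists q. auto.
Qed.

Section Component.
Context (f : C -> sphere) (V : C -> Prop) (HV : is_component (fatou f) V).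

Lemma component_fatou z : V z -> fatou f z.
Proof. destruct HV as [z0 [H0 H]]. intros Hz. apply H in Hz. destruct Hz as [T [T1 [T2 [T3 T4]]]]. auto. Qed.

Lemma component_extend (B : C -> Prop) x y : connected_C B -> (forall z, B z -> fatou f z) -> V x -> B x -> B y -> V y.
Proof.
  destruct HV as [z0 [H0 H]]. intros HB HBf Vx Bx By. apply H in Vx. apply H. destruct Vx as [T [T1 [T2 [T3 T4]]]].
  exists (fun z => T z \/ B z). split. intros u [Hu|Hu]; auto. split. now apply connected_union with x. auto.
Qed.

Lemma component_loc z : fatou f z -> exists d, 0 < d /\ forall w, Cmod (w - z) < d -> (V w <-> V z).
Proof.
  intros Hz. destruct (fatou_open f z Hz) as [d [Hd H]]. exists d. split; auto. intros w Hw.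
  assert (Hz0 : Cmod (z - z) < d) by (rewrite Cmod_diag; lra).
  split; intro K; apply (component_extend _ _ _ (ball_connected z d)) with (2 := K); auto.
Qed.

Lemma component_path x y : V x -> V y -> exists T : C -> Prop, connected_C T /\ T x /\ T y /\ forall z, T z -> V z.
Proof.
  destruct HV as [z0 [H0 H]]. intros Hx Hy.
  destruct (proj1 (H x) Hx) as [T [T1 [T2 [T3 T4]]]]. destruct (proj1 (H y) Hy) as [S [S1 [S2 [S3 S4]]]].
  exists (fun z => T z \/ S z). split. now apply connected_union with z0. split; auto. split; auto.
  intros z [Hz|Hz]; apply H; [exists T|exists S]; auto.
Qed.
End Component.

Lemma component_eq f V W x : is_component (fatou f) V -> is_component (fatou f) W -> V x -> W x -> forall z, V z <-> W z.
Proof.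
  assert (K : forall V W, is_component (fatou f) V -> is_component (fatou f) W -> V x -> W x -> forall z, V z -> W z).
  { clear V W. intros V W HV HW Vx Wx z Vz. destruct (component_path f V HV x z Vx Vz) as [T [T1 [T2 [T3 T4]]]].
    apply (component_extend f W HW T x z); auto. intros u Hu. apply (component_fatou f V HV). auto. }
  intros. split; eapply K; eauto.
Qed.

(** * Periodic rings *)

Definition reciprocal_of (f : C -> sphere) (b : C) (g : C -> C) : Prop :=
  entire g /\ (forall z, g z = 0%C -> f z = None) /\ (forall z, g z <> 0%C -> f z = Some (fmap b g z)).

Lemma omitted_value_reciprocal f b : meromorphic f -> omitted_value f b -> exists g, reciprocal_of f b g.
Proof.
  intros Hf Hb.
  set (g := fun z => match f z with None => RtoC 0 | Some w => (/ (w - b))%C end).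
  assert (Hwb : forall z w, f z = Some w -> (w - b)%C <> 0%C).
  { intros z w E. apply Csub_neq_0. intros ->. now apply (Hb z). }
  assert (Hinv : forall x : C, x <> 0%C -> (/ x)%C <> 0%C).
  { intros x Hx E. apply C1_nz. rewrite <- (Cinv_r x Hx), E. ring. }
  exists g. split; [|split].
  - intros z0. destruct (Hf z0) as [r [Hr [h [Hh Hcase]]]]. destruct Hcase as [E|[E0 [E1 E2]]].
    + apply holo_loc with (fun z => / (h z - b))%C r; auto.
      * intros w Hw. unfold g. now rewrite E.
      * assert (K : f z0 = Some (h z0)). { apply E. unfold ball_C. now rewrite Cmod_diag. }
        apply holo_inv. apply holo_minus. apply C_holo_at_holo, Hh. unfold ball_C. now rewrite Cmod_diag. apply holo_const.
        now apply (Hwb z0).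
    (* At a pole h = 1 / f is holomorphic and 1 / (f - b) = h / (1 - b h), with denominator 1 at the
       pole itself. *)
    + apply holo_loc with (fun z => h z / (1 - b * h z))%C r; auto.
      * intros w Hw. unfold g. destruct (classic (w = z0)) as [->|Hn].
        { rewrite E0, E1. replace (1 - b * 0)%C with (RtoC 1) by ring. field. }
        destruct (E2 w Hw Hn) as [K1 K2]. rewrite K2. assert (K3 := Hwb w _ K2). field. split; auto.
        intro K4. apply K3. replace (/ h w - b)%C with ((1 - b * h w) / h w)%C by (field; auto). rewrite K4. field; auto.
      * assert (holo h z0). { apply C_holo_at_holo, Hh. unfold ball_C. now rewrite Cmod_diag. }
        apply holo_div; auto. apply holo_minus. apply holo_const. apply holo_mult; auto. apply holo_const.
        rewrite E1. intro K. apply C1_nz. rewrite <- K. ring.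
  - intros z Hz. unfold g in Hz. destruct (f z) as [w|] eqn:E; auto. exfalso. revert Hz. apply Hinv. now apply (Hwb z).
  - intros z Hz. unfold fmap. unfold g in *. destruct (f z) as [w|] eqn:E; [|now contradiction Hz].
    f_equal. assert (K := Hwb z w E). field. auto.
Qed.

(** A total version of the iterates, which can be composed and differentiated freely; it agrees with
    [fiter] as long as [g] has not vanished along the orbit. *)
Fixpoint iter_map (b : C) (g : C -> C) (n : nat) (z : C) : C :=
  match n with O => z | S m => fmap b g (iter_map b g m z) end.

Lemma iter_map_add b g m n z : iter_map b g (m + n) z = iter_map b g m (iter_map b g n z).
Proof. induction m; simpl; congruence. Qed.

Lemma iter_map_holo b g n z : entire g -> (forall k, (k < n)%nat -> g (iter_map b g k z) <> 0%C) -> holo (iter_map b g n) z.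
Proof.
  intros Hg. induction n; intros H; simpl. apply holo_id.
  unfold fmap. apply (holo_plus (fun _ => b)). apply holo_const. apply (holo_inv (fun z => g (iter_map b g n z))).
  apply (holo_comp g). apply Hg. apply IHn. intros; apply H; lia. apply H. lia.
Qed.

Lemma fiter_iter_map f b g n z : reciprocal_of f b g -> (forall k, (k < n)%nat -> g (iter_map b g k z) <> 0%C) ->
  fiter f n z = Some (iter_map b g n z).
Proof.
  intros [_ [_ Hf]] H. induction n; simpl; auto. rewrite IHn by (intros; apply H; lia). apply Hf. apply H. lia.
Qed.

Lemma fiter_some f b g n z w : reciprocal_of f b g -> fiter f n z = Some w ->
  w = iter_map b g n z /\ forall k, (k < n)%nat -> g (iter_map b g k z) <> 0%C.
Proof.
  intros [Hg [H0 Hf]]. revert w. induction n; simpl; intros w E.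
  - split. congruence. lia.
  - destruct (fiter f n z) as [v|] eqn:Ev; [|discriminate]. destruct (IHn v eq_refl) as [-> K].
    assert (Hv : g (iter_map b g n z) <> 0%C) by (intro K0; rewrite H0 in E; [discriminate|auto]).
    rewrite Hf in E by auto. split. congruence. intros k Hk. destruct (Nat.eq_dec k n) as [->|]; auto. apply K. lia.
Qed.

(** The chart is inverted, so that core curves are images of circles. *)
Record ring_data (f : C -> sphere) (p : nat) (V : C -> Prop) (r : R) (iota : C -> C) (s : R) : Prop := {
  rd_r : 1 < r;
  rd_in : forall u, ann r u -> V (iota u);
  rd_onto : forall z, V z -> exists u, ann r u /\ iota u = z;
  rd_holo : forall u, ann r u -> holo iota u;
  rd_inj : forall u v, ann r u -> ann r v -> iota u = iota v -> u = v;
  rd_s : 0 <= s <= 2 * PI;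
  rd_conj : forall u, ann r u -> fiter f p (iota u) = Some (iota (cis s * u)%C) }.

Lemma component_open f V z : is_component (fatou f) V -> V z -> exists d, 0 < d /\ forall w, Cmod (w - z) < d -> V w.
Proof.
  intros HV Hz. destruct (component_loc f V HV z) as [d [Hd H]]. now apply (component_fatou f V).
  exists d. split; auto. intros w Hw. now apply H.
Qed.

Lemma herman_ring_data f p V : herman_ring f p V -> exists r iota s, ring_data f p V r iota s.
Proof.
  intros [[HV [_ [Hmap _]]] [r [theta [phi [Hr [_ [Hphi [Hinj [Hann [Honto Hconj]]]]]]]]]].
  set (iota := fun u => @epsilon C (inhabits (RtoC 0)) (fun z => V z /\ phi z = u)).
  assert (HI : forall u, ann r u -> V (iota u) /\ phi (iota u) = u).
  { intros u Hu. apply (epsilon_spec (inhabits (RtoC 0)) (fun z => V z /\ phi z = u)). now apply Honto. }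
  assert (HK : forall z, V z -> iota (phi z) = z).
  { intros z Hz. destruct (HI (phi z) (Hann z Hz)). now apply Hinj. }
  assert (HVo : forall z, V z -> exists d, 0 < d /\ forall w, Cmod (w - z) < d -> V w) by (intros; now apply (component_open f)).
  assert (Hh : forall z, V z -> holo phi z) by (intros; now apply C_holo_at_holo, Hphi).
  (* The rotation angle is reduced to [0, 2 pi], the range in which integrals over a period will be
     shifted. *)
  destruct (polar (cis (2 * PI * theta))) as [s [Hs Es]]. rewrite Cmod_cis, Cmult_1_l in Es.
  exists r, iota, s. split; auto.
  - intros u Hu. now apply HI.
  - intros z Hz. exists (phi z). split; auto. now apply Hann.
  - intros u Hu. destruct (HI u Hu) as [K1 K2]. rewrite <- K2. now apply (inv_holo V phi iota).
  - intros u v Hu Hv E. destruct (HI u Hu) as [_ <-]. destruct (HI v Hv) as [_ <-]. now rewrite E.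
  - intros u Hu. destruct (HI u Hu) as [K1 K2]. destruct (Hconj _ K1) as [w [W1 W2]]. destruct (Hmap _ K1) as [w' [W3 W4]].
    assert (w' = w) by congruence. subst w'. rewrite W1. f_equal. rewrite <- Es.
    rewrite <- (HK w W4), W2, K2. reflexivity.
Qed.

Section RingDynamics.
Context (f : C -> sphere) (b : C) (g : C -> C) (Hfg : reciprocal_of f b g).
Context (p : nat) (Hp : (1 <= p)%nat).
Let it := iter_map b g.
Let Hg : entire g := proj1 Hfg.

Lemma it_add m n z : it (m + n) z = it m (it n z).
Proof. apply iter_map_add. Qed.

Section OneRing.
Context (V : C -> Prop) (r : R) (iota : C -> C) (s : R) (HV : ring_data f p V r iota s).
Let rho := (1 + r) / 2.

Lemma rho_bounds : 1 < rho < r.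
Proof. assert (K := rd_r _ _ _ _ _ _ HV). unfold rho. lra. Qed.

Lemma ann_rot t u : ann r u -> ann r (cis t * u)%C.
Proof. unfold ann. rewrite Cmod_mult, Cmod_cis, Rmult_1_l. auto. Qed.

Lemma it_p u : ann r u -> it p (iota u) = iota (cis s * u)%C /\ forall k, (k < p)%nat -> g (it k (iota u)) <> 0%C.
Proof.
  intro Hu. destruct (fiter_some f b g p (iota u) _ Hfg (rd_conj _ _ _ _ _ _ HV u Hu)) as [E K]. split; auto.
Qed.

Lemma it_kp k u : ann r u -> it (k * p) (iota u) = iota (cis (INR k * s) * u)%C.
Proof.
  revert u. induction k as [|k IH]; intros u Hu.
  - simpl. rewrite Rmult_0_l, cis_0, Cmult_1_l. reflexivity.
  - simpl Nat.mul. rewrite Nat.add_comm. rewrite it_add. rewrite (proj1 (it_p u Hu)).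
    rewrite IH by now apply ann_rot. f_equal. rewrite S_INR, Rmult_plus_distr_r, Rmult_1_l, cis_plus. ring.
Qed.

(** The first p steps meet no pole, and after them the orbit is back in the ring. *)
Lemma it_alive n u : ann r u -> g (it n (iota u)) <> 0%C.
Proof.
  revert u. induction n as [n IH] using lt_wf_ind; intros u Hu.
  destruct (Nat.lt_ge_cases n p) as [H|H]. now apply it_p.
  replace n with ((n - p) + p)%nat by lia. rewrite it_add. rewrite (proj1 (it_p u Hu)).
  apply IH. lia. now apply ann_rot.
Qed.

(** Injectivity of the n-th iterate on the ring follows because the iterate of order n p factors
    through it and is conjugate to a rotation. *)
Lemma it_ring n : ring r rho (fun u => it n (iota u)).
Proof.
  split. apply rho_bounds.
  - intros u Hu. apply (holo_comp (it n) iota). apply iter_map_holo; auto. intros k _. now apply it_alive.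
    now apply (rd_holo _ _ _ _ _ _ HV).
  - intros u v Hu Hv E.
    assert (K : it (n * p) (iota u) = it (n * p) (iota v)).
    { replace (n * p)%nat with ((n * p - n) + n)%nat by nia. rewrite !it_add. now rewrite E. }
    rewrite !it_kp in K by auto. apply (rd_inj _ _ _ _ _ _ HV) in K; try now apply ann_rot.
    assert (H := cis_neq_0 (INR n * s)).
    replace u with (cis (INR n * s) * u / cis (INR n * s))%C by (field; auto). rewrite K. field. auto.
Qed.

Lemma cint_periodic (G0 : R -> C) t0 : 0 <= t0 <= 2 * PI -> (forall t, cont RtoC G0 t) -> (forall t, G0 (t + 2 * PI) = G0 t) ->
  cint (fun t => G0 (t + t0)) 0 (2 * PI) = cint G0 0 (2 * PI).
Proof.
  intros Ht Hc Hper. assert (HP := two_PI_pos).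
  rewrite cint_shift; [|lra|intros t _; auto]. rewrite Rplus_0_l, (Rplus_comm (2 * PI)).
  rewrite <- (cint_chasles G0 t0 (2 * PI) (t0 + 2 * PI)); try lra; [|intros t _; auto].
  rewrite <- (cint_chasles G0 0 t0 (2 * PI)); try lra; [|intros t _; auto].
  replace (cint G0 (2 * PI) (t0 + 2 * PI)) with (cint G0 0 t0). ring.
  assert (E := cint_shift G0 0 t0 (2 * PI)). rewrite Rplus_0_l in E. rewrite <- E by (try lra; intros t _; auto).
  apply cint_ext. lra. intros t _. auto.
Qed.

Lemma rot_circle t : (cis s * circle rho t)%C = circle rho (t + s).
Proof. unfold circle. rewrite cis_plus. ring. Qed.

(** The first p steps merely rotate the parameter circle, so the curves at times n + p and n
    coincide as sets. *)
Lemma it_shift_on n a : on rho (fun u => it (n + p) (iota u)) a <-> on rho (fun u => it n (iota u)) a.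
Proof.
  assert (Hr := rho_bounds).
  assert (E : forall u, Cmod u = rho -> it (n + p) (iota u) = it n (iota (cis s * u)%C)).
  { intros u Hu. rewrite it_add. rewrite (proj1 (it_p u ltac:(unfold ann; lra))). reflexivity. }
  split; intros [u [Hu K]].
  - exists (cis s * u)%C. split. rewrite Cmod_mult, Cmod_cis, Hu. ring. now rewrite <- E.
  - exists (/ cis s * u)%C. assert (H := cis_neq_0 s).
    assert (Hu' : Cmod (/ cis s * u) = rho). { rewrite Cmod_mult, Cmod_inv, Cmod_cis, Hu by auto. field. }
    split; auto. rewrite E by auto. rewrite <- K. f_equal. f_equal. field. auto.
Qed.

(** The rotation shifts the parameter by [s], and the winding integral over a full period is
    invariant under shifts. *)
Lemma it_shift_wd n a : ~ on rho (fun u => it n (iota u)) a ->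
  wd rho (fun u => it (n + p) (iota u)) a = wd rho (fun u => it n (iota u)) a.
Proof.
  intros Ha. assert (Hr := rho_bounds). assert (HP := two_PI_pos).
  set (h := fun u => it n (iota u)). set (h' := fun u => it (n + p) (iota u)).
  assert (Hh := it_ring n). fold h in Hh.
  assert (E : forall u, ann r u -> h' u = h (cis s * u)%C).
  { intros u Hu. unfold h', h. rewrite it_add. now rewrite (proj1 (it_p u Hu)). }
  assert (Hann : forall t, ann r (circle rho t)) by (intro t; unfold ann; rewrite Cmod_circle; lra).
  assert (HL := ring_loop r rho h Hh).
  assert (Hoff : off (ploop h rho) a) by (apply off_on; auto; lra).
  unfold wd, wind.
  rewrite <- (cint_periodic (fun t => dploop h rho t / (ploop h rho t - a))%C s).
  - apply cint_ext. lra. intros t _. unfold ploop, dploop. rewrite <- rot_circle. set (u := circle rho t).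
    rewrite (E u (Hann t)).
    assert (Du : Cder h' u = (Cder h (cis s * u) * cis s)%C).
    { apply Cder_eq. destruct (ann_ball r u (Hann t)) as [d [Hd K]].
      apply der_loc with (fun w => h (cis s * w)%C) d; auto. intros w Hw. symmetry. apply E, K. exact Hw.
      eapply der_eq. apply (der_comp idC h (fun w => cis s * w)%C). apply Cder_spec. apply (ring_holo _ _ _ Hh).
      now apply ann_rot, Hann. apply der_scal, der_id. ring. }
    rewrite Du. field. unfold u. rewrite rot_circle. apply Csub_neq_0. apply (Hoff (t + s)).
  - apply (rd_s _ _ _ _ _ _ HV).
  - intro t. now apply wind_integrand_cont.
  - intro t. unfold ploop, dploop, circle. now rewrite cis_period.
Qed.

Lemma it_shift n a : (ins rho (fun u => it (n + p) (iota u)) a <-> ins rho (fun u => it n (iota u)) a) /\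
  (out rho (fun u => it (n + p) (iota u)) a <-> out rho (fun u => it n (iota u)) a).
Proof.
  unfold ins, out. rewrite it_shift_on. destruct (classic (on rho (fun u => it n (iota u)) a)) as [H|H]. tauto.
  rewrite it_shift_wd by auto. tauto.
Qed.

Lemma it_shift_k k n a :
  (on rho (fun u => it (n + k * p) (iota u)) a <-> on rho (fun u => it n (iota u)) a) /\
  (ins rho (fun u => it (n + k * p) (iota u)) a <-> ins rho (fun u => it n (iota u)) a) /\
  (out rho (fun u => it (n + k * p) (iota u)) a <-> out rho (fun u => it n (iota u)) a).
Proof.
  induction k as [|k IH]. simpl. rewrite Nat.add_0_r. tauto.
  replace (n + S k * p)%nat with (n + k * p + p)%nat by lia.
  rewrite it_shift_on. destruct (it_shift (n + k * p) a) as [-> ->]. exact IH.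
Qed.

Lemma it_kp_on k a : on rho (fun u => it (k * p) (iota u)) a <-> on rho iota a.
Proof. exact (proj1 (it_shift_k k 0 a)). Qed.

Lemma it_kp_ins k a : ins rho (fun u => it (k * p) (iota u)) a <-> ins rho iota a.
Proof. exact (proj1 (proj2 (it_shift_k k 0 a))). Qed.

Lemma it_kp_out k a : out rho (fun u => it (k * p) (iota u)) a <-> out rho iota a.
Proof. exact (proj2 (proj2 (it_shift_k k 0 a))). Qed.

Lemma it_mod n : exists j k, (j < p)%nat /\ n = (j + k * p)%nat.
Proof.
  exists (n mod p)%nat, (n / p)%nat. split. apply Nat.mod_upper_bound. lia.
  rewrite (Nat.div_mod_eq n p) at 1. lia.
Qed.

(** By periodicity only p curves occur, and each has a bounded inside. *)
Lemma it_bounded : exists M, forall n a, ins rho (fun u => it n (iota u)) a -> Cmod a <= M.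
Proof.
  assert (H : forall q, exists M, forall j, (j < q)%nat -> forall a, ins rho (fun u => it j (iota u)) a -> Cmod a <= M).
  { induction q as [|q [M HM]]. exists 0. lia.
    destruct (ring_far r rho _ (it_ring q)) as [M' HM']. exists (Rmax M M'). intros j Hj a Ha.
    destruct (Nat.eq_dec j q) as [->|Hjq].
    - apply Rle_trans with M'; [|apply Rmax_r]. apply Rnot_lt_le. intro K. apply HM' in K. apply ins_not_out in Ha. contradiction.
    - apply Rle_trans with M; [|apply Rmax_l]. apply (HM j); auto. lia. }
  destruct (H p) as [M HM]. exists M. intros n a Ha. destruct (it_mod n) as [j [k [Hj ->]]].
  apply (HM j Hj). now apply it_shift_k in Ha.
Qed.

Lemma b_off_it n : ~ on rho (fun u => it n (iota u)) b.
Proof.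
  assert (H : forall m, ~ on rho (fun u => it (S m) (iota u)) b).
  { intro m. apply (b_off b g r rho (fun u => it m (iota u)) (it_ring m)). intros u Hu. now apply it_alive. }
  (* For positive times [b] is avoided because it is omitted; time 0 is traded for time p. *)
  intro K. rewrite <- it_shift_on in K. destruct p as [|q]. lia. rewrite Nat.add_succ_r in K. now apply (H (n + q)%nat).
Qed.

Lemma on_V a : on rho iota a -> V a.
Proof. intros [u [Hu <-]]. apply (rd_in _ _ _ _ _ _ HV). assert (K := rho_bounds). unfold ann. lra. Qed.

Lemma fatou_of_orbit z : (exists d, 0 < d /\ forall w, Cmod (w - z) < d -> forall n, g (it n w) <> 0%C) ->
  (exists d M, 0 < d /\ forall w, Cmod (w - z) < d -> forall n, Cmod (it n w) <= M) -> fatou f z.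
Proof.
  intros [d1 [Hd1 H1]] [d2 [M [Hd2 H2]]]. apply (fatou_criterion f it z (Rmin d1 d2) M). now apply Rmin_pos.
  intros n w Hw. assert (K1 := Rmin_l d1 d2). assert (K2 := Rmin_r d1 d2).
  split; [|split]. apply fiter_iter_map; auto. intros k _. apply H1. lra.
  apply iter_map_holo; auto. intros k _. apply H1. lra. apply H2. lra.
Qed.

Lemma inside_fatou z : (forall n, out rho (fun u => it n (iota u)) b) -> ins rho iota z -> fatou f z.
Proof.
  intros Hb Hz. destruct (ins_open r rho iota z (it_ring 0) Hz) as [d [Hd H]]. destruct it_bounded as [M HM].
  assert (K : forall w, Cmod (w - z) < d -> forall n, ins rho (fun u => it n (iota u)) (it n w) /\ g (it n w) <> 0%C).
  { intros w Hw.
    assert (K : forall n, ins rho (fun u => it n (iota u)) (it n w) -> g (it n w) <> 0%C /\ ins rho (fun u => it (S n) (iota u)) (it (S n) w)).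
    { intros n Hn. apply (step_out_1 b g Hg r rho (fun u => it n (iota u)) (it_ring n)); auto.
      intros u Hu. now apply it_alive. apply (it_ring (S n)). apply (Hb (S n)). }
    assert (K0 : forall n, ins rho (fun u => it n (iota u)) (it n w)).
    { induction n. now apply H. now apply K. }
    intro n. split; auto. now apply K. }
  apply fatou_of_orbit.
  - exists d. split; auto. intros w Hw n. now apply K.
  - exists d, M. split; auto. intros w Hw n. apply (HM n). now apply K.
Qed.

(* Points of the ring that tend to a boundary circle of the annulus cannot accumulate in the ring. *)
Lemma inside_not_in_ring : ~ (forall z, ins rho iota z -> V z).
Proof.
  intro Hin. assert (Hr := rho_bounds). assert (HR : ring r rho iota) by exact (it_ring 0).
  assert (Hseq : forall (v : nat -> C) e, ~ (1 < e < r) -> (forall n, ann r (v n) /\ ins rho iota (iota (v n))) ->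
    (forall eps, 0 < eps -> exists N, forall n, (N <= n)%nat -> Rabs (Cmod (v n) - e) < eps) -> False).
  { intros v e He Hv Hlim. destruct it_bounded as [M HM].
    destruct (complex_subsequence (fun n => iota (v n)) M) as [phi [l [P1 P2]]].
    { intro n. apply (HM O). apply Hv. }
    assert (Vl : V l).
    { destruct (trichotomy rho iota l) as [K|[K|K]]; auto. now apply on_V. exfalso.
      destruct (out_open r rho iota l HR K) as [d [Hd H]]. destruct (P2 d Hd) as [N HN].
      assert (K2 := H _ (HN N (le_n N))). destruct (Hv (phi N)) as [_ K3]. apply ins_not_out in K3. contradiction. }
    destruct (rd_onto _ _ _ _ _ _ HV l Vl) as [u [Hu <-]].
    set (eps := Rabs (Cmod u - e) / 2).
    assert (Heps : 0 < eps).
    { assert (0 < Rabs (Cmod u - e)). { apply Rabs_pos_lt. intro E. apply He. unfold ann in Hu. lra. } unfold eps. lra. }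
    destruct (ring_open r rho iota HR u Hu eps Heps) as [del [Hdel K]].
    destruct (P2 del Hdel) as [N1 HN1]. destruct (Hlim eps Heps) as [N2 HN2].
    set (n := Nat.max N1 N2). specialize (HN1 n ltac:(lia)).
    assert (HN2' := HN2 (phi n) ltac:(generalize (increasing_ge phi P1 n); lia)).
    destruct (K _ HN1) as [w [W1 [W2 W3]]]. apply (ring_inj _ _ _ HR) in W3; auto; [|apply Hv]. subst w.
    assert (T1 := Cmod_tri_inv (v (phi n)) u). assert (T2 := Cmod_tri_inv u (v (phi n))). rewrite (Cmod_sub_sym u) in T2.
    assert (Rabs (Cmod u - e) < 2 * eps); [|unfold eps in *; lra]. apply Rabs_def2 in HN2'. apply Rabs_def1; lra. }
  destruct (ring_inner_values r rho iota HR) as [c [Hc [Hu _]]].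
  assert (Hp1 : per 1 <> 0%C). { rewrite <- per_0. intro E. apply per_inj in E. discriminate. }
  assert (Hlim : forall x eps, 0 < eps -> exists N, forall n, (N <= n)%nat -> Rabs (x * / INR (n + 2)) < eps).
  { intros x eps He. assert (0 <= Rabs x) by apply Rabs_pos. destruct (archimed_cor1 (eps / (Rabs x + 1))) as [N [HN HN0]].
    apply Rdiv_lt_0_compat; lra. exists N. intros n Hn.
    assert (I0 : 0 < INR N) by now apply lt_0_INR.
    assert (I1 : / INR (n + 2) <= / INR N) by (apply Rinv_le_contravar; auto; apply le_INR; lia).
    assert (I2 : 0 < / INR (n + 2)) by (apply Rinv_0_lt_compat, lt_0_INR; lia).
    rewrite Rabs_mult, (Rabs_pos_eq (/ INR (n + 2))) by lra.
    apply Rle_lt_trans with ((Rabs x + 1) * / INR (n + 2)). apply Rmult_le_compat_r; lra.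
    replace eps with ((Rabs x + 1) * (eps / (Rabs x + 1))) by (field; lra). apply Rmult_lt_compat_l; lra. }
  assert (Hhalf : forall n, 0 < / INR (n + 2) < 1).
  { intro n. split. apply Rinv_0_lt_compat, lt_0_INR; lia. rewrite <- Rinv_1. apply Rinv_lt_contravar.
    rewrite Rmult_1_l. apply lt_0_INR; lia. apply (lt_INR 1). lia. }
  assert (Hend : forall e, e = 1 \/ e = r ->
    (forall x, 1 < x < r -> (e - rho) * (x - rho) > 0 -> wd rho iota (iota (RtoC x)) <> 0%C) -> False).
  (* Real points that move from the side of rho towards the end radius e; n + 2 keeps the factor
     strictly between 0 and 1. *)
  { intros e He Hw. set (x := fun n : nat => e + (rho - e) * / INR (n + 2)).
    assert (Hx : forall n, 1 < x n < r /\ (e - rho) * (x n - rho) > 0).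
    { intro n. unfold x. specialize (Hhalf n). set (k := / INR (n + 2)) in *.
      replace ((e - rho) * (e + (rho - e) * k - rho)) with ((rho - e) * (rho - e) * (1 - k)) by ring.
      assert (K : forall a, 0 < a -> 0 < a * k /\ 0 < a * (1 - k)) by (intros a Ha; split; apply Rmult_lt_0_compat; lra).
      assert (K2 : 0 < (rho - e) * (rho - e)) by (destruct He as [-> | ->]; nra).
      destruct (K _ K2). destruct (K (rho - 1)); [lra|]. destruct (K (r - rho)); [lra|].
      destruct He as [-> | ->]; repeat split; lra. }
    assert (Ex : forall n, Cmod (RtoC (x n)) = x n). { intro n. destruct (Hx n). rewrite Cmod_R. apply Rabs_pos_eq. lra. }
    apply (Hseq (fun n => RtoC (x n)) e).
    - destruct He as [-> | ->]; lra.
    - intro n. destruct (Hx n) as [X1 X2]. assert (Ha : ann r (RtoC (x n))) by (unfold ann; rewrite Ex; lra).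
      split; auto. split; auto. apply (off_iota r rho iota HR); auto. rewrite Ex. intro E. rewrite E in X2. lra.
    - intros eps He0. destruct (Hlim (rho - e) eps He0) as [N HN]. exists N. intros n Hn. rewrite Ex. unfold x.
      replace (e + (rho - e) * / INR (n + 2) - e) with ((rho - e) * / INR (n + 2)) by ring. auto. }
  assert (Ec : forall x, 1 < x < r -> Cmod (RtoC x) = x) by (intros x Hx; rewrite Cmod_R; apply Rabs_pos_eq; lra).
  (* The value of [c] tells which side of the curve is inside: |u| < rho when [c] is 0, so the end
     used is 1; otherwise |u| > rho, with end r. *)
  destruct Hc as [-> | ->].
  - apply (Hend 1); auto. intros x Hx Hs. rewrite Hu; unfold ann; rewrite Ec; auto; [|nra].
    destruct (Rlt_dec x rho); [|nra]. now rewrite Cplus_0_l.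
  - apply (Hend r); auto. intros x Hx Hs. rewrite Hu; unfold ann; rewrite Ec; auto; [|nra].
    destruct (Rlt_dec x rho); [nra|]. rewrite Cplus_0_r. intro K0. apply Hp1.
    replace (per 1) with (- - per 1)%C by ring. rewrite K0. ring.
Qed.

(* Otherwise the iterates would be bounded inside the core curve, and the ring would contain its inside. *)
Lemma surrounds_b : is_component (fatou f) V -> exists j, (j < p)%nat /\ ins rho (fun u => it j (iota u)) b.
Proof.
  intros Hcomp. apply NNPP. intro Hn. assert (HR : ring r rho iota) by exact (it_ring 0).
  assert (Hb : forall n, out rho (fun u => it n (iota u)) b).
  { intro n. destruct (trichotomy rho (fun u => it n (iota u)) b) as [K|[K|K]]; auto; exfalso.
    now apply (b_off_it n). destruct (it_mod n) as [j [k [Hj ->]]]. apply Hn. exists j. split; auto. now apply it_shift_k in K. }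
  apply inside_not_in_ring. intros z Hz. apply NNPP. intro HnV.
  destruct (exists_out2 _ _ _ _ _ _ HR HR) as [o [Ho _]].
  assert (K : ins rho iota o /\ ~ V o).
  (* All points inside are now Fatou points, so membership in [V] is locally constant there, and
     near the curve every point is in [V]. *)
  { apply (plane_connected (fun z => ins rho iota z /\ ~ V z) z); auto. intros w.
    destruct (trichotomy rho iota w) as [K|[K|K]].
    - apply loc_false. destruct (component_open f V w Hcomp (on_V w K)) as [d [Hd H]]. exists d. split; auto.
      intros x Hx [_ Q]. auto.
    - apply loc_and. apply (ins_loc r); auto. apply K. apply loc_not. apply component_loc with f; auto. now apply inside_fatou.
    - apply loc_false. destruct (near_not_ins _ _ _ _ HR K) as [d [D1 D2]]. exists d. split; auto.
      intros x Hx [Q _]. now apply (D2 x). }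
  destruct K as [K _]. apply ins_not_out in K. contradiction.
Qed.
End OneRing.

Section TwoRings.
Context (V : C -> Prop) (r : R) (iota : C -> C) (s : R) (HV : ring_data f p V r iota s).
Context (W : C -> Prop) (r' : R) (eta : C -> C) (s' : R) (HW : ring_data f p W r' eta s').
Context (HcV : is_component (fatou f) V) (HcW : is_component (fatou f) W) (Hdisj : forall z, V z -> ~ W z).
Let rho := (1 + r) / 2.
Let rho' := (1 + r') / 2.

(** A common point at time n, iterated n p - n more steps, would be a common point of the two rings
    themselves. *)
Lemma it_disjoint n : curves_disjoint rho (fun u => it n (iota u)) rho' (fun u => it n (eta u)).
Proof.
  intros a [u [Hu E]] [v [Hv E']]. assert (K1 := rho_bounds V r iota s HV). assert (K2 := rho_bounds W r' eta s' HW).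
  assert (Ha : ann r u) by (unfold ann; rewrite Hu; exact K1). assert (Hb : ann r' v) by (unfold ann; rewrite Hv; exact K2).
  assert (K : it (n * p) (iota u) = it (n * p) (eta v)).
  { replace (n * p)%nat with ((n * p - n) + n)%nat by nia. rewrite !it_add. now rewrite E, E'. }
  rewrite (it_kp V r iota s HV) in K by auto. rewrite (it_kp W r' eta s' HW) in K by auto.
  apply (Hdisj (iota (cis (INR n * s) * u)%C)). apply (rd_in _ _ _ _ _ _ HV). now apply ann_rot.
  rewrite K. apply (rd_in _ _ _ _ _ _ HW). now apply ann_rot.
Qed.

Lemma between_fatou n0 : nested rho iota rho' eta ->
  (forall n z, (n0 <= n)%nat -> in_between rho (fun u => it n (iota u)) rho' (fun u => it n (eta u)) z ->
     g z <> 0%C /\ in_between rho (fun u => it (S n) (iota u)) rho' (fun u => it (S n) (eta u)) (fmap b g z)) ->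
  forall z, ins rho iota z -> out rho' eta z -> fatou f z.
Proof.
  intros Hn Hstep z Hz Hz'.
  destruct (ins_open r rho iota z (it_ring V r iota s HV 0) Hz) as [d1 [D1 D2]].
  destruct (out_open r' rho' eta z (it_ring W r' eta s' HW 0) Hz') as [d2 [D3 D4]].
  destruct (it_bounded V r iota s HV) as [M1 HM1]. destruct (it_bounded W r' eta s' HW) as [M2 HM2]. fold rho in HM1. fold rho' in HM2.
  set (d := Rmin d1 d2). assert (Hd : 0 < d) by now apply Rmin_pos.
  (* Advancing the curves, but not the orbit, by [n0 * p] steps changes no side, by periodicity, and
     brings all times above [n0]. *)
  assert (K : forall w, Cmod (w - z) < d -> forall n,
    in_between rho (fun u => it (n + n0 * p) (iota u)) rho' (fun u => it (n + n0 * p) (eta u)) (it n w)).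
  { intros w Hw n. induction n as [|n IH].
    - left. split; [|split].
      + intros a Ha. apply (it_kp_ins V r iota s HV n0). apply Hn. destruct Ha as [Ha|Ha]; [left|right].
        now apply (it_kp_ins W r' eta s' HW n0). now apply (it_kp_on W r' eta s' HW n0).
      + apply (it_kp_ins V r iota s HV n0). apply D2. eapply Rlt_le_trans. apply Hw. apply Rmin_l.
      + apply (it_kp_out W r' eta s' HW n0). apply D4. eapply Rlt_le_trans. apply Hw. apply Rmin_r.
    - apply (Hstep (n + n0 * p)%nat (it n w)); auto. nia. }
  apply fatou_of_orbit.
  - exists d. split; auto. intros w Hw n. apply (Hstep (n + n0 * p)%nat (it n w)). nia. now apply K.
  - exists d, (Rmax M1 M2). split; auto. intros w Hw n. destruct (K w Hw n) as [[_ [Q _]]|[_ [Q _]]].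
    + apply Rle_trans with M1; [|apply Rmax_l]. now apply HM1 in Q.
    + apply Rle_trans with M2; [|apply Rmax_r]. now apply HM2 in Q.
Qed.

(** If the gap were in the Fatou set, the points inside [iota] that do not belong to [V] would form
    an open and closed set. It contains the curve of [eta], so it would extend to points far
    away. *)
Lemma nested_contradiction : nested rho iota rho' eta -> ~ (forall z, ins rho iota z -> out rho' eta z -> fatou f z).
Proof.
  intros Hn Hf. assert (H1 : ring r rho iota) by exact (it_ring V r iota s HV 0). assert (H2 : ring r' rho' eta) by exact (it_ring W r' eta s' HW 0).
  assert (HdV : forall z, V z -> ~ on rho' eta z). { intros z Vz K. apply (Hdisj z Vz). now apply (on_V W r' eta s' HW). }
  (* [V] is connected and avoids the curve of [eta], and its own core curve is outside [eta]; so all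
     of [V] stays outside. *)
  assert (HVout : forall z, V z -> ~ ins rho' eta z).
  { intros z Vz Hz. set (a := iota (RtoC rho)).
    assert (K := rho_bounds V r iota s HV). fold rho in K.
    assert (Ha : on rho iota a). { exists (RtoC rho). split; auto. rewrite Cmod_R, Rabs_pos_eq; lra. }
    assert (Va : V a) by now apply (on_V V r iota s HV).
    assert (Hao : out rho' eta a).
    { destruct (trichotomy rho' eta a) as [Q|[Q|Q]]; auto; exfalso. now apply (HdV a).
      apply (ins_not_on rho iota a); auto. }
    destruct (component_path f V HcV z a Vz Va) as [T [T1 [T2 [T3 T4]]]].
    destruct (T1 (ins rho' eta) (out rho' eta)) as [x [_ [X1 X2]]].
    - intros x Hx. now apply (ins_open r').
    - intros x Hx. now apply (out_open r').
    - intros x Hx. destruct (trichotomy rho' eta x) as [Q|[Q|Q]]; auto. exfalso. apply (HdV x); auto.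
    - now exists z.
    - now exists a.
    - apply ins_not_out in X1. contradiction. }
  destruct (exists_out2 _ _ _ _ _ _ H1 H2) as [o [Ho _]].
  set (e := eta (RtoC rho')).
  assert (K := rho_bounds W r' eta s' HW). fold rho' in K.
  assert (He : on rho' eta e). { exists (RtoC rho'). split; auto. rewrite Cmod_R, Rabs_pos_eq; lra. }
  assert (Q : ins rho iota o /\ ~ V o).
  { apply (plane_connected (fun z => ins rho iota z /\ ~ V z) e).
    2:{ split. apply Hn. now right. intro Ve. now apply (HdV e). }
    intros w. destruct (trichotomy rho iota w) as [Hw|[Hw|Hw]].
    - apply loc_false. destruct (component_open f V w HcV (on_V V r iota s HV w Hw)) as [d [Hd H]]. exists d. split; auto.
      intros x Hx [_ Q]. auto.
    - apply loc_and. apply (ins_loc r); auto. apply Hw. apply loc_not. destruct (trichotomy rho' eta w) as [Q|[Q|Q]].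
      + apply component_loc with f; auto. apply (component_fatou f W HcW). now apply (on_V W r' eta s' HW).
      + apply loc_false. destruct (ins_open r' rho' eta w H2 Q) as [d [D1 D2]]. exists d. split; auto.
        intros x Hx Vx. now apply (HVout x Vx), D2.
      + apply component_loc with f; auto.
    - apply loc_false. destruct (near_not_ins _ _ _ _ H1 Hw) as [d [D1 D2]]. exists d. split; auto.
      intros x Hx [Q _]. now apply (D2 x). }
  destruct Q as [Q _]. apply ins_not_out in Q. contradiction.
Qed.
End TwoRings.

Lemma between_sym rho0 iota0 rho1 eta0 z : in_between rho0 iota0 rho1 eta0 z -> in_between rho1 eta0 rho0 iota0 z.
Proof. unfold in_between. tauto. Qed.

(* Disjoint rings whose images surround b at the same times cannot exist: the annulus between them would be mapped to the
   annulus between their images at every step, hence would lie in the Fatou set. *)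
Lemma same_type_meet V r iota s W r' eta s' : ring_data f p V r iota s -> ring_data f p W r' eta s' ->
  is_component (fatou f) V -> is_component (fatou f) W ->
  (forall j, (j < p)%nat -> ins ((1 + r) / 2) (fun u => it j (iota u)) b <-> ins ((1 + r') / 2) (fun u => it j (eta u)) b) ->
  exists z, V z /\ W z.
Proof.
  intros HV HW HcV HcW Htype. apply NNPP. intro Hn.
  assert (Hdisj : forall z, V z -> ~ W z) by (intros z K1 K2; apply Hn; now exists z).
  assert (Hdisj' : forall z, W z -> ~ V z) by (intros z K1 K2; apply Hn; now exists z).
  set (rho := (1 + r) / 2) in *. set (rho' := (1 + r') / 2) in *.
  assert (Ht : forall n, ins rho (fun u => it n (iota u)) b <-> ins rho' (fun u => it n (eta u)) b).
  { intro n. destruct (it_mod n) as [j [k [Hj ->]]].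
    assert (A := proj1 (proj2 (it_shift_k V r iota s HV k j b))). assert (B := proj1 (proj2 (it_shift_k W r' eta s' HW k j b))).
    specialize (Htype j Hj). fold rho in A. fold rho' in B. tauto. }
  assert (HdV := it_disjoint V r iota s HV W r' eta s' HW Hdisj). fold rho rho' in HdV.
  assert (HdW := it_disjoint W r' eta s' HW V r iota s HV Hdisj'). fold rho rho' in HdW.
  assert (RV := it_ring V r iota s HV). assert (RW := it_ring W r' eta s' HW). fold rho in RV. fold rho' in RW.
  set (N := fun n => nested rho (fun u => it n (iota u)) rho' (fun u => it n (eta u)) \/
                     nested rho' (fun u => it n (eta u)) rho (fun u => it n (iota u))).
  assert (SV : forall n, nested rho (fun u => it n (iota u)) rho' (fun u => it n (eta u)) -> N (S n) /\
    forall z, ins rho (fun u => it n (iota u)) z -> out rho' (fun u => it n (eta u)) z ->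
    g z <> 0%C /\ in_between rho (fun u => it (S n) (iota u)) rho' (fun u => it (S n) (eta u)) (fmap b g z)).
  { intros n. apply (nested_step b g r rho (fun u => it n (iota u)) r' rho' (fun u => it n (eta u)) Hg (RV n) (RW n)).
    intros u Hu. now apply (it_alive V r iota s HV). intros u Hu. now apply (it_alive W r' eta s' HW).
    apply (RV (S n)). apply (RW (S n)). apply (HdV (S n)). apply (Ht (S n)). }
  assert (SW : forall n, nested rho' (fun u => it n (eta u)) rho (fun u => it n (iota u)) -> N (S n) /\
    forall z, ins rho' (fun u => it n (eta u)) z -> out rho (fun u => it n (iota u)) z ->
    g z <> 0%C /\ in_between rho (fun u => it (S n) (iota u)) rho' (fun u => it (S n) (eta u)) (fmap b g z)).
  { intros n Hnn.
    destruct (nested_step b g r' rho' (fun u => it n (eta u)) r rho (fun u => it n (iota u)) Hg (RW n) (RV n)) as [A B]; auto.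
    intros u Hu. now apply (it_alive W r' eta s' HW). intros u Hu. now apply (it_alive V r iota s HV).
    apply (RW (S n)). apply (RV (S n)). apply (HdW (S n)). symmetry. apply (Ht (S n)).
    split. destruct A; [right|left]; auto. intros z Z1 Z2. destruct (B z Z1 Z2) as [B1 B2]. split; auto. now apply between_sym. }
  (* A common point [b] of the two insides makes the curves nested at time [j0], which starts the
     propagation. *)
  destruct (surrounds_b V r iota s HV HcV) as [j0 [_ Hj0]]. fold rho in Hj0.
  assert (N0 : N j0).
  { apply (nested_of_common r rho _ r' rho' _ b); auto. now apply Ht. }
  assert (Nn : forall k, N (k + j0)%nat).
  { induction k as [|k IH]; auto. destruct IH as [IH|IH]; [now apply SV|now apply SW]. }
  assert (Hstep : forall n z, in_between rho (fun u => it n (iota u)) rho' (fun u => it n (eta u)) z ->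
    g z <> 0%C /\ in_between rho (fun u => it (S n) (iota u)) rho' (fun u => it (S n) (eta u)) (fmap b g z)).
  { intros n z [[K1 [K2 K3]]|[K1 [K2 K3]]]. now apply SV. now apply SW. }
  (* The time [j0 * p] is reached from [j0] by forward steps, and being a multiple of p it shows the
     original core curves again. *)
  assert (Hper : N (0 + j0 * p)%nat).
  { replace (0 + j0 * p)%nat with ((j0 * p - j0) + j0)%nat by nia. apply Nn. }
  destruct Hper as [Hper|Hper].
  - assert (Hnest : nested rho iota rho' eta).
    { intros a Ha. apply (it_kp_ins V r iota s HV j0). apply Hper. destruct Ha as [Ha|Ha]; [left|right].
      now apply (it_kp_ins W r' eta s' HW j0). now apply (it_kp_on W r' eta s' HW j0). }
    apply (nested_contradiction V r iota s HV W r' eta s' HW HcV HcW Hdisj Hnest).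
    apply (between_fatou V r iota s HV W r' eta s' HW 0 Hnest). intros n z _. apply Hstep.
  - assert (Hnest : nested rho' eta rho iota).
    { intros a Ha. apply (it_kp_ins W r' eta s' HW j0). apply Hper. destruct Ha as [Ha|Ha]; [left|right].
      now apply (it_kp_ins V r iota s HV j0). now apply (it_kp_on V r iota s HV j0). }
    apply (nested_contradiction W r' eta s' HW V r iota s HV HcW HcV Hdisj' Hnest).
    apply (between_fatou W r' eta s' HW V r iota s HV 0 Hnest). intros n z _ K. apply between_sym in K.
    destruct (Hstep n z K) as [K1 K2]. split; auto. now apply between_sym.
Qed.
End RingDynamics.

(** * Counting the rings by type *)

Fixpoint bit_lists (n : nat) : list (list bool) :=
  match n with O => nil :: nil | S m => map (cons true) (bit_lists m) ++ map (cons false) (bit_lists m) end.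

Lemma bit_lists_spec (P : nat -> Prop) n : exists l, In l (bit_lists n) /\ forall j, (j < n)%nat -> (nth j l false = true <-> P j).
Proof.
  revert P. induction n as [|n IH]; intros P.
  - exists nil. split. now left. lia.
  - destruct (IH (fun j => P (S j))) as [l [Hl H]]. destruct (classic (P O)) as [H0|H0].
    + exists (true :: l). split. simpl. apply in_or_app. left. now apply in_map.
      intros [|j] Hj; simpl. tauto. apply H. lia.
    + exists (false :: l). split. simpl. apply in_or_app. right. now apply in_map.
      intros [|j] Hj; simpl. split; [discriminate|tauto]. apply H. lia.
Qed.

Theorem theorem1p1 :
  forall (f : C -> sphere), class_MS f ->
  forall p : nat, (3 <= p)%nat ->
  exists L : list (C -> Prop),
    forall V, herman_ring f p V -> exists W, In W L /\ forall z, V z <-> W z.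
Proof.
  intros f [[Hmer _] [b [[Hb _] _]]] p Hp.
  destruct (omitted_value_reciprocal f b Hmer Hb) as [g Hfg].
  set (has_type := fun (V : C -> Prop) (l : list bool) => exists r iota s, ring_data f p V r iota s /\
    forall j, (j < p)%nat -> (nth j l false = true <-> ins ((1 + r) / 2) (fun u => iter_map b g j (iota u)) b)).
  (* Each entry is the union of all rings of one type. As rings of the same type coincide, it equals
     each of them, and no representative has to be chosen; a type that does not occur contributes
     the empty set. *)
  exists (map (fun l z => exists V, herman_ring f p V /\ has_type V l /\ V z) (bit_lists p)).
  intros V HV. destruct (herman_ring_data f p V HV) as [r [iota [s Hd]]].
  destruct (bit_lists_spec (fun j => ins ((1 + r) / 2) (fun u => iter_map b g j (iota u)) b) p) as [l [Hl Htype]].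
  assert (HT : has_type V l) by (exists r, iota, s; auto).
  exists (fun z => exists V, herman_ring f p V /\ has_type V l /\ V z). split.
  - apply (in_map (fun l z => exists V, herman_ring f p V /\ has_type V l /\ V z)). exact Hl.
  - intros z. split. intro Vz. now exists V.
    intros [W [HW [[r' [eta [s' [Hd' Htype']]]] Wz]]].
    assert (HcV : is_component (fatou f) V) by apply HV. assert (HcW : is_component (fatou f) W) by apply HW.
    destruct (same_type_meet f b g Hfg p ltac:(lia) V r iota s W r' eta s' Hd Hd' HcV HcW) as [x [Vx Wx]].
    { intros j Hj. rewrite <- Htype, <- Htype' by auto. tauto. }
    now apply (component_eq f V W x HcV HcW Vx Wx).
Qed.
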